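(* Let $p\in(1,+\infty)$ and $m\in\mathbb N\setminus\{0\}$, and let $\mathcal K_1=\mathcal K_1(p,m)$ and $\mathcal K_3=\mathcal K_3(p,m)$ be the constants given in the context. For any function $f$ on $I=(0,1)$ such that $\|f\|_\infty=1$ and $f=h\phi$, with $h$ positive and concave on $I$ and $\phi$ positive and $(\frac1m)$-concave on $I$, the following implication holds: $$\mu_p(I,f)\le\pi_p^p+1\quad\Longrightarrow\quad\mu_p(I,f)\ \ge\ \pi_p^p+\mathcal K_1\,\min_{[\mathcal K_3,\,1-\mathcal K_3]}\Big(\frac{h'}h\Big)^2.$$
   Context: For an open interval $I$ and a positive weight $f\in L^1(I)$, $$\mu_p(I,f):=\inf\Big\{\frac{\int_If|u'|^p}{\int_If|u|^p}\ :\ u\in W^{1,p}(I,f)\setminus\{0\},\ \int_If|u|^{p-2}u=0\Big\},$$ where $W^{1,p}(I,f)$ is the usual weighted Sobolev space (functions with weak derivative such that $\int_If(|u|^p+|u'|^p)<\infty$). A positive function $\phi$ is $\alpha$-concave if $\phi^\alpha$ is concave. $\pi_p:=2\pi\frac{(p-1)^{1/p}}{p\sin(\pi/p)}$. If the concave function $h$ is not differentiable everywhere, the minimum of $(h'/h)^2$ is understood as the infimum over the points of the interval at which $h$ is differentiable. Constants. For an integer $k\ge2$ let $\omega_k$ be the Lebesgue measure of the unit ball in $\mathbb R^k$ and $$\mathcal K_\infty(k):=2^{2k}\,\omega_k^{-1}\,(1+4k^{k+1})^k\Big(\frac k{k-1}\Big)^{k(k-1)}.$$ Set $$\gamma=\gamma(p,m):=\mathcal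 K_\infty(m+1)\,(\pi_p^p+1)^{\frac{m+1}p}\Big(\int_0^1\min\{x,1-x\}^{m+1}\,dx\Big)^{-\frac1p}.$$ For $p>1$, $a\in(0,1)$, $s,t>0$ set $$b_0=b_0(p,a,s,t):=\min\Big\{\frac a2,\Big(\frac12\,\frac{p-1}p\,\frac st\Big)^{\frac p{p-1}}\Big\},$$ $$M(p,a,s,t):=\begin{cases}\big(\frac{p-1}p\big)^{p-1}\min\big\{\frac{b_0^2}2,\ \frac{b_0}2\,s^{\frac p{p-1}}\big\}&\text{if }p\in(1,2),\\[4pt] \frac12\big(\frac{p-1}p\big)^{p-1}b_0^{p-1}s^p&\text{if }p\ge2.\end{cases}$$ Then $$\mathcal K_1(p,m):=\frac1{2^{\frac1{p-1}}}\;\frac{e^{-(m+1)2^{m+3}\gamma^{p(m+2)}}}{\gamma^{\frac{2p^2-p}{p-1}}}\;M\Big(p,\ \frac1{4\gamma^p},\ \frac1{(4\gamma)^{\frac1{p-1}}},\ (4\gamma^p)^{m+1}(\pi_p^p+1)\Big),\qquad \mathcal K_3(p,m):=\frac1{4\gamma^p}.$$ *)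

(* Defs.v *)
From HB Require Import structures.
From mathcomp Require Import all_boot all_order all_algebra.
From mathcomp Require Import all_classical all_reals all_analysis.

Set Implicit Arguments.
Unset Strict Implicit.
Unset Printing Implicit Defensive.

Import Order.TTheory GRing.Theory Num.Theory.
Import numFieldNormedType.Exports.

Local Open Scope classical_set_scope.
Local Open Scope ring_scope.

Section defs.
Context {R : realType}.
Notation mu := (@lebesgue_measure R).

Definition unit_itv : set R := `]0, 1[.

Definition ess_norm (I : set R) (f : R -> R) : \bar R :=
  ('N[mu]_+oo[EFin \o (f \_ I)%R])%E.

Definition concave_on (D : set R) (g : R -> R) : Prop :=
  convex_function D (fun x => - g x).

Definition power_concave_on (alpha : R) (D : set R) (g : R -> R) : Prop :=
  concave_on D (fun x => g x `^ alpha).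

(* The space of test functions C_c^oo(I). *)
Definition test_function (I : set R) (psi : R -> R) : Prop :=
  (forall n x, derivable (psi^`(n))%classic x 1) /\
  (exists K : set R, [/\ compact K, K `<=` I & forall x, ~ K x -> psi x = 0]).

Definition weak_derivative (I : set R) (u v : R -> R) : Prop :=
  [/\ locally_integrable I u, locally_integrable I v &
      forall psi, test_function I psi ->
        \int[mu]_(x in I) (u x * psi^`()%classic x) =
        - \int[mu]_(x in I) (v x * psi x)].

(* u belongs to W^{1,p}(I, f), with weak derivative v.  Functions are given on
   all of R, but only their values in I (up to null sets) matter. *)
Definition weighted_sobolev (p : R) (I : set R) (f u v : R -> R) : Prop :=
  weak_derivative I u v /\
  (\int[mu]_(x in I) (f x * (`|u x| `^ p + `|v x| `^ p))%:E < +oo)%E.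

(* The infimum is taken in the extended reals, so that it is meaningful without
   side conditions.  The vanishing of the integral of f |u|^(p-2) u is also an
   extended-real equation, in which a non-integrable integrand has an infinite
   integral rather than a default value; both integrals in the quotient are
   finite by weighted_sobolev. *)
Definition mu_p (p : R) (I : set R) (f : R -> R) : \bar R :=
  ereal_inf [set q : \bar R | exists u v : R -> R,
    [/\ weighted_sobolev p I f u v,
        ~ ae_eq mu I u (fun=> 0),
        (\int[mu]_(x in I) (f x * (`|u x| `^ (p - 2) * u x))%:E = 0)%E &
        q = ((\int[mu]_(x in I) (f x * `|v x| `^ p)) /
             (\int[mu]_(x in I) (f x * `|u x| `^ p)))%:E]].

Definition pi_p (p : R) : R :=
  2 * pi * ((p - 1) `^ p^-1 / (p * sin (pi / p))).

(* k-dimensional Lebesgue measure on k.-tuple R, as the iterated product of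
   the one-dimensional one. *)
Fixpoint lebesgue_tuple (k : nat) : set (k.-tuple R) -> \bar R :=
  match k return set (k.-tuple R) -> \bar R with
  | 0 => dirac [tuple]
  | n.+1 => pushforward (mu \x @lebesgue_tuple n)%E
              (fun z : R * n.-tuple R => [tuple of z.1 :: z.2])
  end.

Definition unit_ball (k : nat) : set (k.-tuple R) :=
  [set x | \sum_(i < k) tnth x i ^+ 2 < 1].

Definition omega (k : nat) : R := fine (lebesgue_tuple (@unit_ball k)).

Definition K_infty (k : nat) : R :=
  2 ^+ (2 * k)%N * (omega k)^-1 * (1 + 4 * k%:R ^+ k.+1) ^+ k *
  (k%:R / (k%:R - 1)) ^+ (k * (k - 1))%N.

Definition gamma (p : R) (m : nat) : R :=
  K_infty m.+1 * (pi_p p `^ p + 1) `^ (m.+1%:R / p) *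
  (\int[mu]_(x in `[0, 1]) (Num.min x (1 - x) ^+ m.+1)) `^ (- p^-1).

Definition b0 (p a s t : R) : R :=
  Num.min (a / 2) ((2^-1 * ((p - 1) / p) * (s / t)) `^ (p / (p - 1))).

Definition M (p a s t : R) : R :=
  let b := b0 p a s t in
  if p < 2 then
    ((p - 1) / p) `^ (p - 1) *
      Num.min (b ^+ 2 / 2) (b / 2 * s `^ (p / (p - 1)))
  else 2^-1 * ((p - 1) / p) `^ (p - 1) * b `^ (p - 1) * s `^ p.

Definition K1 (p : R) (m : nat) : R :=
  let g := gamma p m in
  (2 `^ (p - 1)^-1)^-1 *
  (expR (- (m.+1%:R * 2 ^+ (m + 3)%N * g `^ (p * (m + 2)%:R))) /
   g `^ ((2 * p ^+ 2 - p) / (p - 1))) *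
  M p (4 * g `^ p)^-1 ((4 * g) `^ (p - 1)^-1)^-1
    ((4 * g `^ p) ^+ m.+1 * (pi_p p `^ p + 1)).

Definition K3 (p : R) (m : nat) : R := (4 * gamma p m `^ p)^-1.

End defs.

(* Main.v *)
(* A lower bound [nu] for the Rayleigh quotient follows, by a weighted Young
   inequality and Tonelli, from a point [x0] such that the weight admits, on both
   sides of [x0], a solution of the differential inequality that the derivative
   of a Neumann eigenfunction would satisfy.  In the Riccati variable this
   inequality only involves upper bounds for the slopes of [ln f], which decrease
   because [ln f = ln h + ln phi] is concave: [x0] is chosen where the slope of
   [ln f] crosses a value [a] for which the two Riccati times, for the slopes
   [a] and [- a], fit exactly into [(0, 1)].  These two times add up to at least
   twice the time for slope 0, that is [(pi_p p `^ p / nu) `^ p^-1].  To the right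
   of a point [z] at which [h'/h] does not vanish, the concavity of [h] alone makes
   [ln f] steeper by a multiple of [(h'/h)^2 z]; this shortens one of the times
   and leaves room for [nu] beyond [pi_p p `^ p].  Only the values of [h'/h] at one
   point on each side of [1/2] are needed, and [K1] is far below the gain. *)
Require Import Defs.
From HB Require Import structures.
From mathcomp Require Import all_boot all_order all_algebra.
From mathcomp Require Import all_classical all_reals all_analysis.
From mathcomp Require Import measurable_realfun ring lra.

Import Order.TTheory GRing.Theory Num.Theory.
Import numFieldNormedType.Exports.

Local Open Scope classical_set_scope.
Local Open Scope ring_scope.

Set Implicit Arguments.
Unset Strict Implicit.

(** With [E' = k] and [f k^(p-1)] the flux of a Neumann eigenfunction, the Riccati variable is
    [eta = (k / E)^(p-1)]. It would satisfy [- eta' = nu + (ln f)' eta + (p-1) eta^q], where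
    [q = p / (p-1)], and fall from infinity at [x0] to 0 at 1. No eigenfunction is constructed: an
    upper bound [a] for the slope turns this into an autonomous equation, solved by inverting its
    time function. Only values [nu] strictly below the target are treated, so [eta] may start from a
    large finite [S] and no improper integral occurs. The two times add up well because [1/X] is
    convex: [1/(A + a s) + 1/(A - a s) >= 2/A]. The obstacle is the position of [x0]: the steepening
    holds only to the right of a tangency point that lies beyond [x0]. The left piece is therefore
    capped at length 1/2. Either the crossing occurs before 1/2, or the left field alone is obtained
    at 1/2; the same alternative for the reflected weight then provides the right one. The
    constraint on [u] enters only through [centering], which permits subtracting from [u] its value
    at [x0]. *)

(** * Calculus, Young's inequality and reflection *)

Lemma le_derive_increment (R : realType) (F F' G G' : R -> R) (a b : R) :
  a <= b ->
  {within `[a, b], continuous F} -> {within `[a, b], continuous G} ->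
  (forall x, a < x < b -> is_derive x 1 F (F' x)) ->
  (forall x, a < x < b -> is_derive x 1 G (G' x)) ->
  (forall x, a < x < b -> F' x <= G' x) ->
  F b - F a <= G b - G a.
Proof.
rewrite le_eqVlt => /predU1P[->|ab] cF cG dF dG FG; first by rewrite !subrr.
have dGF x : x \in `]a, b[ -> is_derive x 1 (G - F) (G' x - F' x).
  rewrite in_itv/= => xab; have := dF x xab; have := dG x xab => ? ?.
  exact: is_deriveB.
have cGF : {within `[a, b], continuous (G - F)}.
  by move=> x; first [exact: cvgB (cG x) (cF x) | apply: continuousD; [exact: cG|apply: continuousN; exact: cF]].
have [c + E] := MVT ab dGF cGF.
rewrite in_itv/= => /FG Fc.
rewrite -subr_ge0.
suff -> : G b - G a - (F b - F a) = (G' c - F' c) * (b - a).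
  by rewrite mulr_ge0 ?subr_ge0// ltW.
by rewrite -E !fctE; ring.
Qed.

Lemma is_derive_continuous (R : realType) (F : R -> R) (x l : R) :
  is_derive x 1 F l -> {for x, continuous F}.
Proof. by move=> [d _]; apply: differentiable_continuous; apply/derivable1_diffP. Qed.

Lemma primitive_exists (R : realType) (g : R -> R) : continuous g ->
  exists G : R -> R, (forall x : R, is_derive x 1 G (g x)) /\
    forall a b, a <= b ->
    (\int[@lebesgue_measure R]_(x in `[a, b]) (g x)%:E = (G b - G a)%:E)%E.
Proof.
move=> cg.
pose I a x : R := \int[@lebesgue_measure R]_(t in `[a, x]) g t.
have ig a b : (@lebesgue_measure R).-integrable `[a, b] (EFin \o g).
  apply: continuous_compact_integrable; first exact: segment_compact.
  exact: continuous_subspaceT.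
have Isplit a b c : a <= b -> b <= c -> I a c = I a b + I b c.
  move=> ab bc; rewrite /I.
  have := @Rintegral_itvB _ g (BLeft a) (BRight c) b (ig a c).
  rewrite !bnd_simp => /(_ ab bc) E.
  rewrite -[X in _ = _ + X](@Rintegral_itv_obnd_cbnd _ b (BRight c) g); last first.
    by apply: integrableS (ig b c) => //; apply: subset_itvr; rewrite bnd_simp.
  by rewrite -E addrC subrK.
(* The fundamental theorem of calculus only serves points to the right of the base point, so the
   base point moves with [x]; by [GE] any fixed base point below 0 and [x] gives the same value. *)
pose G x := I (- `|x| - 1) x - I (- `|x| - 1) 0.
have GE a x : a < 0 -> a < x -> G x = I a x - I a 0.
  move=> a0 ax; rewrite /G.
  set b := - `|x| - 1.
  have b0 : b <= 0 by rewrite /b; have := normr_ge0 x; lra.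
  have bx : b <= x by rewrite /b; have := ler_norm (- x); rewrite normrN; lra.
  have [ab|ba] := leP a b.
    by rewrite (Isplit a b x)// (Isplit a b 0)//; ring.
  by rewrite (Isplit b a x) ?(ltW ba)// ?(Isplit b a 0) ?(ltW ba) ?(ltW a0) ?(ltW ax)//; ring.
exists G; split.
- move=> x.
  set a := - `|x| - 1.
  have a0 : a < 0 by rewrite /a; have := normr_ge0 x; lra.
  have ax : a < x by rewrite /a; have := ler_norm (- x); rewrite normrN; lra.
  have xx1 : x < x + 1 by lra.
  have [d1 d2] := @continuous_FTC1_closed R g a x (x + 1) xx1 (ig _ _) ax (cg x).
  have dI : is_derive x 1 (fun y => I a y - I a 0) (g x).
    have dI : is_derive x 1 (I a) (g x) by split; [exact: d1|rewrite -derive1E].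
    have := is_deriveB dI (is_derive_cst (I a 0) x 1).
    by rewrite subr0.
  apply: near_eq_is_derive dI.
  near=> y; rewrite (GE a)//.
  by near: y; exact: lt_nbhsr.
- move=> a b ab.
  set c := Num.min a 0 - 1.
  have [ca c0] : c <= a /\ c < 0 by rewrite /c; case: (leP a 0) => ?; split; lra.
  have cb := le_trans ca ab.
  have [c1 [c1a c1b]] : c - 1 < 0 /\ c - 1 < a /\ c - 1 < b by split; [lra|split; lra].
  rewrite (GE (c - 1) a)// (GE (c - 1) b)//.
  rewrite (Isplit (c - 1) a b) ?(ltW c1a)//.
  rewrite [X in _ = X%:E](_ : _ = I a b); last by ring.
  by rewrite /I /Rintegral fineK//; apply: integrable_fin_num.
Unshelve. all: by end_near. Qed.

Lemma is_derive_within_continuous (R : realType) (F F' : R -> R) (A : set R) :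
  (forall x : R, is_derive x 1 F (F' x)) -> {within A, continuous F}.
Proof.
by move=> dF; apply: continuous_subspaceT => x; apply: is_derive_continuous.
Qed.

Lemma is_derive_increasing (R : realType) (F F' : R -> R) :
  (forall x : R, is_derive x 1 F (F' x)) -> (forall x, 0 < F' x) ->
  {mono F : x y / x < y}.
Proof.
move=> dF F'0; apply: leW_mono; apply: le_mono => x y xy.
have [c _ E] := @MVT _ F F' x y xy (fun c _ => dF c) (is_derive_within_continuous dF).
by rewrite -subr_gt0 E mulr_gt0 ?subr_gt0.
Qed.

(** Separation of variables: for [s >= 0], [T s] is the time needed to descend from [s] to 0 at
    speed [D], and [eta] inverts it so as to reach 0 at 1. The bound [m] keeps [D] positive; the
    bound [c] makes [T] unbounded in both directions, so that [eta] is defined on the whole line. *)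
Lemma autonomous_ode (R : realType) (D : R -> R) (m c : R) :
  continuous D -> 0 < m -> (forall s, m <= D s <= c) ->
  exists T eta : R -> R,
    [/\ forall s : R, is_derive s 1 T (D s)^-1, T 0 = 0,
        forall x, T (eta x) = 1 - x &
        forall x : R, is_derive x 1 eta (- D (eta x))].
Proof.
move=> cD m0 Dmc.
have D0 s : 0 < D s by have /andP[] := Dmc s; lra.
have c0 : 0 < c by have /andP[] := Dmc 0; lra.
have cV : continuous (fun s => (D s)^-1).
  by move=> s; apply: continuousV; [rewrite gt_eqF|exact: cD].
have [T0 [dT0 _]] := primitive_exists cV.
pose T s := T0 s - T0 0.
have dT (s : R) : is_derive s 1 T (D s)^-1.
  have := is_deriveB (dT0 s) (is_derive_cst (T0 0) s 1).
  by rewrite subr0.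
have T00 : T 0 = 0 by rewrite /T subrr.
have Tmono := is_derive_increasing dT (fun s => ltac:(by rewrite invr_gt0)).
have cT : continuous T by move=> s; exact: is_derive_continuous (dT s).
have Tge a b : a <= b -> c^-1 * (b - a) <= T b - T a.
  move=> ab.
  have dl (x : R) : is_derive x 1 (fun x : R => c^-1 * x) (c^-1).
    by have := is_deriveZ c^-1 (is_derive_id x 1); rewrite /GRing.scale/= mulr1.
  have := @le_derive_increment _ _ (fun=> c^-1) T (fun s => (D s)^-1) a b ab
    (is_derive_within_continuous dl) (is_derive_within_continuous dT)
    (fun x _ => dl x) (fun x _ => dT x).
  rewrite mulrBr; apply => x _.
  by rewrite lef_pV2 ?posrE//; have /andP[] := Dmc x.
have Tsurj y : exists s, T s = y.
  pose b := c * `|y|.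
  have b0 : 0 <= b by rewrite mulr_ge0// ltW.
  have Tb : `|y| <= T b.
    by have := Tge 0 b b0; rewrite T00 !subr0 /b mulKf ?gt_eqF.
  have TNb : T (- b) <= - `|y|.
    by have := Tge (- b) 0 (ltac:(lra)); rewrite T00 sub0r opprK /b mulKf ?gt_eqF//; lra.
  have [|s _ <-] := @IVT R T (- b) b y (ltac:(lra)) (continuous_subspaceT cT); last by exists s.
  rewrite ge_min le_max; apply/andP; split; apply/orP; [left|right].
    by apply: (le_trans TNb); rewrite lerNl -normrN ler_norm.
  by apply: le_trans Tb; exact: ler_norm.
pose g y := projT1 (cid (Tsurj y)).
have gK y : T (g y) = y by rewrite /g; case: cid.
have Tinj : injective T.
  move=> a b E; apply/eqP; rewrite eq_le !leNgt.
  by apply/andP; split; rewrite -Tmono E ltxx.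
have Kg s : g (T s) = s by apply: Tinj; rewrite gK.
have dg (y : R) : is_derive y 1 g (D (g y)).
  have := @is_derive_inverse R T g (D (g y))^-1 (g y).
  rewrite gK invrK; apply => //.
  - by near=> z; exact: Kg.
  - by near=> z; exact: cT.
  - by rewrite invr_eq0 gt_eqF.
exists T, (fun x => g (1 - x)); split => // x.
have dl : is_derive x 1 (fun x : R => 1 - x) (- 1).
  by have := is_deriveB (is_derive_cst (1:R) x 1) (is_derive_id x 1); rewrite sub0r.
have := @is_derive1_comp R g (fun x => 1 - x) x _ _ (dg (1 - x)) dl.
by rewrite mulrN1.
Unshelve. all: by end_near. Qed.

Lemma continuous_norm_powR (R : realType) (r : R) : 0 < r ->
  continuous (fun x : R => `|x| `^ r).
Proof.
move=> r0 x; have [->|x0] := eqVneq x 0.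
  rewrite /continuous_at normr0 powR0 ?gt_eqF//.
  apply/cvgrPdist_lt => e e0.
  near=> y.
  rewrite sub0r normrN ger0_norm ?powR_ge0//.
  have -> : e = (e `^ r^-1) `^ r by rewrite -powRrM mulVf ?gt_eqF// powRr1 ?ltW.
  rewrite gt0_ltr_powR ?nnegrE ?powR_ge0//.
  near: y; exists (e `^ r^-1); first by rewrite /= powR_gt0.
  by move=> z /=; rewrite sub0r normrN.
have nx : 0 < `|x| by rewrite normr_gt0.
have c1 : {for x, continuous (fun y : R => expR (r * ln `|y|))}.
  apply: continuous_comp; last exact: continuous_expR.
  apply: cvgM; first exact: cvg_cst.
  apply: (@continuous_comp _ _ _ (fun y : R => `|y|) (@ln R)); first exact: norm_continuous.
  exact: continuous_ln.
have c2 : `|x| `^ r = expR (r * ln `|x|) by rewrite /powR gt_eqF.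
rewrite /continuous_at c2; apply: (cvg_trans _ c1); apply: near_eq_cvg.
near=> y.
by rewrite /powR gt_eqF// normr_gt0; near: y; exists `|x| => //= y; apply: contraTneq => ->; rewrite subr0 ltxx.
Unshelve. all: by end_near. Qed.

(** The convex function [b ^ p] lies above its tangent at [a]; this is Young's inequality for [b]
    and [a ^ (p - 1)]. *)
Lemma young_tangent (R : realType) (p a b : R) : 1 < p -> 0 <= a -> 0 <= b ->
  p * (a `^ (p - 1) * b) <= (p - 1) * a `^ p + b `^ p.
Proof.
move=> p1 a0 b0.
have p0 : 0 < p by lra.
have q0 : 0 < p / (p - 1) by rewrite divr_gt0; lra.
have pq : p^-1 + (p / (p - 1))^-1 = 1 by rewrite invf_div; field; lra.
have := @conjugate_powR R b (a `^ (p - 1)) p (p / (p - 1)) b0 (powR_ge0 _ _) p0 q0 pq.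
rewrite -powRrM (_ : (p - 1) * (p / (p - 1)) = p); last by field; lra.
rewrite -(ler_pM2l p0) => /le_trans.
have -> : p * (b `^ p / p + a `^ p / (p / (p - 1))) = (p - 1) * a `^ p + b `^ p.
  by field; lra.
by rewrite [b * _]mulrC; apply.
Qed.

(** The convex function [|.| ^ p], with derivative [p |u|^(p-2) u], lies above its tangent at [u];
    the tangent is evaluated at [u - c]. *)
Lemma young_shift (R : realType) (p u c : R) : 1 < p ->
  `|u| `^ p <= `|u - c| `^ p + p * c * (`|u| `^ (p - 2) * u).
Proof.
move=> p1.
have uE : `|u| `^ (p - 2) * u * u = `|u| `^ p.
  have [->|u0] := eqVneq u 0; first by rewrite normr0 mulr0 powR0//; lra.
  have -> : p = (p - 2) + 2 by lra.
  rewrite [in RHS]powRD; last by rewrite normr_eq0 u0 implybT.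
  by rewrite addrK -mulrA (powR_mulrn 2)// real_normK ?num_real// expr2.
have nE : `|u| `^ (p - 1) * `|u - c| >= `|u| `^ (p - 2) * u * (u - c).
  apply: (le_trans (ler_norm _)); rewrite !normrM [`|_ `^ _|]ger0_norm ?powR_ge0//.
  rewrite ler_wpM2r//.
  have [->|u0] := eqVneq u 0; first by rewrite normr0 mulr0 powR_ge0.
  have -> : p - 1 = (p - 2) + 1 by lra.
  rewrite (@powRD _ _ (p - 2) 1); last by rewrite normr_eq0 u0 implybT.
  by rewrite powRr1.
have := @young_tangent R p `|u| `|u - c| p1 (normr_ge0 _) (normr_ge0 _).
move: nE; rewrite mulrBr uE.
set X := `|u| `^ p; set Y := `|u| `^ (p - 1) * _; set Z := _ * u.
move=> h1 h2.
have h3 : p * (X - Z * c) <= p * Y by rewrite ler_wpM2l//; lra.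
nra.
Qed.

Section centering.
Context {R : realType}.
Let mu := @lebesgue_measure R.
Local Open Scope ereal_scope.

(** The integral is the difference of the integrals of the positive and negative parts, and in the
    extended reals such a difference is 0 only when both are finite. *)
Lemma integral_eq0_integrable (D : set R) (g : R -> R) :
  measurable D -> measurable_fun D g ->
  \int[mu]_(x in D) (g x)%:E = 0 -> mu.-integrable D (EFin \o g).
Proof.
move=> mD mg g0.
have mg' : measurable_fun D (fun x => (g x)%:E) by exact/measurable_EFinP.
apply/integrableP; split => //.
have -> : \int[mu]_(x in D) `|(EFin \o g) x| =
    \int[mu]_(x in D) ((EFin \o g)^\+ x + (EFin \o g)^\- x).
  apply: eq_integral => x _.
  by have /(congr1 (fun f => f x)) := fune_abse (EFin \o g).
rewrite ge0_integralD//; last 2 first.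
  exact: measurable_funepos.
  exact: measurable_funeneg.
have aux : forall A B : \bar R, 0 <= A -> 0 <= B -> A - B = 0 -> A + B < +oo.
  by move=> [a| |] [b| |] //= _ _ _; rewrite -EFinD ltry.
rewrite integralE in g0.
by apply: (aux _ _ _ _ g0); exact: integral_ge0.
Qed.

Lemma ge0_integrable_lty (D : set R) (g : R -> R) :
  measurable D -> measurable_fun D g -> (forall x, D x -> 0 <= g x)%R ->
  \int[mu]_(x in D) (g x)%:E < +oo -> mu.-integrable D (EFin \o g).
Proof.
move=> mD mg g0 fin; apply/integrableP; split; first exact/measurable_EFinP.
rewrite (_ : \int[mu]_(x in D) _ = \int[mu]_(x in D) (g x)%:E)//.
by apply: eq_integral => x; rewrite inE => Dx; rewrite /= ger0_norm ?g0.
Qed.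

(** The constraint says that [c = 0] is a critical point, hence a minimum, of the convex function
    sending [c] to the integral of [f |u - c|^p]. The proof integrates [young_shift]. *)
Lemma centering (p c : R) (D : set R) (f u : R -> R) :
  (1 < p)%R -> measurable D -> measurable_fun D f -> measurable_fun D u ->
  (forall x, D x -> 0 <= f x)%R ->
  \int[mu]_(x in D) (f x * `|u x| `^ p)%:E < +oo ->
  \int[mu]_(x in D) (f x * (`|u x| `^ (p - 2) * u x))%:E = 0 ->
  \int[mu]_(x in D) (f x * `|u x| `^ p)%:E <=
  \int[mu]_(x in D) (f x * `|u x - c| `^ p)%:E.
Proof.
move=> p1 mD mf mu_ f0 fin u0.
have mpow r (g : R -> R) : measurable_fun D g -> measurable_fun D (fun x => `|g x| `^ r)%R.
  move=> mg; apply: (@measurableT_comp _ _ _ _ _ _ (fun y : R => y `^ r)%R).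
    exact: measurable_powR.
  exact: (@measurableT_comp _ _ _ _ _ _ (fun y : R => `|y|)%R).
have m1 : measurable_fun D (fun x => f x * `|u x| `^ p)%R.
  by apply: measurable_funM => //; exact: mpow.
have m2 : measurable_fun D (fun x => f x * (`|u x| `^ (p - 2) * u x))%R.
  by apply: measurable_funM => //; apply: measurable_funM => //; exact: mpow.
have m3 : measurable_fun D (fun x => f x * `|u x - c| `^ p)%R.
  apply: measurable_funM => //; apply: mpow.
  by apply: measurable_funB.
have p1_ge0 x : D x -> (0 <= f x * `|u x| `^ p)%R.
  by move=> Dx; rewrite mulr_ge0 ?powR_ge0 ?f0.
have p3_ge0 x : D x -> (0 <= f x * `|u x - c| `^ p)%R.
  by move=> Dx; rewrite mulr_ge0 ?powR_ge0 ?f0.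
have [/eqP ->|] := boolP (\int[mu]_(x in D) (f x * `|u x - c| `^ p)%:E == +oo).
  exact: leey.
rewrite -ltey => fin3.
have i1 : mu.-integrable D (EFin \o (fun x => f x * `|u x| `^ p)%R).
  exact: (ge0_integrable_lty mD m1 p1_ge0 fin).
have i2 := integral_eq0_integrable mD m2 u0.
have i3 : mu.-integrable D (EFin \o (fun x => f x * `|u x - c| `^ p)%R).
  exact: (ge0_integrable_lty mD m3 p3_ge0 fin3).
have i2' : mu.-integrable D (fun x => (p * c)%:E * (f x * (`|u x| `^ (p - 2) * u x))%:E).
  exact: integrableZl.
have -> : \int[mu]_(x in D) (f x * `|u x - c| `^ p)%:E =
    \int[mu]_(x in D) ((f x * `|u x - c| `^ p)%:E +
      (p * c)%:E * (f x * (`|u x| `^ (p - 2) * u x))%:E).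
  by rewrite integralD//= integralZl// u0 mule0 adde0.
apply: le_integral => //; first exact: integrableD.
move=> x; rewrite inE => Dx; rewrite -EFinM -EFinD lee_fin mulrCA -mulrDr.
by rewrite ler_wpM2l ?f0// young_shift.
Qed.
End centering.

(** The image of Lebesgue measure under the reflection has the right values on half-open intervals,
    so it is Lebesgue measure. Everything to the left of [x0] is deduced from the right side in this
    way. *)
Lemma ge0_integral_onem (R : realType) (D : set R) (g : R -> \bar R) :
  measurable D -> measurable_fun D g -> (forall x, D x -> (0 <= g x)%E) ->
  (\int[@lebesgue_measure R]_(x in D) g x =
   \int[@lebesgue_measure R]_(x in (fun x => (1 - x)%R) @^-1` D) g (1 - x)%R)%E.
Proof.
move=> mD mg g0.
have mF : measurable_fun [set: measurableTypeR R] ((fun x : R => 1 - x) : measurableTypeR R -> measurableTypeR R).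
  exact: measurable_funB.
pose F : {mfun measurableTypeR R >-> measurableTypeR R} :=
  HB.pack (fun x : measurableTypeR R => (1 - x) : measurableTypeR R) (isMeasurableFun.Build _ _ _ _ _ mF).
have FE (A : set R) : measurable A -> lebesgue_measure A = pushforward (@lebesgue_measure R) F A.
  move: A; apply: (@lebesgue_measure_unique R (pushforward (@lebesgue_measure R) F)).
  move=> X [[a b]/= _ <-]; rewrite /pushforward.
  rewrite (_ : _ @^-1` _ = `[1 - b, 1 - a[%classic); last first.
    by apply/seteqP; split => x /=; rewrite !in_itv/=; lra.
  rewrite !lebesgue_measure_itv/= !lte_fin.
  by rewrite -!EFinD ltrD2l ltrN2 (_ : 1 - a - (1 - b) = b - a)//; ring.
have := @ge0_integral_pushforward _ _ _ _ R _ mF (@lebesgue_measure R) D g mD mg.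
move=> /= <-; last by move=> y; rewrite inE; exact: g0.
by apply: eq_measure_integral => A mA _; exact: FE.
Qed.

Lemma gt0_powRD (R : realType) (a x y : R) : 0 < a -> a `^ (x + y) = a `^ x * a `^ y.
Proof. by move=> a0; rewrite powRD// (gt_eqF a0) implybT. Qed.

(** Young's inequality for [c k] and [w], divided by [k ^ (p - 1)]. *)
Lemma young_weighted (R : realType) (p c w k : R) : 1 < p -> 0 <= c -> 0 <= w -> 0 < k ->
  p * c `^ (p - 1) * w <= w `^ p * k `^ (1 - p) + (p - 1) * c `^ p * k.
Proof.
move=> p1 c0 w0 k0.
have := @young_tangent R p (c * k) w p1 (mulr_ge0 c0 (ltW k0)) w0.
rewrite !powRM ?(ltW k0)//.
have E1 : k `^ (p - 1) * k `^ (1 - p) = 1.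
  by rewrite -gt0_powRD// (_ : p - 1 + (1 - p) = 0) ?powRr0//; ring.
have E2 : k `^ p * k `^ (1 - p) = k.
  by rewrite -gt0_powRD// (_ : p + (1 - p) = 1) ?powRr1 ?(ltW k0)//; ring.
have kp : 0 < k `^ (1 - p) by rewrite powR_gt0.
rewrite -(ler_pM2r kp).
rewrite [leLHS](_ : _ = p * c `^ (p - 1) * w * (k `^ (p - 1) * k `^ (1 - p))); last by ring.
rewrite E1 mulr1 => /le_trans; apply.
by rewrite -[X in _ <= _ + _ * X]E2 le_eqVlt; apply/orP; left; apply/eqP; ring.
Qed.

(** * Hardy inequalities *)

Section hardy.
Context {R : realType}.
Let mu := @lebesgue_measure R.
Local Open Scope ereal_scope.

(** Hölder's inequality for the product of [w k^(-(p-1)/p)] and [k^((p-1)/p)], obtained by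
    integrating [young_weighted] with the best constant. *)
Lemma hardy_pointwise (p x0 x c e : R) (k w : R -> R) :
  (1 < p)%R -> measurable_fun `]x0, x[ k -> measurable_fun `]x0, x[ w ->
  (forall t, `]x0, x[%classic t -> 0 < k t)%R ->
  (forall t, `]x0, x[%classic t -> 0 <= w t)%R ->
  (0 <= c)%R -> (0 < e)%R ->
  \int[mu]_(t in `]x0, x[) (k t)%:E <= e%:E ->
  c%:E <= \int[mu]_(t in `]x0, x[) (w t)%:E ->
  (c `^ p)%:E <= (e `^ (p - 1))%:E *
    \int[mu]_(t in `]x0, x[) (w t `^ p * k t `^ (1 - p))%:E.
Proof.
move=> p1 mk mw k0 w0 c0 e0 ke cw.
have p0 : (0 < p)%R by lra.
have mpow (r : R) (g : R -> R) : measurable_fun `]x0, x[ g -> measurable_fun `]x0, x[ (fun x => g x `^ r)%R.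
  exact: (measurableT_comp (measurable_powR _)).
have mV : measurable_fun `]x0, x[ (fun t => w t `^ p * k t `^ (1 - p))%R.
  by apply: measurable_funM; exact: mpow.
set V := \int[mu]_(t in _) (w t `^ p * _)%:E.
have V0 : 0 <= V.
  by apply: integral_ge0 => t _; rewrite lee_fin mulr_ge0 ?powR_ge0.
(* The optimal constant: Young's inequality is an equality when [w = d k]. *)
pose d := (c / e)%R.
have d0 : (0 <= d)%R by rewrite divr_ge0// ltW.
have H : (p * d `^ (p - 1))%:E * c%:E <= V + ((p - 1) * d `^ p)%:E * e%:E.
  have a0 : (0 <= p * d `^ (p - 1))%R by rewrite mulr_ge0 ?powR_ge0 ?ltW.
  have b0 : (0 <= (p - 1) * d `^ p)%R by rewrite mulr_ge0 ?powR_ge0//; lra.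
  apply: (@le_trans _ _ ((p * d `^ (p - 1))%:E * \int[mu]_(t in `]x0, x[) (w t)%:E)).
    by rewrite lee_wpmul2l// lee_fin.
  apply: (@le_trans _ _ (V + ((p - 1) * d `^ p)%:E * \int[mu]_(t in `]x0, x[) (k t)%:E)); last first.
    by rewrite leeD2l// lee_wpmul2l// lee_fin.
  have k0' t : `]x0, x[%classic t -> 0 <= (k t)%:E by move=> /k0; rewrite lee_fin => /ltW.
  have w0' t : `]x0, x[%classic t -> 0 <= (w t)%:E by move=> /w0; rewrite lee_fin.
  have mk' : measurable_fun `]x0, x[ (fun t => (k t)%:E) by exact/measurable_EFinP.
  have mw' : measurable_fun `]x0, x[ (fun t => (w t)%:E) by exact/measurable_EFinP.
  rewrite -!ge0_integralZl//.
  rewrite -ge0_integralD//; last 4 first.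
  - by move=> t _; rewrite lee_fin mulr_ge0 ?powR_ge0.
  - exact/measurable_EFinP.
  - by move=> t /k0; rewrite -EFinM lee_fin => /ltW ?; rewrite mulr_ge0.
  - by apply/measurable_EFinP; apply: measurable_funM.
  apply: ge0_le_integral => //.
  - by move=> t /w0 ?; rewrite -EFinM lee_fin mulr_ge0.
  - by apply/measurable_EFinP; apply: measurable_funM.
  - apply/measurable_EFinP; apply: measurable_funD => //.
    exact: measurable_funM.
  move=> t xt; rewrite -!EFinM -EFinD lee_fin.
  by apply: young_weighted => //; [exact: w0|exact: k0].
have cE : c = (d * e)%R by rewrite /d divfK// gt_eqF.
have V1 : (d `^ p * e)%:E <= V.
  have [/eqP ->|] := boolP (V == +oo); first exact: leey.
  rewrite -ltey => Vfin; have Vf : V \is a fin_num by rewrite ge0_fin_numE.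
  move: H; rewrite -(fineK Vf) -!EFinM -EFinD !lee_fin cE.
  have -> : (p * d `^ (p - 1) * (d * e) = p * d `^ p * e)%R.
    have [->|dn] := eqVneq d 0%R; first by rewrite (@powR0 _ p) ?gt_eqF// !(mul0r, mulr0).
    have -> : (d `^ p = d `^ (p - 1) * d)%R.
      rewrite -[X in (_ * X)%R](powRr1 d0) -gt0_powRD ?subrK//.
      by rewrite lt_neqAle eq_sym dn.
    by ring.
  by move=> ?; nra.
apply: (@le_trans _ _ ((e `^ (p - 1))%:E * (d `^ p * e)%:E)); last first.
  by rewrite lee_wpmul2l// lee_fin powR_ge0.
rewrite -EFinM lee_fin cE powRM ?(ltW e0)//.
rewrite [leRHS](_ : _ = d `^ p * (e `^ (p - 1) * e))%R; last by ring.
by rewrite -[X in (_ * (_ * X))%R](@powRr1 _ e) ?(ltW e0)// -gt0_powRD// subrK.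
Qed.

(** Both sections of the Tonelli kernel in [hardy_right] have this shape, with [b] the indicator of
    the triangle in one of the variables. *)
Lemma integral_scaled_patch (a : R) (h b : R -> R) (D S : set R) :
  (0 <= a)%R -> measurable D -> measurable S -> measurable_fun D h ->
  (forall t, D t -> 0 <= h t)%R -> S `<=` D ->
  (forall t, D t -> b t = (t \in S)%:R) ->
  \int[mu]_t (a * (h \_ D)%R t * b t)%:E = a%:E * \int[mu]_(t in S) (h t)%:E.
Proof.
move=> a0 mD mS mh h0 SD bE.
rewrite -ge0_integralZl; [|exact: mS| | |by rewrite lee_fin]; last 2 first.
- by apply/measurable_EFinP; exact: measurable_funS mD SD mh.
- by move=> t /SD/h0; rewrite lee_fin.
rewrite [RHS]integral_mkcond; apply: eq_integral => t _.
rewrite !patchE; have [Dt|nDt] := pselect (D t).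
  rewrite (mem_set Dt) bE//.
  by case: ifPn => _; rewrite ?mulr1 ?mulr0// EFinM.
rewrite [t \in D]memNset// [t \in S]memNset ?mulr0 ?mul0r//.
by move=> /SD.
Qed.

(** Schur test: [hardy_pointwise] bounds [g x ^ p] by [E x ^ (p-1)] times the integral of
    [w^p k^(1-p)] over [(x0, x)]. After multiplication by [f] and exchange of the integrals, the
    integral of [f E^(p-1)] over [(t, 1)] appears, and its bound by [f k^(p-1) / nu] cancels
    [k^(1-p)]. *)
Lemma hardy_right (p nu x0 : R) (f E k w g : R -> R) :
  (1 < p)%R -> (0 <= nu)%R ->
  let D := `]x0, 1%R[%classic in
  measurable_fun D f -> measurable_fun D E -> measurable_fun D k ->
  measurable_fun D w -> measurable_fun D g ->
  (forall x, D x -> 0 <= f x)%R -> (forall x, D x -> 0 < E x)%R ->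
  (forall x, D x -> 0 < k x)%R -> (forall x, D x -> 0 <= w x)%R ->
  (forall x, D x -> 0 <= g x)%R ->
  (forall x, D x -> \int[mu]_(t in `]x0, x[) (k t)%:E <= (E x)%:E) ->
  (forall t, D t -> nu%:E * \int[mu]_(x in `]t, 1%R[) (f x * E x `^ (p - 1))%:E <=
     (f t * k t `^ (p - 1))%:E) ->
  {ae mu, forall x, D x -> (g x)%:E <= \int[mu]_(t in `]x0, x[) (w t)%:E} ->
  nu%:E * \int[mu]_(x in D) (f x * g x `^ p)%:E <=
    \int[mu]_(x in D) (f x * w x `^ p)%:E.
Proof.
move=> p1 nu0 D mf mE mk mw mg f0 E0 k0 w0 g0 kE fE gw.
have mD : measurable D by exact: measurable_itv.
have mpow (r : R) (h : R -> R) : measurable_fun D h -> measurable_fun D (fun x => h x `^ r)%R.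
  exact: (measurableT_comp (measurable_powR _)).
pose A := ((fun x => f x * E x `^ (p - 1)) \_ D)%R.
pose B := ((fun t => w t `^ p * k t `^ (1 - p)) \_ D)%R.
have mA : measurable_fun setT A.
  by apply/(measurable_restrictT _ mD); apply: measurable_funM => //; exact: mpow.
have mB : measurable_fun setT B.
  by apply/(measurable_restrictT _ mD); apply: measurable_funM; exact: mpow.
have A0 x : (0 <= A x)%R.
  by rewrite /A patchE; case: ifPn => //; rewrite inE => Dx; rewrite mulr_ge0 ?f0 ?powR_ge0.
have B0 x : (0 <= B x)%R.
  by rewrite /B patchE; case: ifPn => //; rewrite inE => Dx; rewrite mulr_ge0 ?powR_ge0.
(* Extension by zero and the indicator of the triangle make both iterated integrals run over the
   whole line, as Tonelli's theorem requires. *)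
pose F (z : R * R) := (A z.1 * B z.2 * (z.2 < z.1)%R%:R)%:E.
have mF : measurable_fun setT F.
  apply/measurable_EFinP; apply: measurable_funM.
    apply: measurable_funM.
      exact: (measurableT_comp mA).
    exact: (measurableT_comp mB).
  have -> : (fun z : R * R => (z.2 < z.1)%R%:R : R) = (fun b : bool => b%:R) \o (fun z => (z.2 < z.1)%R) by [].
  apply: measurableT_comp => //.
  exact: measurable_fun_ltr.
have F0 z : 0 <= F z by rewrite lee_fin !mulr_ge0.
pose G x := \int[mu]_t F (x, t); pose H t := \int[mu]_x F (x, t).
have LM : \int[mu]_x G x = \int[mu]_t H t := @fubini_tonelli _ _ _ _ R mu mu F mF F0.
have mG : measurable_fun setT G.
  exact: (@measurable_fun_fubini_tonelli_F _ _ _ _ R mu F mF F0).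
have mH : measurable_fun setT H.
  exact: (@measurable_fun_fubini_tonelli_G _ _ _ _ R mu F mF F0).
have G0 x : 0 <= G x by apply: integral_ge0.
have H0 t : 0 <= H t by apply: integral_ge0.
have Dx0 x t : D x -> `]x0, x[%classic t -> D t.
  by rewrite /D/= !in_itv/=; lra.
have Dt1 x t : D t -> `]t, 1%R[%classic x -> D x.
  by rewrite /D/= !in_itv/=; lra.
have GE x : D x -> G x = (A x)%:E *
    \int[mu]_(t in `]x0, x[) (w t `^ p * k t `^ (1 - p))%:E.
  move=> Dx; apply: integral_scaled_patch (A0 x) mD (measurable_itv _) _ _ _ _.
  - by apply: measurable_funM; exact: mpow.
  - by move=> t _; rewrite mulr_ge0 ?powR_ge0.
  - by move=> t; exact: Dx0.
  - by move=> t Dt; rewrite mem_setE in_itv/=; move: Dt; rewrite /D/= in_itv/= => /andP[-> _].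
have HE t : D t -> H t = (B t)%:E *
    \int[mu]_(x in `]t, 1%R[) (f x * E x `^ (p - 1))%:E.
  move=> Dt; rewrite /H /F; under eq_integral do rewrite [(A _ * _)%R]mulrC.
  apply: integral_scaled_patch (B0 t) mD (measurable_itv _) _ _ _ _.
  - by apply: measurable_funM => //; exact: mpow.
  - by move=> x Dx; rewrite mulr_ge0 ?powR_ge0 ?f0.
  - by move=> x; exact: Dt1.
  - by move=> x Dx; rewrite mem_setE in_itv/=; move: Dx; rewrite /D/= in_itv/= => /andP[_ ->]; rewrite andbT.
have H0' t : ~ D t -> H t = 0.
  move=> nDt; apply: integral0_eq => x _.
  by rewrite /F /B patchE /= (memNset nDt) mulr0 mul0r.
have AE x : D x -> A x = (f x * E x `^ (p - 1))%R by move=> Dx; rewrite /A patchE mem_set.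
have BE t : D t -> B t = (w t `^ p * k t `^ (1 - p))%R by move=> Dx; rewrite /B patchE mem_set.
clearbody G H; clear F mF F0; clearbody A B.
have mpg : measurable_fun D (fun x => f x * g x `^ p)%R.
  by apply: measurable_funM => //; exact: mpow.
apply: (@le_trans _ _ (nu%:E * \int[mu]_x G x)).
  rewrite lee_wpmul2l ?lee_fin//.
  apply: (@le_trans _ _ (\int[mu]_(x in D) G x)); last first.
    by apply: ge0_subset_integral.
  apply: ae_ge0_le_integral => //.
  - by move=> x Dx; rewrite lee_fin mulr_ge0 ?powR_ge0 ?f0.
  - exact/measurable_EFinP.
  - exact: measurable_funS mG.
  case: gw => N [mN N0 gN]; exists N; split => //; apply: subset_trans gN.
  move=> x/= nx gx; apply: nx => Dx; rewrite GE//.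
  have := @hardy_pointwise p x0 x (g x) (E x) k w p1.
  move=> /(_ (measurable_funS mD (fun t => Dx0 x t Dx) mk) (measurable_funS mD (fun t => Dx0 x t Dx) mw)).
  move=> /(_ (fun t xt => k0 t (Dx0 x t Dx xt)) (fun t xt => w0 t (Dx0 x t Dx xt)) (g0 x Dx) (E0 x Dx) (kE x Dx) (gx Dx)).
  move=> h; rewrite EFinM; apply: le_trans (lee_wpmul2l _ h) _; first by rewrite lee_fin f0.
  by rewrite muleA -EFinM AE.
rewrite LM [X in _ * X](_ : _ = \int[mu]_(t in D) H t); last first.
  rewrite [RHS]integral_mkcond; apply: eq_integral => t _.
  rewrite patchE; case: ifPn => // /negP nDt; apply: H0' => Dt.
  by apply: nDt; rewrite inE.
rewrite -ge0_integralZl//; last exact: measurable_funS mH.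
apply: ge0_le_integral => //.
- by move=> t _; rewrite mule_ge0// lee_fin.
- by apply: emeasurable_funM => //; exact: measurable_funS mH.
- by apply/measurable_EFinP; apply: measurable_funM => //; exact: mpow.
move=> t Dt; rewrite HE// muleCA.
apply: le_trans (lee_wpmul2l _ (fE t Dt)) _; first by rewrite lee_fin.
rewrite -EFinM lee_fin BE//.
rewrite [leLHS](_ : _ = f t * w t `^ p * (k t `^ (1 - p) * k t `^ (p - 1)))%R; last by ring.
by rewrite -gt0_powRD ?k0// (_ : 1 - p + (p - 1) = 0)%R ?powRr0 ?mulr1//; ring.
Qed.
End hardy.

(* [E] and [k] are the weights of a Schur test for the operator that takes [v] to
   its primitive vanishing at [x0]; the last condition is the adjoint one. *)
Definition neumann_field (R : realType) (p nu : R) (f : R -> R) (x0 : R) :=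
  exists E k : R -> R,
    [/\ continuous E, continuous k,
        forall x, x0 < x < 1 -> 0 < E x /\ 0 < k x,
        forall x, x0 < x < 1 ->
          (\int[@lebesgue_measure R]_(t in `]x0, x[) (k t)%:E <= (E x)%:E)%E &
        forall t, x0 < t < 1 ->
          (nu%:E * \int[@lebesgue_measure R]_(x in `]t, 1%R[) (f x * E x `^ (p - 1))%:E <=
           (f t * k t `^ (p - 1))%:E)%E].

Section two_sided.
Context {R : realType}.
Let mu := @lebesgue_measure R.
Local Open Scope ereal_scope.

Lemma measurable_onem (D : set R) (g : R -> R) : measurable D ->
  measurable_fun D g -> measurable_fun ((fun x => 1 - x)%R @^-1` D) (fun x => g (1 - x)%R).
Proof.
move=> mD mg; apply: (measurable_comp mD) => //; last first.
  by apply: (@measurable_funB _ _ _ _ (cst 1%R) id).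
by move=> _ [x Dx <-].
Qed.

Lemma ae_onem (P : R -> Prop) : {ae mu, forall x, P x} -> {ae mu, forall x, P (1 - x)%R}.
Proof.
case=> N [mN N0 PN]; exists ((fun x => 1 - x)%R @^-1` N).
have mN' : measurable ((fun x : R => 1 - x)%R @^-1` N).
  rewrite -[X in measurable X]setTI.
  by apply: (@measurable_funB _ _ _ setT (cst 1%R) id).
split; [exact: mN'| |by move=> x Px; exact: (PN (1 - x)%R)].
have := @ge0_integral_onem R N (cst 1) mN (measurable_cst _) (fun _ _ => lee01).
rewrite integral_cst// [X in (1 * X)%E]N0 mule0 => E0.
by rewrite -[LHS]mul1e -integral_cst//; exact/esym.
Qed.

Lemma ae_impl (P Q : R -> Prop) : {ae mu, forall x, P x} ->
  (forall x, P x -> Q x) -> {ae mu, forall x, Q x}.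
Proof.
case=> N [mN N0 PN] PQ; exists N; split => //.
by move=> x Qx; apply: PN => Px; apply: Qx; exact: PQ.
Qed.

Lemma hardy_field_right (p nu x0 : R) (f w g : R -> R) :
  (1 < p)%R -> (0 <= nu)%R -> neumann_field p nu f x0 ->
  let D : set R := `]x0, 1%R[%classic in
  measurable_fun D f -> measurable_fun D w -> measurable_fun D g ->
  (forall x, D x -> 0 <= f x)%R -> (forall x, D x -> 0 <= w x)%R ->
  (forall x, D x -> 0 <= g x)%R ->
  {ae mu, forall x, D x -> (g x)%:E <= \int[mu]_(t in `]x0, x[) (w t)%:E} ->
  nu%:E * \int[mu]_(x in D) (f x * g x `^ p)%:E <=
    \int[mu]_(x in D) (f x * w x `^ p)%:E.
Proof.
move=> p1 nu0 [E [k [cE ck Ek kE fE]]] D mf mw mg f0 w0 g0 gw.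
have DE x : D x -> (x0 < x < 1)%R by rewrite /D/= in_itv.
apply: (hardy_right (E := E) (k := k)) => //.
- exact: measurable_funS (continuous_measurable_fun cE).
- exact: measurable_funS (continuous_measurable_fun ck).
- by move=> x /DE/Ek[].
- by move=> x /DE/Ek[].
Qed.

Lemma hardy_field_left (p nu x0 : R) (f w g : R -> R) :
  (1 < p)%R -> (0 <= nu)%R -> neumann_field p nu (fun x => f (1 - x)%R) (1 - x0)%R ->
  let D : set R := `]0%R, x0[%classic in
  measurable_fun D f -> measurable_fun D w -> measurable_fun D g ->
  (forall x, D x -> 0 <= f x)%R -> (forall x, D x -> 0 <= w x)%R ->
  (forall x, D x -> 0 <= g x)%R ->
  {ae mu, forall x, D x -> (g x)%:E <= \int[mu]_(t in `]x, x0[) (w t)%:E} ->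
  nu%:E * \int[mu]_(x in D) (f x * g x `^ p)%:E <=
    \int[mu]_(x in D) (f x * w x `^ p)%:E.
Proof.
move=> p1 nu0 F D mf mw mg f0 w0 g0 gw.
have mpow (r : R) (h : R -> R) : measurable_fun D h -> measurable_fun D (fun x => h x `^ r)%R.
  exact: (measurableT_comp (measurable_powR _)).
have pD : (fun x => 1 - x)%R @^-1` D = `](1 - x0)%R, 1%R[%classic.
  by apply/seteqP; split => x /=; rewrite /D/= !in_itv/=; lra.
have DE x : `](1 - x0)%R, 1%R[%classic x -> D (1 - x)%R by rewrite -pD.
have mD : measurable D by exact: measurable_itv.
rewrite ge0_integral_onem; [|exact: mD| |]; last 2 first.
- by apply/measurable_EFinP; apply: measurable_funM => //; exact: mpow.
- by move=> x Dx; rewrite lee_fin mulr_ge0 ?f0 ?powR_ge0.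
rewrite [leRHS]ge0_integral_onem; [|exact: mD| |]; last 2 first.
- by apply/measurable_EFinP; apply: measurable_funM => //; exact: mpow.
- by move=> x Dx; rewrite lee_fin mulr_ge0 ?f0 ?powR_ge0.
rewrite pD.
apply: (@hardy_field_right p nu (1 - x0)%R (fun x => f (1 - x)%R) (fun x => w (1 - x)%R) (fun x => g (1 - x)%R)) => //.
- by rewrite -pD; exact: measurable_onem.
- by rewrite -pD; exact: measurable_onem.
- by rewrite -pD; exact: measurable_onem.
- by move=> x /DE/f0.
- by move=> x /DE/w0.
- by move=> x /DE/g0.
apply: (ae_impl (ae_onem gw)) => x gx /DE Dx; apply: le_trans (gx Dx) _.
rewrite ge0_integral_onem; [|exact: measurable_itv| |]; last 2 first.
- apply/measurable_EFinP; apply: measurable_funS mw => // t; move: Dx; rewrite /D/= !in_itv/=; lra.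
- by move=> t xt; rewrite lee_fin w0//; move: Dx xt; rewrite /D/= !in_itv/=; lra.
rewrite (_ : _ @^-1` _ = `](1 - x0)%R, x[%classic)//.
by apply/seteqP; split => t /=; rewrite !in_itv/=; lra.
Qed.

Lemma ge0_integral_itv_split (x0 : R) (F : R -> R) : (0 < x0 < 1)%R ->
  measurable_fun (`]0%R, 1%R[ : set R) F -> (forall x, (0 < x < 1 -> 0 <= F x)%R) ->
  \int[mu]_(x in `]0%R, 1%R[) (F x)%:E =
  \int[mu]_(x in `]0%R, x0[) (F x)%:E + \int[mu]_(x in `]x0, 1%R[) (F x)%:E.
Proof.
move=> x01 mF F0.
have UE : `]0%R, 1%R[%classic = `]0%R, x0[ `|` `[x0, 1%R[ :> set R.
  by rewrite -itv_bndbnd_setU// bnd_simp; lra.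
rewrite UE ge0_integral_setU //.
- congr (_ + _); apply/esym/integral_itv_obnd_cbnd; apply/measurable_EFinP.
  by apply: measurable_funS mF => // x /=; rewrite !in_itv/=; lra.
- by rewrite -UE; exact/measurable_EFinP.
- by rewrite -UE => x /=; rewrite in_itv/= lee_fin; exact: F0.
- by apply/disj_setPS => x /= []; rewrite !in_itv/=; lra.
Qed.

(** Here [c] stands for the value of [u] at [x0]. After [centering] replaces [u] by [u - c], the
    inequalities on the two sides of [x0] have the same constant [nu] and add up. *)
Lemma poincare_two_fields (p nu x0 c : R) (f u v : R -> R) :
  (1 < p)%R -> (0 <= nu)%R -> (0 < x0 < 1)%R ->
  neumann_field p nu f x0 ->
  neumann_field p nu (fun x => f (1 - x)%R) (1 - x0)%R ->
  let D : set R := `]0%R, 1%R[%classic in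
  measurable_fun D f -> measurable_fun D u -> measurable_fun D v ->
  (forall x, D x -> 0 <= f x)%R ->
  {ae mu, forall x, (x0 < x < 1)%R ->
     `|u x - c|%:E <= \int[mu]_(t in `]x0, x[) `|v t|%:E} ->
  {ae mu, forall x, (0 < x < x0)%R ->
     `|u x - c|%:E <= \int[mu]_(t in `]x, x0[) `|v t|%:E} ->
  \int[mu]_(x in D) (f x * `|u x| `^ p)%:E < +oo ->
  \int[mu]_(x in D) (f x * (`|u x| `^ (p - 2) * u x))%:E = 0 ->
  nu%:E * \int[mu]_(x in D) (f x * `|u x| `^ p)%:E <=
    \int[mu]_(x in D) (f x * `|v x| `^ p)%:E.
Proof.
move=> p1 nu0 x01 Fr Fl D mf mu_ mv f0 ur ul fin u0.
have mD : measurable D by exact: measurable_itv.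
have Dl x : `]0%R, x0[%classic x -> D x by rewrite /D/= !in_itv/=; lra.
have Dr x : `]x0, 1%R[%classic x -> D x by rewrite /D/= !in_itv/=; lra.
have mn (g : R -> R) : measurable_fun D g -> measurable_fun D (fun x => `|g x|)%R.
  by move=> mg; exact: (@measurableT_comp _ _ _ _ _ _ (fun y : R => `|y|)%R).
have mpow (g : R -> R) : measurable_fun D g -> measurable_fun D (fun x => f x * `|g x| `^ p)%R.
  move=> mg; apply: measurable_funM => //.
  by apply: (measurableT_comp (measurable_powR _)); exact: mn.
have muc : measurable_fun D (fun x => u x - c)%R by exact: measurable_funB.
have pos (g : R -> R) x : (0 < x < 1 -> 0 <= f x * `|g x| `^ p)%R.
  by move=> x1; rewrite mulr_ge0 ?powR_ge0// f0// /D/= in_itv.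
apply: (@le_trans _ _ (nu%:E * \int[mu]_(x in D) (f x * `|u x - c| `^ p)%:E)).
  by apply: lee_wpmul2l; [rewrite lee_fin|exact: centering].
rewrite [X in _ * X](@ge0_integral_itv_split x0)//; [|exact: mpow|exact: pos].
rewrite [leRHS](@ge0_integral_itv_split x0)//; [|exact: mpow|exact: pos].
rewrite ge0_muleDr; last 2 first.
- by apply: integral_ge0 => x /Dl; rewrite /D/= in_itv/= lee_fin; exact: (pos (fun x => u x - c)%R).
- by apply: integral_ge0 => x /Dr; rewrite /D/= in_itv/= lee_fin; exact: (pos (fun x => u x - c)%R).
apply: leeD.
- apply: (@hardy_field_left p nu x0 f (fun x => `|v x|)%R (fun x => `|u x - c|)%R) => //.
  + exact: measurable_funS Dl mf.
  + exact: measurable_funS Dl (mn _ mv).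
  + exact: measurable_funS Dl (mn _ muc).
  + by move=> x /Dl/f0.
- apply: (@hardy_field_right p nu x0 f (fun x => `|v x|)%R (fun x => `|u x - c|)%R) => //.
  + exact: measurable_funS Dr mf.
  + exact: measurable_funS Dr (mn _ mv).
  + exact: measurable_funS Dr (mn _ muc).
  + by move=> x /Dr/f0.
Qed.
End two_sided.

Lemma is_derive1_cvgP (R : realType) (f : R -> R) (x l : R) :
  is_derive x 1 f l <-> h^-1 * (f (h + x) - f x) @[h --> 0^'] --> l.
Proof.
have E : (fun h => h^-1 *: ((f \o shift x) (h *: (1:R)) - f x)) = (fun h => h^-1 * (f (h + x) - f x)).
  by apply/funext => h; rewrite /= /GRing.scale/= mulr1.
split; first by case; rewrite /derivable /derive E => d <-.
move=> d; split; rewrite /derivable /derive E; first by apply/cvg_ex; exists l.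
exact: cvg_lim.
Qed.

Lemma is_derive_squeeze (R : realType) (lo f hi : R -> R) (z l : R) :
  (\forall x \near z, lo x <= f x <= hi x) -> lo z = f z -> hi z = f z ->
  is_derive z 1 lo l -> is_derive z 1 hi l -> is_derive z 1 f l.
Proof.
move=> lfh lz hz /is_derive1_cvgP dl /is_derive1_cvgP dh; apply/is_derive1_cvgP.
pose a h := h^-1 * (lo (h + z) - lo z); pose b h := h^-1 * (hi (h + z) - hi z).
pose q h := h^-1 * (f (h + z) - f z).
have ba0 : `|b h - a h| @[h --> 0^'] --> (0:R).
  by have := cvg_norm (cvgB dh dl); rewrite subrr normr0; apply.
have nba0 : - `|b h - a h| @[h --> 0^'] --> (0:R) by have := cvgN ba0; rewrite oppr0; apply.
have qa : q h - a h @[h --> 0^'] --> (0:R).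
  apply: squeeze_cvgr nba0 ba0.
  (* Comparing absolute values, [|q h - a h| <= |b h - a h|], treats both signs of [h] at once. *)
  near=> h; rewrite -ler_norml -mulrBr -mulrBr !normrM ler_wpM2l//.
  rewrite lz hz !opprB ![_ - f z + _]addrA !subrK.
  have /andP[h1 h2] : lo (h + z) <= f (h + z) <= hi (h + z).
    near: h; move/nbhs_ballP : lfh => [e /= e0 He]; exists e => //= h.
    rewrite /ball/= sub0r normrN => he _; apply: He.
    by rewrite /ball/= opprD addrCA subrr addr0 normrN.
  by rewrite !ger0_norm; lra.
have -> : (fun h => h^-1 * (f (h + z) - f z)) = (fun h => a h + (q h - a h)).
  by apply/funext => h; rewrite addrCA subrr addr0.
by rewrite -[l]addr0; exact: cvgD.
Unshelve. all: by end_near. Qed.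

(** * Smooth test functions and Sobolev representatives *)

(** Recursion on the first derivative suits the inductions for products and compositions;
    [Cn_derivable] translates back to iterated derivatives. *)
Fixpoint Cn (R : realType) (n : nat) (f : R -> R) : Prop :=
  if n is m.+1 then (forall x, derivable f x 1) /\ Cn m (f^`()%classic) else True.

Section Cn.
Context {R : realType}.
Implicit Types f g : R -> R.

Lemma is_derive_derive1 f f' : (forall x : R, is_derive x 1 f (f' x)) -> f^`()%classic = f'.
Proof. by move=> df; apply/funext => x; rewrite derive1E; exact: derive_val. Qed.

Lemma derivable_is_derive f (x : R) : derivable f x 1 -> is_derive x 1 f (f^`()%classic x).
Proof. by move=> d; split => //; rewrite derive1E. Qed.

Lemma CnS_intro n f f' : (forall x : R, is_derive x 1 f (f' x)) -> Cn n f' -> Cn n.+1 f.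
Proof. by move=> df cf; split => [x|]; [exact: ex_derive|rewrite (is_derive_derive1 df)]. Qed.

Lemma Cn_derivable n f (x : R) : (forall m, Cn m f) -> derivable (f^`(n))%classic x 1.
Proof.
elim: n f x => [|n IH] f x cf; first by case: (cf 1%N) => /(_ x).
by rewrite derive1Sn; apply: IH => m; case: (cf m.+1).
Qed.

Lemma CnW n f : Cn n.+1 f -> Cn n f.
Proof.
elim: n f => //= n IH f [df [ddf cf]]; split=> //.
by apply: IH.
Qed.

Lemma Cn_add n f g : Cn n f -> Cn n g -> Cn n (fun x => f x + g x).
Proof.
elim: n f g => // n IH f g [df cf] [dg cg].
apply: (@CnS_intro _ _ (fun x => f^`()%classic x + g^`()%classic x)); last exact: IH.
by move=> x; apply: is_deriveD; exact: derivable_is_derive.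
Qed.

Lemma Cn_cst n (c : R) : Cn n (fun=> c).
Proof.
elim: n c => // n IH c; apply: (@CnS_intro _ _ (fun=> 0)) => //.
Qed.

Lemma Cn_mul n f g : Cn n f -> Cn n g -> Cn n (fun x => f x * g x).
Proof.
elim: n f g => // n IH f g [df cf] [dg cg].
apply: (@CnS_intro _ _ (fun x => f x * g^`()%classic x + g x * f^`()%classic x)).
  by move=> x; apply: is_deriveM; exact: derivable_is_derive.
by apply: Cn_add; apply: IH => //; exact: CnW.
Qed.

Lemma Cn_comp n f g : Cn n f -> Cn n g -> Cn n (fun x => f (g x)).
Proof.
elim: n f g => // n IH f g [df cf] [dg cg].
have d (x : R) : is_derive x 1 (f \o g) (f^`()%classic (g x) * g^`()%classic x).
  by apply: is_derive1_comp; exact: derivable_is_derive.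
apply: (CnS_intro d).
by apply: Cn_mul => //; apply: IH => //; exact: CnW.
Qed.

Lemma Cn_id n : Cn n (@id R).
Proof.
by case: n => // n; apply: (@CnS_intro _ _ (fun=> 1)); exact: Cn_cst.
Qed.

(* The functions [x^-n exp(-1/x)], extended by [0] for [x <= 0], are closed
   under differentiation up to linear combinations. *)
Definition flat (n : nat) (x : R) : R := if 0 < x then x ^- n * expR (- x^-1) else 0.

(** A quadratic bound forces the derivative at 0 to vanish. It comes from the term of degree [n + 2]
    in the exponential series at [x^-1]. *)
Lemma flat_bound n (x : R) : 0 <= flat n x <= (n.+2)`!%:R * x ^+ 2.
Proof.
rewrite /flat; case: ifPn => x0; last by rewrite lexx mulr_ge0// ?ler0n// sqr_ge0.
rewrite mulr_ge0 ?expR_ge0 ?invr_ge0 ?exprn_ge0 ?(ltW x0)//=.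
have y0 : 0 < x^-1 by rewrite invr_gt0.
have := expR_ge1Dxn n.+1 (ltW y0).
set F := (n.+2)`!%:R => H.
have F0 : 0 < F :> R by rewrite ltr0n fact_gt0.
rewrite expRN -exprVn -(ler_pM2r (expR_gt0 x^-1)) mulfVK ?gt_eqF ?expR_gt0//.
apply: (@le_trans _ _ (F * x ^+ 2 * (x^-1 ^+ n.+2 / F))); last first.
  by apply: ler_wpM2l; [rewrite mulr_ge0 ?sqr_ge0// ltW|lra].
rewrite le_eqVlt; apply/orP; left; apply/eqP.
rewrite -[n.+2]addn2 exprD !exprVn; field.
by apply/and3P; split; rewrite gt_eqF// exprn_gt0.
Qed.

Lemma is_derive_flat n (x : R) :
  is_derive x 1 (flat n) (- n%:R * flat n.+1 x + flat n.+2 x).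
Proof.
have [x0|x0|->] := ltgtP x 0.
- have dc := @is_derive_cst R R R (0:R) x (1:R).
  have -> : - n%:R * flat n.+1 x + flat n.+2 x = 0 by rewrite /flat !ltNge (ltW x0)/= mulr0 addr0.
  apply: near_eq_is_derive dc; near=> y.
  by rewrite /flat ltNge (_ : y <= 0)//; near: y; apply: filterS (lt_nbhsl x0) => y /ltW.
- have xn0 : x != 0 by rewrite gt_eqF.
  have dV : is_derive x 1 (fun y : R => y^-1) (- x ^- 2).
    have := @is_deriveV R id x 1 1 xn0 (is_derive_id _ _).
    by rewrite /GRing.scale/= mulr1.
  have dVn : is_derive x 1 (fun y : R => y^-1 ^+ n) (n%:R * x^-1 ^+ n.-1 * (- x ^- 2)).
    have := @is_deriveX R R (fun y : R => y^-1) n x 1 _ dV.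
    by rewrite exprfctE /GRing.scale/=; apply.
  have de : is_derive x 1 (fun y : R => expR (- y^-1)) (expR (- x^-1) * x ^- 2).
    have dN : is_derive x 1 (fun y : R => - y^-1) (x ^- 2).
      by have := is_deriveN dV; rewrite opprK.
    exact: (@is_derive1_comp R expR _ _ _ _ (is_derive_expR _) dN).
  have dM := is_deriveM dVn de.
  have E : - n%:R * flat n.+1 x + flat n.+2 x =
     x^-1 ^+ n *: (expR (- x^-1) * x ^- 2) + expR (- x^-1) *: (n%:R * x^-1 ^+ n.-1 * - x ^- 2).
    rewrite /flat x0 /GRing.scale/= -!exprVn.
    case: n {dVn dM} => [|n]/=; first by rewrite expr0; ring.
    rewrite !exprS; ring.
  rewrite E; apply: near_eq_is_derive dM; near=> y.
  have y0 : 0 < y by near: y; exact: lt_nbhsr.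
  by rewrite /flat y0 fctE exprVn.
rewrite (_ : _ + _ = 0); last by rewrite /flat ltxx mulr0 addr0.
apply: (@is_derive_squeeze _ (fun=> 0) _ (fun y => (n.+2)`!%:R * y ^+ 2)).
- by near=> y; exact: flat_bound.
- by rewrite /flat ltxx.
- by rewrite /flat ltxx expr0n/= mulr0.
have := is_deriveZ (n.+2)`!%:R (@is_deriveX R R id 2 0 1 1 (is_derive_id _ _)).
by rewrite exprfctE /GRing.scale/= expr1 mulr0 mul0r mulr0.
Unshelve. all: by end_near. Qed.

Lemma Cn_flat m n : Cn m (flat n).
Proof.
elim: m n => // m IH n; apply: CnS_intro (is_derive_flat n) _.
by apply: Cn_add => //; apply: Cn_mul => //; exact: Cn_cst.
Qed.
End Cn.

Lemma integral_is_derive (R : realType) (F g : R -> R) (a b : R) : a <= b ->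
  continuous g -> (forall x : R, is_derive x 1 F (g x)) ->
  (\int[@lebesgue_measure R]_(x in `[a, b]) (g x)%:E = (F b - F a)%:E)%E.
Proof.
move=> ab cg dF; have [G [dG GE]] := primitive_exists cg.
rewrite GE//; congr (_%:E); apply/eqP; rewrite eq_le; apply/andP; split.
- exact: (le_derive_increment ab (is_derive_within_continuous dG)
    (is_derive_within_continuous dF) (fun x _ => dG x) (fun x _ => dF x)).
- exact: (le_derive_increment ab (is_derive_within_continuous dF)
    (is_derive_within_continuous dG) (fun x _ => dF x) (fun x _ => dG x)).
Qed.

Lemma flat_le0 (R : realType) n (x : R) : x <= 0 -> flat n x = 0.
Proof. by move=> x0; rewrite /flat ltNge x0. Qed.

Lemma flat0_le (R : realType) (x y : R) : x <= y -> flat 0 x <= flat 0 y.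
Proof.
move=> xy; have [x0|x0] := leP x 0; first by rewrite (flat_le0 _ x0); case/andP: (flat_bound 0 y).
have y0 := lt_le_trans x0 xy.
by rewrite /flat x0 y0 expr0 !invr1 !mul1r ler_expR lerN2 lef_pV2.
Qed.

Lemma smooth_step (R : realType) : exists (T T' : R -> R) (C : R),
  [/\ forall n, Cn n T, forall x : R, is_derive x 1 T (T' x) /\ 0 <= T x <= 1,
      forall x : R, (x <= 0 -> T x = 0) /\ (1 <= x -> T x = 1), continuous T' &
      0 < C /\ forall x, `|T' x| <= C /\ (~~ (0 <= x <= 1) -> T' x = 0)].
Proof.
pose e1 : R := flat 0 1; pose c := flat 0 e1.
have e10 : 0 < e1 by rewrite /e1 /flat ltr01 mulr_gt0 ?expR_gt0// expr0 invr1.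
have c0 : 0 < c by rewrite /c /flat e10 mulr_gt0 ?expR_gt0// expr0 invr1.
(* For [x <= 0] the inner value is at least [e1], so the outer argument is at most 0; for [x >= 1]
   the inner value is 0. Nesting [flat 0] gives a step without a quotient of functions, so sums,
   products and compositions suffice for smoothness. *)
pose T x := flat 0 (e1 + (-1) * flat 0 (1 + (-1) * x)) * c^-1.
have cT n : Cn n T.
  apply: Cn_mul; last exact: Cn_cst.
  apply: (Cn_comp (Cn_flat n 0)); apply: Cn_add; first exact: Cn_cst.
  apply: Cn_mul; first exact: Cn_cst.
  apply: (Cn_comp (Cn_flat n 0)); apply: Cn_add; first exact: Cn_cst.
  by apply: Cn_mul; [exact: Cn_cst|exact: Cn_id].
pose T' := (T^`()%classic).
have dT (x : R) : is_derive x 1 T (T' x).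
  by apply: derivable_is_derive; case: (cT 1%N).
have dT' (x : R) : is_derive x 1 T' (T'^`()%classic x).
  by apply: derivable_is_derive; case: (cT 2%N) => _ [].
have cT' : continuous T' by move=> x; exact: is_derive_continuous (dT' x).
have T01 x : 0 <= T x <= 1.
  rewrite /T mulr_ge0 ?invr_ge0 ?(ltW c0)//=; last by case/andP: (flat_bound 0 (e1 + -1 * flat 0 (1 + -1 * x))).
  rewrite ler_pdivrMr// mul1r flat0_le//.
  by case/andP: (flat_bound 0 (1 + -1 * x)); lra.
have Tl x : x <= 0 -> T x = 0.
  move=> x0; rewrite /T.
  have h : e1 <= flat 0 (1 + -1 * x) by apply: flat0_le; lra.
  by rewrite flat_le0 ?mul0r// mulN1r subr_le0.
have Tr x : 1 <= x -> T x = 1.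
  move=> x1; rewrite /T [X in e1 + _ * X](_ : _ = 0) ?mulr0 ?addr0 ?divff ?gt_eqF//.
  by rewrite flat_le0//; lra.
have T'0 x : ~~ (0 <= x <= 1) -> T' x = 0.
  rewrite negb_and -!ltNge => /orP[x0|x1].
  - rewrite /T' derive1E; have dc := @is_derive_cst R R R (0:R) x (1:R).
    apply: derive_val; apply: near_eq_is_derive dc.
    by near=> y; rewrite Tl//; near: y; apply: filterS (lt_nbhsl x0) => y /ltW.
  - rewrite /T' derive1E; have dc := @is_derive_cst R R R (1:R) x (1:R).
    apply: derive_val; apply: near_eq_is_derive dc.
    by near=> y; rewrite Tr//; near: y; apply: filterS (lt_nbhsr x1) => y /ltW.
have [s _ Hs] := @EVT_max R (fun x => `|T' x|) 0 1 ler01 (continuous_subspaceT (fun x => cvg_norm (cT' x))).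
exists T, T', (`|T' s| + 1); split => //; first by move=> x; split; [exact: Tl|exact: Tr].
split => [|x]; first by rewrite ltr_wpDl.
split; last exact: T'0.
have [x01|nx] := boolP (0 <= x <= 1).
  by rewrite (le_trans (Hs x _)) ?in_itv//; lra.
by rewrite T'0// normr0 addr_ge0.
Unshelve. all: by end_near. Qed.

Section approximate_identity.
Context {R : realType}.
Let mu := @lebesgue_measure R.
Local Open Scope ereal_scope.

Lemma integrableM_bounded (D : set R) (u g : R -> R) (M : R) :
  measurable D -> mu.-integrable D (EFin \o u) -> measurable_fun D g ->
  (forall x, D x -> `|g x| <= M)%R ->
  mu.-integrable D (EFin \o (fun x => u x * g x)%R).
Proof.
move=> mD iu mg gM.
have mu_ : measurable_fun D u by apply/measurable_EFinP; exact: measurable_int iu.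
apply: (@le_integrable _ _ _ mu D mD _ (fun x => M%:E * (u x)%:E)).
- by apply/measurable_EFinP; exact: measurable_funM.
- move=> x Dx; rewrite -EFinM /= lee_fin !normrM mulrC ler_wpM2r//.
  by rewrite (le_trans (gM x Dx)) ?ler_norm.
exact: integrableZl.
Qed.

Lemma integrable_cst_itv (l r c : R) : mu.-integrable `[l, r] (EFin \o cst c).
Proof.
apply: continuous_compact_integrable; first exact: segment_compact.
by apply: continuous_subspaceT => x; exact: cst_continuous.
Qed.

(** Since [k] has mass 1, the error is the integral of [(u - u c) k]. The support [[c, c + d]] lies
    in the open ball of radius [2 d], whose measure [4 d] times the height [C / d] gives the factor
    [4 C]. *)
Lemma kernel_average_le (l r c d C : R) (u k : R -> R) :
  (0 < d)%R -> (0 <= C)%R ->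
  mu.-integrable `[l, r] (EFin \o u) -> measurable_fun (`[l, r] : set R) k ->
  (l <= c <= r)%R ->
  (forall x, `|k x| <= C / d)%R -> (forall x, ~~ (c <= x <= c + d) -> k x = 0)%R ->
  (\int[mu]_(x in `[l, r]) k x = 1)%R ->
  (`|(\int[mu]_(x in `[l, r]) (u x * k x))%R - u c|)%:E <=
  (4 * C)%:E * davg (u \_ `[l, r]) c (2 * d)%R.
Proof.
move=> d0 C0 iu mk lcr kC k0 k1.
set K := `[l, r]%classic in iu mk k1 *.
have mK : measurable K by exact: measurable_itv.
have mu_ : measurable_fun K u by apply/measurable_EFinP; exact: measurable_int iu.
have iuc : mu.-integrable K (EFin \o (fun x => u x - u c)%R).
  exact: (@integrableB _ _ R mu K mK _ _ iu (integrable_cst_itv l r (u c))).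
have iuk := integrableM_bounded mK iu mk (fun x _ => kC x).
have ick : mu.-integrable K (EFin \o (fun x => u c * k x)%R).
  exact: (integrableM_bounded mK (integrable_cst_itv l r (u c)) mk (fun x _ => kC x)).
have ik : mu.-integrable K (EFin \o k).
  have := integrableM_bounded mK (integrable_cst_itv l r 1%R) mk (fun x _ => kC x).
  by congr (_.-integrable _ _); apply/funext => x /=; rewrite mul1r.
have -> : ((\int[mu]_(x in K) (u x * k x))%R - u c = (\int[mu]_(x in K) ((u x - u c) * k x))%R)%R.
  rewrite (_ : (fun x => (u x - u c) * k x)%R = (fun x => u x * k x - u c * k x)%R); last first.
    by apply/funext => x; rewrite mulrBl.
  by rewrite RintegralB// RintegralZl// k1 mulr1.
have iuck := integrableM_bounded mK iuc mk (fun x _ => kC x).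
have Cd0 : (0 <= C / d)%R by rewrite divr_ge0// ltW.
have mball : measurable (ball c (2 * d)%R) by exact: measurable_ball.
have muK : measurable_fun setT (u \_ K) by apply/(measurable_restrictT _ mK).
have mB : measurable_fun (ball c (2 * d)%R) (fun y => `|(u \_ K) y - u c|%:E).
  apply/measurable_EFinP; apply: measurableT_comp => //; apply: measurable_funB => //.
  exact: measurable_funS muK.
rewrite -abse_EFin /Rintegral fineK; last exact: integrable_fin_num.
apply: le_trans (le_abse_integral _ _ _) _ => //; first exact: measurable_int iuck.
apply: (@le_trans _ _ (\int[mu]_(y in ball c (2 * d)%R) ((C / d)%:E * `|(u \_ K) y - u c|%:E))).
  rewrite [leRHS]integral_mkcond [leLHS]integral_mkcond.
  apply: ge0_le_integral => //.
  - by move=> x _; rewrite patchE; case: ifPn.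
  - apply/(measurable_restrictT _ mK); apply: measurableT_comp => //.
    exact: measurable_int iuck.
  - by apply/(measurable_restrictT _ mball); apply: emeasurable_funM.
  move=> x _; rewrite !patchE; case: ifPn => [xK|_]; last first.
    by case: ifPn => // _; rewrite -EFinM lee_fin mulr_ge0.
  case: ifPn => xb.
    rewrite -EFinM abse_EFin lee_fin normrM mulrC ler_wpM2r//.
  rewrite abse_EFin k0 ?mulr0 ?normr0//.
  apply/negP => /andP[cx xcd]; move/negP: xb; apply; rewrite inE /ball/=.
  by rewrite ler0_norm; lra.
rewrite (@ge0_integralZl _ _ R mu _ mball _ mB) ?lee_fin//.
rewrite /davg /iavg lebesgue_measure_ball; last by rewrite mulr_ge0 ?ltW.
have uKc : (u \_ K) c = u c by rewrite patchE mem_set//= in_itv.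
rewrite [X in _ * (_ * X)](_ : _ = \int[mu]_(y in ball c (2 * d)%R) `|(u \_ K) y - u c|%:E); last first.
  by apply: eq_integral => y _; rewrite /= uKc.
rewrite muleA lee_wpmul2r ?integral_ge0//.
rewrite inver gt_eqF ?pmulrn_lgt0 ?mulr_gt0// -EFinM lee_fin.
by rewrite le_eqVlt; apply/orP; left; apply/eqP; field; rewrite gt_eqF.
Qed.
End approximate_identity.

Section weak_increment.
Context {R : realType}.
Let mu := @lebesgue_measure R.

Lemma locally_integrable_itv (l r : R) (u : R -> R) : 0 < l -> r < 1 ->
  locally_integrable unit_itv u -> mu.-integrable `[l, r] (EFin \o u).
Proof.
move=> l0 r1 [mu_ oI iu].
have sub : `[l, r] `<=` @unit_itv R by move=> x; rewrite /unit_itv/= !in_itv/=; lra.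
apply/integrableP; split.
  have mI : measurable (@unit_itv R) by exact: measurable_itv.
  by apply/measurable_EFinP; exact: (measurable_funS mI sub mu_).
by apply: iu => //; exact: segment_compact.
Qed.

Lemma Rintegral_supp (A B : set R) (g : R -> R) : A `<=` B ->
  (forall x, B x -> ~ A x -> g x = 0) ->
  \int[mu]_(x in B) g x = \int[mu]_(x in A) g x.
Proof.
move=> AB g0; rewrite Rintegral_mkcond [RHS]Rintegral_mkcond.
congr Rintegral; apply/funext => x; rewrite !patchE.
have [xA|nxA] := pselect (A x); first by rewrite !mem_set//; exact: AB.
rewrite [x \in A]memNset//; case: ifPn => // xB; apply: g0 => //.
by rewrite -inE.
Qed.

Lemma is_derive_affine (c e x : R) : is_derive x 1 (fun y : R => (y - c) * e) e.
Proof.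
have := is_deriveM (is_deriveB (is_derive_id x 1) (is_derive_cst c x 1)) (is_derive_cst e x 1).
by rewrite /GRing.scale/= mulr0 add0r subr0 mulr1; apply.
Qed.

(** The test function is a difference of two smooth steps of width [d n], starting at [a] and at
    [b]. Its derivative is a difference of two kernels whose averages of [u] converge at Lebesgue
    points, while the function itself tends to the indicator of []a, b]]. *)
Lemma weak_increment (u v : R -> R) (l a b r : R) :
  weak_derivative unit_itv u v ->
  0 < l -> l < a -> a < b -> b < r -> r < 1 ->
  lebesgue_pt (u \_ `[l, r]) a -> lebesgue_pt (u \_ `[l, r]) b ->
  u b - u a = \int[mu]_(x in `]a, b]) v x.
Proof.
move=> [liu liv weak] l0 la ab br r1 pta ptb.
have iu := locally_integrable_itv l0 r1 liu.
have iv := locally_integrable_itv l0 r1 liv.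
have [T [T' [C [cT dT Tv cT' [C0 T'C]]]]] := smooth_step R.
set K := `[l, r]%classic in iu iv pta ptb.
have mK : measurable K by exact: measurable_itv.
have KI : K `<=` unit_itv by move=> x; rewrite /K /unit_itv/= !in_itv/=; lra.
(* The widths tend to 0 and are at most [r - b], which keeps both transition zones inside
   [[l, r]]. *)
pose d n : R := (r - b) * n.+1%:R^-1.
have d0 n : 0 < d n by rewrite mulr_gt0 ?invr_gt0//; lra.
have dr n : d n <= r - b.
  rewrite /d ler_piMr//; first by lra.
  by rewrite invf_le1// ler1n.
have dlt (e : R) : 0 < e -> \forall n \near \oo, d n < e.
  move=> e0; have rb : 0 < r - b by lra.
  near=> n; rewrite /d mulrC -ltr_pdivlMr//.
  by near: n; exact: (near_infty_natSinv_lt (PosNum (divr_gt0 e0 rb))).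
pose k c n x : R := T' ((x - c) / d n) / d n.
have dk c n (x : R) : is_derive x 1 (fun y : R => T ((y - c) / d n)) (k c n x).
  exact: (@is_derive1_comp R T _ _ _ _ (dT _).1 (is_derive_affine c (d n)^-1 x)).
have ck c n : continuous (k c n).
  move=> x; apply: cvgMl; apply: (@continuous_comp _ _ _ (fun y : R => (y - c) / d n) T'); last exact: cT'.
  by apply: cvgMl; apply: cvgB; [exact: cvg_id|exact: cvg_cst].
have kC c n x : `|k c n x| <= C / d n.
  by rewrite normrM [`|(d n)^-1|]gtr0_norm ?invr_gt0// ler_pM2r ?invr_gt0//; case: (T'C ((x - c) / d n)).
have k0 c n x : ~~ (c <= x <= c + d n) -> k c n x = 0.
  move=> nx; rewrite /k (T'C _).2 ?mul0r//; apply: contra nx.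
  by rewrite ler_pdivrMr// ler_pdivlMr// mul0r mul1r; lra.
have k1 c n : l < c -> c <= b -> \int[mu]_(x in K) k c n x = 1.
  move=> lc cb; rewrite /Rintegral (@integral_is_derive _ _ _ _ _ _ (ck c n) (dk c n)) /=; last by lra.
  have dn0 := d0 n; have drn := dr n.
  rewrite (Tv _).2 ?(Tv _).1 ?subr0//.
    by rewrite pmulr_lle0 ?invr_gt0//; lra.
  by rewrite ler_pdivlMr// mul1r; lra.
have J c : l < c -> c <= b -> lebesgue_pt (u \_ K) c ->
    \int[mu]_(x in K) (u x * k c n x) @[n --> \oo] --> u c.
  move=> lc cb ptc.
  have d20 : (2 * d n) @[n --> \oo] --> 0^'+.
    move=> A [e /= e0 He]; suff : \forall n \near \oo, A (2 * d n) by [].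
    near=> n; have p2 : 0 < 2 * d n by rewrite mulr_gt0.
    apply: (He _ _ p2).
    rewrite /ball/= sub0r normrN (gtr0_norm p2) mulrC -ltr_pdivlMr//.
    by near: n; apply: dlt; rewrite divr_gt0.
  have dav : davg (u \_ K) c (2 * d n) @[n --> \oo] --> 0%E.
    exact: (cvg_comp _ _ d20 ptc).
  have dav4 : ((4 * C)%:E * davg (u \_ K) c (2 * d n))%E @[n --> \oo] --> 0%E.
    by have := @cvgeZl _ _ _ _ _ (4 * C)%:E isT dav; rewrite mule0; apply.
  pose q n : R := `|(\int[mu]_(x in K) (u x * k c n x))%R - u c|.
  suff h : (q n)%:E @[n --> \oo] --> 0%:E.
    by apply/subr_cvg0; apply: norm_cvg0; exact: (fine_cvg h).
  apply: squeeze_cvge (cvg_cst 0%E) dav4; near=> n.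
  rewrite lee_fin normr_ge0 /=.
  apply: kernel_average_le (d0 n) (ltW C0) iu _ _ (kC c n) (k0 c n) (k1 c n lc cb); last by lra.
  exact: measurable_funS (continuous_measurable_fun (ck c n)).
pose psi n x := T ((x - a) / d n) - T ((x - b) / d n).
have dpsi n (x : R) : is_derive x 1 (psi n) (k a n x - k b n x).
  by apply: is_deriveB; exact: dk.
have cpsi n : continuous (psi n) by move=> x; exact: is_derive_continuous (dpsi n x).
have psi0 n x : ~ K x -> psi n x = 0.
  rewrite /K/= in_itv/= => /negP; rewrite negb_and -!ltNge => /orP[xl|rx]; rewrite /psi.
    by rewrite !(Tv _).1 ?subrr// pmulr_lle0 ?invr_gt0//; lra.
  have drn := dr n.
  by rewrite !(Tv _).2 ?subrr// ler_pdivlMr// mul1r; lra.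
have test n : test_function unit_itv (psi n).
  split; last by exists K; split => //; [exact: segment_compact|exact: psi0].
  move=> m x; apply: Cn_derivable => q.
  have cl c : Cn q (fun y : R => (y - c) / d n).
    apply: (@Cn_mul _ q (fun y => y - c) (fun=> (d n)^-1)); last exact: Cn_cst.
    by apply: (@Cn_add _ q id (fun=> - c)); [exact: Cn_id|exact: Cn_cst].
  rewrite (_ : psi n = fun y => T ((y - a) / d n) + (-1) * T ((y - b) / d n)); last first.
    by apply/funext => y; rewrite mulN1r.
  apply: Cn_add; first exact: (Cn_comp (cT q) (cl a)).
  by apply: Cn_mul; [exact: Cn_cst|exact: (Cn_comp (cT q) (cl b))].
have weakK n : \int[mu]_(x in K) (u x * k a n x) - \int[mu]_(x in K) (u x * k b n x) =
    - \int[mu]_(x in K) (v x * psi n x).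
  have iuk c : mu.-integrable K (EFin \o (fun x => u x * k c n x)).
    apply: (integrableM_bounded mK iu _ (fun x _ => kC c n x)).
    exact: measurable_funS (continuous_measurable_fun (ck c n)).
  rewrite -RintegralB//.
  have := weak _ (test n).
  rewrite (is_derive_derive1 (dpsi n)).
  rewrite (Rintegral_supp KI) => [|x _ nK]; last first.
    move: nK; rewrite /K/= in_itv/= => /negP nK; have drn := dr n.
    by rewrite !k0 ?subrr ?mulr0//; apply: contra nK; lra.
  rewrite (Rintegral_supp KI) => [|x _ nK]; last by rewrite psi0// mulr0.
  by move=> <-; apply: eq_Rintegral => x _; rewrite mulrBr.
have psi1 n x : `|psi n x| <= 1.
  rewrite ler_norml /psi; have [_ /andP[]] := dT ((x - a) / d n).
  by have [_ /andP[]] := dT ((x - b) / d n); lra.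
(* The limit is open at [a] and closed at [b] because the step [T] still vanishes at 0. *)
pose chi x : R := (a < x <= b)%R%:R.
have Tchi c x : T ((x - c) / d n) @[n --> \oo] --> ((c < x)%R%:R : R).
  apply: cvg_near_cst; have [cx|xc] := ltP c x; near=> n.
    rewrite (Tv _).2// ler_pdivlMr// mul1r ltW//.
    by near: n; apply: dlt; rewrite subr_gt0.
  by rewrite (Tv _).1// pmulr_lle0 ?invr_gt0// subr_le0.
have psichi x : psi n x @[n --> \oo] --> chi x.
  rewrite (_ : chi x = (a < x)%R%:R - (b < x)%R%:R :> R); first exact: cvgB.
  rewrite /chi; case: (ltP a x) => ax; case: (leP x b) => bx /=; rewrite ?subr0 ?subrr//.
  by lra.
have V : \int[mu]_(x in K) (v x * psi n x) @[n --> \oo] --> \int[mu]_(x in K) (v x * chi x).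
  have mv : measurable_fun K v by apply/measurable_EFinP; exact: measurable_int iv.
  have mvpsi n : measurable_fun K (fun x => (v x * psi n x)%:E).
    apply/measurable_EFinP; apply: measurable_funM => //.
    exact: measurable_funS (continuous_measurable_fun (cpsi n)).
  have mchi : measurable_fun K (fun x => (v x * chi x)%:E).
    apply/measurable_EFinP; apply: measurable_funM => //.
    rewrite (_ : chi = \1_(`]a, b]%classic)); first by apply: measurable_indic; exact: measurable_itv.
    by apply/funext => x; rewrite indicE mem_setE in_itv.
  have mvc : {ae mu, forall x, K x -> (v x * psi n x)%:E @[n --> \oo] --> (v x * chi x)%:E}.
    apply: aeW => x _; apply: cvg_EFin; first by near=> n.
    by apply: cvgMr; exact: psichi.
  have mvb : {ae mu, forall x n, K x -> (`|(v x * psi n x)%:E| <= `|v x|%:E)%E}.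
    by apply: aeW => x n _; rewrite abse_EFin lee_fin normrM ler_piMr.
  have iav : mu.-integrable K (fun x => `|v x|%:E) by have := integrable_abse iv; apply.
  have [iK _ cV] := @dominated_convergence _ _ R mu K mK (fun n x => (v x * psi n x)%:E) (fun x => (v x * chi x)%:E)
     (fun x => `|v x|%:E) mvpsi mchi mvc iav mvb.
  apply: (@fine_cvg _ _ _ _ (fun n => \int[mu]_(x in K) (v x * psi n x)%:E)%E).
  by rewrite fineK//; exact: integrable_fin_num.
have E : u a - u b = - \int[mu]_(x in K) (v x * chi x).
  pose A n := \int[mu]_(x in K) (u x * k a n x) - \int[mu]_(x in K) (u x * k b n x).
  have h1 : A n @[n --> \oo] --> u a - u b.
    by apply: cvgB; [exact: (J a la (ltW ab) pta)|exact: (J b (lt_trans la ab) (lexx _) ptb)].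
  have h2 : A n @[n --> \oo] --> - \int[mu]_(x in K) (v x * chi x).
    by rewrite /A; under eq_fun do rewrite weakK; exact: cvgN.
  by rewrite -(cvg_lim _ h1)// -(cvg_lim _ h2).
rewrite -opprB E opprK.
rewrite (@Rintegral_supp `]a, b] K).
- apply: eq_Rintegral => x; rewrite inE/= in_itv/= => abx.
  by rewrite /chi abx mulr1.
- by move=> x; rewrite /K/= !in_itv/=; lra.
- by move=> x _; rewrite /chi/= in_itv/= => /negP/negbTE ->; rewrite mulr0.
Unshelve. all: by end_near. Qed.
End weak_increment.

Section sobolev_increments.
Context {R : realType}.
Let mu := @lebesgue_measure R.

Lemma locally_integrable_restrict (l r : R) (u : R -> R) : 0 < l -> r < 1 ->
  locally_integrable unit_itv u -> locally_integrable setT (u \_ `[l, r]).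
Proof.
move=> l0 r1 lu; have iu := locally_integrable_itv l0 r1 lu.
apply: open_integrable_locally; first exact: openT.
rewrite (_ : EFin \o _ = (EFin \o u) \_ `[l, r]); last first.
  by apply/funext => x /=; rewrite !patchE; case: ifPn.
by rewrite -integrable_mkcond.
Qed.

(** As [u] is only locally integrable in the open interval, it is cut off to an exhausting sequence
    of compact intervals; the sequence is countable, so almost every point is good. *)
Definition good_pt (u : R -> R) (x : R) :=
  0 < x < 1 /\ forall n, lebesgue_pt (u \_ `[(n.+2%:R)^-1, 1 - (n.+2%:R)^-1]) x.

Lemma ae_good_pt (u : R -> R) : locally_integrable unit_itv u ->
  {ae mu, forall x, 0 < x < 1 -> good_pt u x}.
Proof.
move=> lu.
have h n : {ae mu, forall x, lebesgue_pt (u \_ `[(n.+2%:R)^-1, 1 - (n.+2%:R)^-1]) x}.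
  apply: lebesgue_differentiation; apply: locally_integrable_restrict => //.
have := ae_foralln (fun n => h n).
by move=> /ae_impl; apply => x H x01; split.
Qed.

Lemma good_pt_increment (u v : R -> R) (a b : R) :
  weak_derivative unit_itv u v -> good_pt u a -> good_pt u b -> a < b ->
  u b - u a = \int[mu]_(x in `]a, b]) v x.
Proof.
move=> wd [a01 ga] [b01 gb] ab.
pose e : R := Num.min a (1 - b).
have e0 : 0 < e by rewrite lt_min; lra.
have [n] : exists n : nat, (n.+2%:R)^-1 < e.
  have := near_infty_natSinv_lt (PosNum e0); case=> N _ /(_ N.+1) /=.
  by move=> h; exists N; apply: h => /=.
rewrite lt_min => /andP[na nb].
have n0 : 0 < (n.+2%:R)^-1 :> R by rewrite invr_gt0.
apply: (weak_increment wd n0 na ab _ _ (ga n) (gb n)); last by rewrite ltrBlDr ltrDl.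
by rewrite ltrBrDl -ltrBrDr.
Qed.

Lemma exists_good_pt (u : R -> R) (c : R) : locally_integrable unit_itv u ->
  0 < c < 1 -> exists2 a, good_pt u a & a < c.
Proof.
move=> lu c01; have [N [mN N0 PN]] := ae_good_pt lu.
have [[x [xc xN]]|h] := pselect (exists x, `]0, c[%classic x /\ ~ N x).
  move: xc; rewrite /= in_itv/= => /andP[x0 xc]; exists x => //.
  by have [//|ng] := pselect (good_pt u x); exfalso; apply/xN/PN => /(_ ltac:(lra)).
have : (mu `]0%R, c[ <= mu N)%E.
  apply: le_measure; rewrite ?inE//.
  by move=> x xc; apply: contrapT => xN; apply: h; exists x.
by rewrite [X in (_ <= X)%E]N0 /mu lebesgue_measure_itv/= lte_fin (proj1 (andP c01)) -EFinB lee_fin; lra.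
Qed.

(** The constant is the value at [x0] of the continuous representative. As [x0] itself may fail to
    be a good point, this value is computed from a good point [a] to its left. *)
Lemma sobolev_representative (u v : R -> R) (x0 : R) :
  weak_derivative unit_itv u v -> 0 < x0 < 1 -> exists c,
   {ae mu, forall x, x0 < x < 1 ->
     (`|u x - c|%:E <= \int[mu]_(t in `]x0, x[) `|v t|%:E)%E} /\
   {ae mu, forall x, 0 < x < x0 ->
     (`|u x - c|%:E <= \int[mu]_(t in `]x, x0[) `|v t|%:E)%E}.
Proof.
move=> wd x01; have [lu lv _] := wd.
have [a ga ax0] := exists_good_pt lu x01.
have [a01 _] := ga.
pose I x y := \int[mu]_(t in `]x, y]) v t.
have iv x y : 0 < x -> y < 1 -> mu.-integrable `]x, y] (EFin \o v).
  move=> xp y1; have := locally_integrable_itv xp y1 lv.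
  by apply: integrableS => //; apply: subset_itvr; rewrite bnd_simp.
have Isplit x y z : 0 < x -> x <= y -> y <= z -> z < 1 -> I x z = I x y + I y z.
  move=> xp xy yz z1; rewrite /I.
  have := @Rintegral_itvB _ v (BRight x) (BRight z) y (iv x z xp z1).
  by rewrite !bnd_simp => /(_ xy yz) <-; rewrite addrC subrK.
have Iabs x y : 0 < x -> x <= y -> y < 1 -> (`|I x y|%:E <= \int[mu]_(t in `]x, y[) `|v t|%:E)%E.
  move=> xp xy y1; have ivxy := iv x y xp y1.
  have mvxy := measurable_int _ ivxy.
  rewrite -abse_EFin /I /Rintegral fineK; last exact: integrable_fin_num.
  apply: le_trans (le_abse_integral _ _ _) _ => //.
  rewrite [leRHS]integral_itv_bndo_bndc//.
  have mvo : measurable_fun `]x, y] v by apply/measurable_EFinP.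
  apply/measurable_EFinP; apply: measurableT_comp => //.
  by apply: measurable_funS mvo => //; apply: subset_itvl; rewrite bnd_simp.
exists (u a + I a x0); split.
  apply: (ae_impl (ae_good_pt lu)) => x H x0x.
  have gx : good_pt u x by apply: H; lra.
  have E := good_pt_increment wd ga gx (ltac:(lra)).
  have S := Isplit a x0 x (ltac:(lra)) (ltac:(lra)) (ltac:(lra)) (ltac:(lra)).
  rewrite -/(I a x) S in E.
  have -> : u x - (u a + I a x0) = I x0 x by lra.
  by apply: Iabs; lra.
apply: (ae_impl (ae_good_pt lu)) => x H x0x.
have gx : good_pt u x by apply: H; lra.
have [ax|xa|ax] := ltgtP a x.
- have E := good_pt_increment wd ga gx ax.
  rewrite -/(I a x) in E.
  have S := Isplit a x x0 (ltac:(lra)) (ltac:(lra)) (ltac:(lra)) (ltac:(lra)).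
  rewrite S.
  have -> : u x - (u a + (I a x + I x x0)) = - I x x0 by lra.
  by rewrite normrN; apply: Iabs; lra.
- have E := good_pt_increment wd gx ga xa.
  rewrite -/(I x a) in E.
  have S := Isplit x a x0 (ltac:(lra)) (ltac:(lra)) (ltac:(lra)) (ltac:(lra)).
  have -> : u x - (u a + I a x0) = - I x x0 by rewrite S; lra.
  by rewrite normrN; apply: Iabs; lra.
- rewrite -ax opprD addrA subrr sub0r normrN; apply: Iabs; lra.
Qed.
End sobolev_increments.

(** * From fields to a lower bound for [mu_p] *)

Lemma exists_between_ge1 (R : realType) (q lam : R) : 1 < lam -> q < lam ->
  exists2 nu, 1 <= nu < lam & q < nu.
Proof.
move=> lam1 ql; exists (Num.max 1 ((q + lam) / 2)).
  by rewrite le_max lexx/= gt_max lam1/=; lra.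
by rewrite lt_max; apply/orP; right; lra.
Qed.

Section lower_bound.
Context {R : realType}.
Let mu := @lebesgue_measure R.
Local Open Scope ereal_scope.

Lemma ge0_integral_lty_le (D : set R) (g g' : R -> R) : measurable D ->
  measurable_fun D g -> measurable_fun D g' ->
  (forall x, D x -> 0 <= g x <= g' x)%R ->
  \int[mu]_(x in D) (g' x)%:E < +oo -> \int[mu]_(x in D) (g x)%:E < +oo.
Proof.
move=> mD mg mg' gg'; apply: le_lt_trans; apply: ge0_le_integral => //.
- by move=> x /gg' /andP[g0 _]; rewrite lee_fin.
- exact/measurable_EFinP.
- exact/measurable_EFinP.
- by move=> x /gg' /andP[_ gg]; rewrite lee_fin.
Qed.

(** A quotient below [lam] would leave room for some [nu] strictly between the two, and
    [poincare_two_fields] for this [nu] excludes it. *)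
Lemma mu_p_lower_bound (p lam : R) (f : R -> R) :
  (1 < p)%R -> (1 < lam)%R -> measurable_fun unit_itv f ->
  (forall x, unit_itv x -> 0 < f x)%R ->
  (forall nu, 1 <= nu < lam -> exists x0, [/\ 0 < x0 < 1,
     neumann_field p nu f x0 &
     neumann_field p nu (fun x => f (1 - x)) (1 - x0)])%R ->
  lam%:E <= mu_p p unit_itv f.
Proof.
move=> p1 lam1 mf f0 field; apply: le_ereal_inf_tmp => _ [u [v [[wd fin] u_n0 u0 ->]]].
have mD : measurable (@unit_itv R) by exact: measurable_itv.
have [[mu_ _ _] [mv _ _] _] := wd.
have mpow (g : R -> R) : measurable_fun unit_itv g -> measurable_fun unit_itv (fun x => `|g x| `^ p)%R.
  move=> mg; apply: (measurableT_comp (measurable_powR _)).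
  exact: (@measurableT_comp _ _ _ _ _ _ (fun y : R => `|y|)%R).
have mfpow (g : R -> R) : measurable_fun unit_itv g -> measurable_fun unit_itv (fun x => f x * `|g x| `^ p)%R.
  by move=> mg; apply: measurable_funM => //; exact: mpow.
have msum : measurable_fun unit_itv (fun x => f x * (`|u x| `^ p + `|v x| `^ p))%R.
  by apply: measurable_funM => //; apply: measurable_funD; exact: mpow.
have finu : \int[mu]_(x in unit_itv) (f x * `|u x| `^ p)%:E < +oo.
  apply: (ge0_integral_lty_le mD (mfpow _ mu_) msum _ fin) => x Dx.
  by rewrite mulr_ge0 ?powR_ge0 ?(ltW (f0 x Dx))//= ler_wpM2l ?(ltW (f0 x Dx))// lerDl powR_ge0.
have finv : \int[mu]_(x in unit_itv) (f x * `|v x| `^ p)%:E < +oo.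
  apply: (ge0_integral_lty_le mD (mfpow _ mv) msum _ fin) => x Dx.
  by rewrite mulr_ge0 ?powR_ge0 ?(ltW (f0 x Dx))//= ler_wpM2l ?(ltW (f0 x Dx))// lerDr powR_ge0.
have pos (g : R -> R) : 0 <= \int[mu]_(x in unit_itv) (f x * `|g x| `^ p)%:E.
  by apply: integral_ge0 => x Dx; rewrite lee_fin mulr_ge0 ?powR_ge0 ?(ltW (f0 x Dx)).
(* Were the denominator 0, [u] would vanish almost everywhere because [f] is positive. *)
have B0 : \int[mu]_(x in unit_itv) (f x * `|u x| `^ p)%:E != 0.
  apply/eqP => B0; apply: u_n0.
  have mB : measurable_fun unit_itv (fun x => (f x * `|u x| `^ p)%:E) by apply/measurable_EFinP; exact: mfpow.
  have /(ae_eq_integral_abs mu mD mB) : \int[mu]_(x in unit_itv) `|(f x * `|u x| `^ p)%:E| = 0.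
    rewrite -[RHS]B0; apply: eq_integral => x; rewrite inE => Dx.
    by rewrite abse_EFin ger0_norm// mulr_ge0 ?powR_ge0 ?(ltW (f0 x Dx)).
  move=> /ae_impl; apply => x H Dx; have /eqP := H Dx.
  rewrite eqe mulf_eq0 gt_eqF ?f0//= powR_eq0 normr_eq0 => /andP[/eqP ->].
  by [].
rewrite lee_fin /Rintegral.
set B := \int[mu]_(x in _) (f x * `|u x| `^ p)%:E in finu B0 *.
set A := \int[mu]_(x in _) (f x * `|v x| `^ p)%:E in finv *.
have Bf : B \is a fin_num by rewrite ge0_fin_numE; [exact: finu|exact: pos].
have Af : A \is a fin_num by rewrite ge0_fin_numE; [exact: finv|exact: pos].
have fB0 : (0 < fine B)%R by rewrite fine_gt0// finu lt0e B0 pos.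
rewrite leNgt; apply/negP => /(exists_between_ge1 lam1)[nu nu1 qnu].
have [x0 [x01 Fr Fl]] := field nu nu1.
have [c [ur ul]] := sobolev_representative wd x01.
have nu0 : (0 <= nu)%R by apply: le_trans ler01 _; case/andP: nu1.
have := poincare_two_fields p1 nu0 x01 Fr Fl mf mu_ mv (fun x Dx => ltW (f0 x Dx)) ur ul finu u0.
by rewrite -/A -/B -(fineK Af) -(fineK Bf) -EFinM lee_fin -ler_pdivlMr// leNgt qnu.
Qed.
End lower_bound.

(** * Riccati fields *)

(** An integrated form of [(ln f)' <= a], which requires no differentiability of [f]. *)
Definition slope_le (R : realType) (f : R -> R) (a c d : R) :=
  forall x y, c < x -> x < y -> y < d -> f y <= f x * expR (a * (y - x)).

Section riccati.
Context {R : realType}.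
Let mu := @lebesgue_measure R.

Lemma integral_itvoo_le_derive (F g : R -> R) (a b : R) : a <= b ->
  continuous g -> (forall x : R, is_derive x 1 F (g x)) -> (forall x, 0 <= g x) ->
  (\int[mu]_(x in `]a, b[) (g x)%:E <= (F b - F a)%:E)%E.
Proof.
move=> ab cg dF g0; rewrite -(integral_is_derive ab cg dF).
apply: ge0_subset_integral => //.
- by apply/measurable_EFinP; exact: measurable_funS (continuous_measurable_fun cg).
- by move=> x _; rewrite lee_fin.
- by move=> x /=; rewrite !in_itv/=; lra.
Qed.

(** The flux [f k^(p-1)] for the model weight [f x = expR (a * x)], with [E = expR g] and
    [k^(p-1) = eta E^(p-1)]. *)
Definition riccati_potential (p a : R) (eta g : R -> R) (x : R) :=
  expR (a * x) * eta x * expR ((p - 1) * g x).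

Lemma is_derive_riccati_potential (p a x d e : R) (eta g : R -> R) :
  is_derive x 1 eta d -> is_derive x 1 g e ->
  is_derive x 1 (riccati_potential p a eta g)
  (expR (a * x) * expR ((p - 1) * g x) * (a * eta x + d + (p - 1) * (eta x * e))).
Proof.
move=> deta dg.
have dl (b : R) : is_derive x 1 (fun y : R => b * y) b.
  by have := is_deriveZ b (is_derive_id x 1); rewrite /GRing.scale/= mulr1.
have de : is_derive x 1 (fun y : R => expR (a * y)) (expR (a * x) * a).
  exact: (@is_derive1_comp R expR _ _ _ _ (is_derive_expR _) (dl a)).
have dN : is_derive x 1 (fun y : R => expR ((p - 1) * g y)) (expR ((p - 1) * g x) * ((p - 1) * e)).
  have dg' : is_derive x 1 (fun y : R => (p - 1) * g y) ((p - 1) * e).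
    exact: (is_deriveZ (p - 1) dg).
  exact: (@is_derive1_comp R expR _ _ _ _ (is_derive_expR _) dg').
have H := is_deriveM (is_deriveM de deta) dN.
apply: (is_derive_eq H); rewrite /GRing.scale/= !fctE; ring.
Qed.

Lemma powR_norm_mul (s r : R) : 0 <= s -> 0 < r -> s * `|s| `^ (r - 1) = s `^ r.
Proof.
move=> s0 r0; rewrite ger0_norm//; have [->|sn] := eqVneq s 0.
  by rewrite mul0r powR0// gt_eqF.
by rewrite -{1}(powRr1 s0) -gt0_powRD ?lt0r ?sn// addrC subrK.
Qed.

(** On [(t, d)] the weight is at most the exponential of slope [a] that agrees with it at [t]. For
    that exponential the Riccati inequality says that minus the derivative of the potential
    dominates [nu] times the integrand. *)
Lemma riccati_step (p nu q a t d : R) (eta eta' g f : R -> R) :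
  1 < p -> 0 <= nu -> q = p / (p - 1) ->
  (forall x : R, is_derive x 1 eta (eta' x)) ->
  (forall x : R, is_derive x 1 g (`|eta x| `^ (q - 1))) ->
  t < d -> 0 <= f t ->
  measurable_fun (`]t, d[ : set R) f -> (forall x, t < x < d -> 0 <= f x) ->
  (forall x, t < x < d -> f x <= f t * expR (a * (x - t))) ->
  (forall x, t < x < d -> 0 <= eta x) ->
  (forall x, t < x < d -> nu + a * eta x + (p - 1) * eta x `^ q <= - eta' x) ->
  (nu%:E * \int[mu]_(x in `]t, d[) (f x * expR (g x) `^ (p - 1))%:E <=
   (f t * expR (- (a * t)) *
    (riccati_potential p a eta g t - riccati_potential p a eta g d))%:E)%E.
Proof.
move=> p1 nu0 qE deta dg td ft0 mf f0 ft eta0 ric.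
have q0 : 0 < q by rewrite qE divr_gt0; lra.
have cg : continuous g by move=> x; exact: is_derive_continuous (dg x).
pose N x := expR ((p - 1) * g x).
have cN : continuous N.
  move=> x; apply: (@continuous_comp _ _ _ (fun x => (p - 1) * g x) expR); last exact: continuous_expR.
  by apply: cvgMr; exact: cg.
have NE x : expR (g x) `^ (p - 1) = N x.
  by rewrite -expRM mulrC.
pose w x := expR (a * x) * N x.
have cw : continuous w.
  move=> x; apply: cvgM; last exact: cN.
  apply: (@continuous_comp _ _ _ (fun x => a * x) expR); last exact: continuous_expR.
  by apply: cvgMr; exact: cvg_id.
have w0 x : 0 <= w x by rewrite mulr_ge0 ?expR_ge0.
have [W [dW WE]] := primitive_exists cw.
have c0 : 0 <= f t * expR (- (a * t)) by rewrite mulr_ge0 ?expR_ge0.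
have mN : measurable_fun (`]t, d[ : set R) (fun x => f x * expR (g x) `^ (p - 1)).
  apply: measurable_funM => //; apply: (eq_measurable_fun N); first by move=> x _; rewrite NE.
  exact: measurable_funS (continuous_measurable_fun cN).
have mw : measurable_fun (`]t, d[ : set R) w.
  exact: measurable_funS (continuous_measurable_fun cw).
apply: (@le_trans _ _ (nu%:E * ((f t * expR (- (a * t)))%:E * \int[mu]_(x in `]t, d[) (w x)%:E))%E).
  have mwE : measurable_fun (`]t, d[ : set R) (fun x => (w x)%:E) by exact/measurable_EFinP.
  have w0E (x : R) : `]t, d[%classic x -> (0 <= (w x)%:E)%E by rewrite lee_fin.
  have c0E : (0 <= (f t * expR (- (a * t)))%:E)%E by rewrite lee_fin.
  rewrite lee_wpmul2l ?lee_fin// -(@ge0_integralZl _ _ R mu _ (measurable_itv _) _ mwE _ w0E c0E).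
  apply: ge0_le_integral => //.
  - by move=> x /=; rewrite in_itv/= => /f0 fx; rewrite lee_fin mulr_ge0 ?powR_ge0.
  - exact/measurable_EFinP.
  - by apply/measurable_EFinP; apply: measurable_funM.
  move=> x /=; rewrite in_itv/= => xtd; rewrite -EFinM lee_fin NE /w mulrA ler_wpM2r ?expR_ge0//.
  by rewrite -mulrA -expRD addrC -mulrBr; exact: ft.
apply: (@le_trans _ _ (nu%:E * ((f t * expR (- (a * t)))%:E * (W d - W t)%:E))%E).
  rewrite lee_wpmul2l ?lee_fin// lee_wpmul2l ?lee_fin//.
  exact: integral_itvoo_le_derive (ltW td) cw dW w0.
rewrite -!EFinM lee_fin mulrCA ler_wpM2l//.
have dnW (x : R) : is_derive x 1 (fun y : R => nu * W y) (nu * w x).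
  exact: (is_deriveZ nu (dW x)).
have dnP (x : R) := is_deriveN (is_derive_riccati_potential p a (deta x) (dg x)).
have := @le_derive_increment _ _ _ (- riccati_potential p a eta g) _ t d (ltW td)
  (is_derive_within_continuous dnW) (is_derive_within_continuous dnP)
  (fun x _ => dnW x) (fun x _ => dnP x).
rewrite mulrBr !fctE opprK [- _ + _]addrC; apply => x xtd.
have ex : 0 <= eta x := eta0 x xtd.
rewrite (powR_norm_mul ex q0) -mulrN mulrC ler_wpM2l//.
by have := ric x xtd; lra.
Qed.

End riccati.

Section neumann_field_riccati.
Context {R : realType}.
Let mu := @lebesgue_measure R.

Lemma riccati_potentialE (p a x : R) (eta g : R -> R) (c : R) :
  c * expR (- (a * x)) * riccati_potential p a eta g x = c * (eta x * expR ((p - 1) * g x)).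
Proof.
have E : expR (- (a * x)) * expR (a * x) = 1 by rewrite -expRD addNr expR0.
by rewrite /riccati_potential -[RHS]mulr1 -E; ring.
Qed.

(** The field is [E = expR g] and [k = E']. The integral of [k] from [x0] is [E x - E x0 <= E x], so
    [E] need not vanish at [x0]; this is what allows a finite [eta] there. The two slopes [a] and
    [a'] give two applications of [riccati_step], glued at [th]. *)
Lemma neumann_field_riccati (p nu q x0 th a a' : R) (eta eta' g f : R -> R) :
  1 < p -> 0 <= nu -> q = p / (p - 1) ->
  (forall x : R, is_derive x 1 eta (eta' x)) ->
  (forall x : R, is_derive x 1 g (`|eta x| `^ (q - 1))) ->
  x0 < th -> th < 1 ->
  measurable_fun (`]x0, 1[ : set R) f -> (forall x, x0 < x < 1 -> 0 < f x) ->
  slope_le f a x0 1 ->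
  (forall x y, th <= x -> x < y -> y < 1 -> f y <= f x * expR (a' * (y - x))) ->
  (forall x, x0 < x < 1 -> 0 < eta x) -> 0 <= eta 1 ->
  (forall x, x0 < x < th -> nu + a * eta x + (p - 1) * eta x `^ q <= - eta' x) ->
  (forall x, th < x < 1 -> nu + a' * eta x + (p - 1) * eta x `^ q <= - eta' x) ->
  neumann_field p nu f x0.
Proof.
move=> p1 nu0 qE deta dg x0th th1 mf f0 fa fa' eta0 eta1 ric ric'.
have q1 : 0 < q - 1.
  by rewrite qE subr_gt0 ltr_pdivlMr ?mul1r; lra.
have qp : (q - 1) * (p - 1) = 1 by rewrite qE; field; lra.
have ceta : continuous eta by move=> x; exact: is_derive_continuous (deta x).
have cg : continuous g by move=> x; exact: is_derive_continuous (dg x).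
pose E x := expR (g x); pose k x := `|eta x| `^ (q - 1) * E x.
have dE (x : R) : is_derive x 1 E (k x).
  have := @is_derive1_comp R expR _ _ _ _ (is_derive_expR _) (dg x).
  by rewrite mulrC.
have cE : continuous E by move=> x; exact: is_derive_continuous (dE x).
have ck : continuous k.
  move=> x; apply: cvgM; last exact: cE.
  apply: (@continuous_comp _ _ _ eta (fun y => `|y| `^ (q - 1))); first exact: ceta.
  exact: continuous_norm_powR.
have E0 x : 0 < E x by exact: expR_gt0.
have k0 x : 0 <= k x by rewrite mulr_ge0 ?powR_ge0 ?expR_ge0.
have step' t : th <= t -> x0 < t -> t < 1 ->
    (nu%:E * \int[mu]_(x in `]t, 1%R[) (f x * E x `^ (p - 1))%:E <=
     (f t * (eta t * expR ((p - 1) * g t)))%:E)%E.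
  move=> tht x0t t1; have xt x : t < x < 1 -> x0 < x < 1 by lra.
  have ft : 0 <= f t by rewrite ltW// f0//; lra.
  apply: le_trans (@riccati_step _ p nu q a' t 1 eta eta' g f p1 nu0 qE deta dg t1 ft _ _ _ _ _) _.
  - by apply: measurable_funS mf => // x /=; rewrite !in_itv/=; exact: xt.
  - by move=> x /xt/f0/ltW.
  - by move=> x /andP[tx x1]; exact: fa'.
  - by move=> x /xt/eta0/ltW.
  - by move=> x xt1; apply: ric'; lra.
  rewrite lee_fin mulrBr riccati_potentialE gerBl mulr_ge0 ?mulr_ge0 ?expR_ge0//.
exists E, k; split => //.
- move=> x x01; split => //; rewrite mulr_gt0// powR_gt0// normr_gt0 gt_eqF//.
  exact: eta0.
- move=> x /andP[x0x _]; apply: le_trans (integral_itvoo_le_derive (ltW x0x) ck dE k0) _.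
  by rewrite lee_fin gerBl ltW.
move=> t /andP[x0t t1].
have e0 : 0 <= eta t by rewrite ltW// eta0// x0t.
have ft : 0 <= f t by rewrite ltW// f0// x0t.
have -> : f t * k t `^ (p - 1) = f t * (eta t * expR ((p - 1) * g t)).
  rewrite /k powRM ?powR_ge0 ?(ltW (E0 t))// -powRrM qp powRr1 ?normr_ge0// ger0_norm//.
  by rewrite -expRM [g t * _]mulrC.
have [tht|tth] := leP th t; first exact: step'.
have UE : `]t, 1%R[%classic = `]t, th[ `|` `[th, 1%R[ :> set R.
  by rewrite -itv_bndbnd_setU// bnd_simp; lra.
have mF : measurable_fun (`]t, 1[ : set R) (fun x => f x * E x `^ (p - 1)).
  apply: measurable_funM.
    by apply: measurable_funS mf => // x /=; rewrite !in_itv/=; lra.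
  apply: (measurableT_comp (measurable_powR _)).
  exact: measurable_funS (continuous_measurable_fun cE).
have F0 x : t < x < 1 -> 0 <= f x * E x `^ (p - 1).
  by move=> xt; rewrite mulr_ge0 ?powR_ge0 ?(ltW (f0 _ _))//; lra.
rewrite UE ge0_integral_setU //; last 3 first.
- by rewrite -UE; exact/measurable_EFinP.
- by rewrite -UE => x /=; rewrite in_itv/= lee_fin; exact: F0.
- by apply/disj_setPS => x /= []; rewrite !in_itv/=; lra.
have mF' : measurable_fun (`]th, 1[ : set R) (fun x => f x * E x `^ (p - 1)).
  by apply: measurable_funS mF => // x /=; rewrite !in_itv/=; lra.
rewrite -(@integral_itv_obnd_cbnd R th (BLeft 1)); last exact/measurable_EFinP.
rewrite ge0_muleDr; last 2 first.
- by apply: integral_ge0 => x /=; rewrite in_itv/= lee_fin => xt; apply: F0; lra.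
- by apply: integral_ge0 => x /=; rewrite in_itv/= lee_fin => xt; apply: F0; lra.
(* The term subtracted at [th] by the first stage pays for the second, because [f th] is at most
   [f t] times the exponential of slope [a]. *)
apply: (@le_trans _ _ ((f t * (eta t * expR ((p - 1) * g t)) - f th * (eta th * expR ((p - 1) * g th)))%:E
   + (f th * (eta th * expR ((p - 1) * g th)))%:E)%E); last by rewrite -EFinD lee_fin subrK.
apply: leeD; last by apply: step' => //; lra.
apply: le_trans (@riccati_step _ p nu q a t th eta eta' g f p1 nu0 qE deta dg tth ft _ _ _ _ _) _.
- by apply: measurable_funS mf => // x /=; rewrite !in_itv/=; lra.
- by move=> x xt; rewrite ltW// f0//; lra.
- by move=> x xt; apply: fa; lra.
- by move=> x xt; rewrite ltW// eta0//; lra.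
- by move=> x xt; apply: ric; lra.
rewrite lee_fin mulrBr riccati_potentialE lerB// -(@riccati_potentialE p a th).
rewrite ler_wpM2r//.
  by rewrite !mulr_ge0 ?expR_ge0// ltW// eta0//; lra.
rewrite -ler_pdivlMr ?expR_gt0// -expRN opprK -mulrA -expRD.
rewrite [X in expR X](_ : _ = a * (th - t)); last by ring.
by apply: fa; lra.
Qed.
End neumann_field_riccati.

(* The speed [nu + (p-1) s^q + a s] of the Riccati variable, lowered by the
   cutoff of [kap s] to [0, 1/(16 p)] that exploits the steeper part of [f]. *)
Definition riccati_speed (R : realType) (p nu q a kap s : R) : R :=
  nu + (p - 1) * `|s| `^ q + a * s - kap * Num.max 0 (s - 16 * p * s ^+ 2).

(* For [a = kap = 0] the limit as [S] grows is [pi_p p / nu `^ p^-1 / 2]. *)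
Definition riccati_time (R : realType) (p nu q a kap S : R) : R :=
  \int[@lebesgue_measure R]_(s in `[0, S]) (riccati_speed p nu q a kap s)^-1.

Section riccati_speed.
Context {R : realType}.
Implicit Types p nu q a kap s S : R.

(** Young's inequality for [s^(1/(p-1))] and [nu^(1/p)]. It makes [- p nu^(1/p)] the slope above
    which the speed stays positive. *)
Lemma riccati_speed_young p nu q s : 1 < p -> 0 <= nu -> q = p / (p - 1) -> 0 <= s ->
  p * nu `^ p^-1 * s <= nu + (p - 1) * `|s| `^ q.
Proof.
move=> p1 nu0 qE s0.
have := @young_tangent R p (s `^ (p - 1)^-1) (nu `^ p^-1) p1 (powR_ge0 _ _) (powR_ge0 _ _).
rewrite -!powRrM mulVf ?mulVf ?powRr1//; try lra.
by rewrite [(p - 1)^-1 * p]mulrC -qE ger0_norm//; lra.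
Qed.

(** In this range [a s] costs at most [nu / 16] and the cutoff at most [1 / 16], and [nu >= 1]. *)
Lemma riccati_speed_small p nu q a kap s : 1 < p -> 1 <= nu ->
  - (p * nu `^ p^-1) <= a -> 0 <= kap <= 1 -> 0 <= s <= (16 * p)^-1 ->
  7 / 8 <= riccati_speed p nu q a kap s.
Proof.
move=> p1 nu1 aY kap01 /andP[s0 ss]; rewrite /riccati_speed.
have p0 : 0 < p by lra.
have h1 : 0 <= (p - 1) * `|s| `^ q by rewrite mulr_ge0 ?powR_ge0//; lra.
have h2 : nu `^ p^-1 <= nu.
  rewrite -[leRHS]powRr1; last by lra.
  by rewrite ler_powR// invf_le1 ?ltW.
have ps : p * s <= 16^-1.
  by move: ss; rewrite -(ler_pM2l p0) invfM mulrCA divff ?mulr1// gt_eqF.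
have h3 : Num.max 0 (s - 16 * p * s ^+ 2) <= s.
  rewrite ge_max s0/=; have := mulr_ge0 (ltW p0) (sqr_ge0 s); lra.
have h3' : 0 <= Num.max 0 (s - 16 * p * s ^+ 2) by rewrite le_max lexx.
have s16 : s <= 16^-1 by apply: le_trans ps; rewrite ler_peMl// ltW.
have h4 : - (p * nu `^ p^-1) * s <= a * s by rewrite ler_wpM2r.
have h5 : p * nu `^ p^-1 * s <= nu * 16^-1.
  rewrite [leLHS](_ : _ = nu `^ p^-1 * (p * s)); last by ring.
  by apply: ler_pM => //; rewrite ?powR_ge0 ?mulr_ge0// ltW.
have h6 : kap * Num.max 0 (s - 16 * p * s ^+ 2) <= 1 * 16^-1.
  by apply: ler_pM => //; [lra|lra|exact: le_trans s16].
by lra.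
Qed.

Lemma riccati_speed_large p nu q a kap s : 1 < p -> 0 <= nu -> q = p / (p - 1) ->
  (16 * p)^-1 <= s ->
  riccati_speed p nu q a kap s = nu + (p - 1) * `|s| `^ q + a * s /\
  (p * nu `^ p^-1 + a) * s <= riccati_speed p nu q a kap s.
Proof.
move=> p1 nu0 qE ss; have p0 : 0 < p by lra.
have s0 : 0 < s by apply: lt_le_trans ss; rewrite invr_gt0; lra.
have E : riccati_speed p nu q a kap s = nu + (p - 1) * `|s| `^ q + a * s.
  rewrite /riccati_speed max_l ?mulr0 ?subr0//.
  rewrite expr2 mulrA subr_le0 ler_peMl ?(ltW s0)//.
  by rewrite mulrC -ler_pdivrMr ?mul1r ?mulr_gt0.
split => //; rewrite E mulrDl lerD2r.
exact: riccati_speed_young (ltW s0).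
Qed.

Lemma riccati_speed_ge p nu q a kap s : 1 < p -> 1 <= nu -> q = p / (p - 1) ->
  - (p * nu `^ p^-1) < a -> 0 <= kap <= 1 -> 0 <= s ->
  Num.min (7 / 8) ((p * nu `^ p^-1 + a) / (16 * p)) <= riccati_speed p nu q a kap s.
Proof.
move=> p1 nu1 qE aY kap01 s0; rewrite ge_min.
have [ss|ss] := leP s (16 * p)^-1.
  by rewrite riccati_speed_small// ?s0// ltW.
have [|_ h] := @riccati_speed_large p nu q a kap s p1 _ qE (ltW ss); first by lra.
apply/orP; right; apply: le_trans h; rewrite ler_wpM2l ?(ltW ss)//.
by rewrite -lerBlDl sub0r ltW.
Qed.

Lemma riccati_speed_min_gt0 p nu a : 1 < p -> - (p * nu `^ p^-1) < a ->
  0 < Num.min (7 / 8) ((p * nu `^ p^-1 + a) / (16 * p)).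
Proof.
move=> p1 aY; rewrite lt_min; apply/andP; split; first by lra.
by rewrite divr_gt0//; lra.
Qed.

Lemma continuous_riccati_speed p nu q a kap : 0 < q -> continuous (riccati_speed p nu q a kap).
Proof.
move=> q0 s; apply: cvgB; last first.
  apply: cvgMr; apply: (@continuous_comp _ _ _ (fun s : R => s - 16 * p * s ^+ 2) (fun y => Num.max 0 y)).
    apply: cvgB; first exact: cvg_id.
    by apply: cvgMr; exact: exprn_continuous.
  exact: (continuous_max (@cst_continuous _ _ 0 _) (@cvg_id _ _)).
apply: cvgD; last by apply: cvgMr; exact: cvg_id.
apply: cvgD; first exact: cvg_cst.
by apply: cvgMr; exact: continuous_norm_powR.
Qed.
End riccati_speed.

Section neumann_field_ode.
Context {R : realType}.
Let mu := @lebesgue_measure R.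

(** The solution of [eta' = - speed eta] with [eta 1 = 0] is used. The hypothesis on the time says
    that [eta] does not exceed [S] on [(x0, 1)]. The reduction of the speed acts only once [eta] is
    below [1/(16 p)], which happens after [7/8], where the slope [a - kap] is available. *)
Lemma neumann_field_ode (p nu q a kap S x0 th : R) (f : R -> R) :
  1 < p -> 1 <= nu -> q = p / (p - 1) ->
  - (p * nu `^ p^-1) < a -> 0 <= kap <= 1 -> 0 < S ->
  x0 < th -> th < 1 -> (kap = 0 \/ th <= 7 / 8) ->
  measurable_fun (`]x0, 1[ : set R) f -> (forall x, x0 < x < 1 -> 0 < f x) ->
  slope_le f a x0 1 ->
  (forall x y, th <= x -> x < y -> y < 1 -> f y <= f x * expR ((a - kap) * (y - x))) ->
  1 - x0 <= riccati_time p nu q a kap S ->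
  neumann_field p nu f x0.
Proof.
move=> p1 nu1 qE aY kap01 S0 x0th th1 kth mf f0 fa fa' timeS.
have p0 : 0 < p by lra.
have nu0 : 0 <= nu by lra.
have q1 : 0 < q - 1 by rewrite qE subr_gt0 ltr_pdivlMr ?mul1r; lra.
have q0 : 0 < q by lra.
set m := Num.min (7 / 8) ((p * nu `^ p^-1 + a) / (16 * p)).
have m0 : 0 < m by exact: riccati_speed_min_gt0.
pose speed := riccati_speed p nu q a kap.
have speed_ge s : 0 <= s -> m <= speed s by exact: riccati_speed_ge.
(* The speed is extended from [[0, S]] to the whole line with positive lower and finite upper
   bounds, as [autonomous_ode] requires; the solution takes values in [[0, S]] on the interval of
   interest. *)
pose D (s : R) := speed (Num.min `|s| S).
have ts (s : R) : 0 <= Num.min `|s| S by rewrite le_min normr_ge0 ltW.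
have DE (s : R) : 0 <= s <= S -> D s = speed s.
  by move=> /andP[s0 sS]; rewrite /D ger0_norm// min_l.
have cD : continuous D.
  move=> s; apply: (@continuous_comp _ _ _ (fun s : R => Num.min `|s| S) speed); last exact: continuous_riccati_speed.
  exact: (continuous_min (@norm_continuous _ _ _) (@cst_continuous _ _ S _)).
pose c := nu + (p - 1) * S `^ q + `|a| * S.
have Dmc s : m <= D s <= c.
  rewrite /D speed_ge //= /speed /riccati_speed /c.
  set t := Num.min _ _; have t0 : 0 <= t by exact: ts.
  have tS : t <= S by rewrite /t ge_min lexx orbT.
  have h1 : (p - 1) * `|t| `^ q <= (p - 1) * S `^ q.
    rewrite ler_wpM2l//; first by lra.
    by rewrite ger0_norm// ge0_ler_powR ?nnegrE ?(ltW q0) ?(ltW S0).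
  have h2 : a * t <= `|a| * S.
    apply: le_trans (ler_norm _) _; rewrite normrM (ger0_norm t0) ler_wpM2l//.
  have h3 : 0 <= kap * Num.max 0 (t - 16 * p * t ^+ 2).
    by rewrite mulr_ge0 ?le_max ?lexx//; lra.
  by lra.
have [T [eta [dT T0 Teta deta]]] := autonomous_ode cD m0 Dmc.
have D0 s : 0 < D s by apply: lt_le_trans m0 _; case/andP: (Dmc s).
have Tmono := is_derive_increasing dT (fun s => ltac:(by rewrite invr_gt0)).
have cDV : continuous (fun s => (D s)^-1).
  by move=> s; apply: continuousV; [rewrite gt_eqF|exact: cD].
have TS : T S = riccati_time p nu q a kap S.
  have E := integral_is_derive (ltW S0) cDV dT; rewrite T0 subr0 in E.
  rewrite /riccati_time /Rintegral -[LHS]/(fine (T S)%:E) -E; congr fine.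
  by apply: eq_integral => s; rewrite inE/= in_itv/= => /DE ->.
have eta0 x : x < 1 -> 0 < eta x by move=> x1; rewrite -Tmono T0 Teta; lra.
have eta1 : eta 1 = 0.
  by apply/eqP; rewrite eq_le !leNgt -(Tmono 0) -(Tmono _ 0) !Teta T0 subrr ltxx.
have etaS x : x0 < x -> eta x < S by move=> x0x; rewrite -Tmono Teta TS; lra.
(* A distance of at most [1/16] at speed at least [7/8] takes time at most [1/14]. *)
have T_small : T (16 * p)^-1 <= 1 / 8.
  have s20 : 0 < (16 * p)^-1 by rewrite invr_gt0; lra.
  have dl (x : R) : is_derive x 1 (fun y : R => (y - 0) * (8 / 7)) (8 / 7) by exact: is_derive_affine.
  have := @le_derive_increment _ T (fun s => (D s)^-1) _ (fun=> 8 / 7) 0 (16 * p)^-1 (ltW s20)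
    (is_derive_within_continuous dT) (is_derive_within_continuous dl) (fun x _ => dT x) (fun x _ => dl x).
  have s2p : (16 * p)^-1 <= 16^-1.
    by rewrite lef_pV2 ?posrE; lra.
  have H x : 0 < x < (16 * p)^-1 -> (D x)^-1 <= 8 / 7.
    move=> /andP[xp xs]; have e78 : 0 < 7 / 8 :> R by lra.
    rewrite (_ : 8 / 7 = (7 / 8)^-1); last by field.
    rewrite lef_pV2 ?posrE//.
    apply: riccati_speed_small => //; first exact: ltW.
    by rewrite ts/= ge_min ger0_norm ?(ltW xp)// (ltW xs).
  move=> /(_ H); rewrite T0 !subr0 mul0r subr0; lra.
have cG : continuous (fun s => `|s| `^ (q - 1) * (D s)^-1).
  by move=> s; apply: cvgM; [exact: continuous_norm_powR|exact: cDV].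
have [G [dG _]] := primitive_exists cG.
(* The exponent of [E] is a function of [eta]: along the solution, dividing [|s|^(q-1)] by the speed
   changes the variable from [x] to [s]. *)
have dg (x : R) : is_derive x 1 (fun y : R => - G (eta y)) (`|eta x| `^ (q - 1)).
  have := is_deriveN (@is_derive1_comp R G eta x _ _ (dG (eta x)) (deta x)).
  by rewrite mulrN opprK mulfVK ?gt_eqF.
apply: (@neumann_field_riccati R p nu q x0 th a (a - kap) eta _ _ f p1 nu0 qE deta dg x0th th1 mf f0 fa fa').
- by move=> x xx; apply: eta0; lra.
- by rewrite eta1.
- move=> x /andP[xx0 xxt]; have e0 : 0 < eta x by apply: eta0; exact: lt_trans th1.
  rewrite opprK DE; last by rewrite (ltW e0) (ltW (etaS _ xx0)).
  have -> : speed (eta x) = nu + (p - 1) * `|eta x| `^ q + a * eta x.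
    case: kth => [k0|th78]; first by rewrite /speed /riccati_speed k0 mul0r subr0.
    have ss : (16 * p)^-1 <= eta x by rewrite leNgt -Tmono Teta; lra.
    exact: (riccati_speed_large a kap p1 nu0 qE ss).1.
  rewrite ger0_norm ?(ltW e0)//.
  by lra.
- move=> x /andP[xxt x1]; have e0 : 0 < eta x by exact: eta0.
  rewrite opprK DE; last by rewrite (ltW e0) (ltW (etaS _ (lt_trans x0th xxt))).
  rewrite /speed /riccati_speed ger0_norm ?(ltW e0)//.
  have h : kap * Num.max 0 (eta x - 16 * p * eta x ^+ 2) <= kap * eta x.
    rewrite ler_wpM2l//; first by lra.
    rewrite ge_max (ltW e0)/= gerBl mulr_ge0 ?sqr_ge0//; lra.
  by lra.
Qed.

(** For such steep descent a constant [eta] suffices on any length: [e = nu^(1/q)] is the equality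
    case of [riccati_speed_young], where both sides are [p nu]. *)
Lemma neumann_field_const (p nu q a x0 : R) (f : R -> R) :
  1 < p -> 0 < nu -> q = p / (p - 1) ->
  a <= - (p * nu `^ p^-1) -> x0 < 1 ->
  measurable_fun (`]x0, 1[ : set R) f -> (forall x, x0 < x < 1 -> 0 < f x) ->
  slope_le f a x0 1 ->
  neumann_field p nu f x0.
Proof.
move=> p1 nu0 qE aY x01 mf f0 fa.
have p0 : 0 < p by lra.
pose e := nu `^ q^-1.
have e0 : 0 < e by rewrite powR_gt0.
have deta (x : R) : is_derive x 1 (fun=> e) 0 by exact: is_derive_cst.
have dg (x : R) : is_derive x 1 (fun y : R => (y - 0) * (`|e| `^ (q - 1))) (`|e| `^ (q - 1)).
  exact: is_derive_affine.
have x0m : x0 < (x0 + 1) / 2 by lra.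
have q0 : 0 < q by rewrite qE divr_gt0; lra.
have eq : e `^ q = nu by rewrite /e -powRrM mulVf ?gt_eqF// powRr1// ltW.
have ric : nu + a * e + (p - 1) * e `^ q <= - 0.
  have E : nu `^ p^-1 * e = nu.
    rewrite /e -gt0_powRD// (_ : p^-1 + q^-1 = 1) ?powRr1 ?ltW//.
    by rewrite qE invf_div; field; rewrite gt_eqF.
  have h : a * e <= - (p * nu `^ p^-1) * e by rewrite ler_wpM2r// ltW.
  by rewrite eq; nra.
apply: (@neumann_field_riccati R p nu q x0 ((x0 + 1) / 2) a a _ _ _ f p1 (ltW nu0) qE deta dg x0m _ mf f0 fa) => //.
- by lra.
- by move=> x y xx xy y1; apply: fa => //; lra.
- by rewrite ltW.
Qed.
End neumann_field_ode.

Section riccati_time.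
Context {R : realType}.
Let mu := @lebesgue_measure R.
Variables (p nu q S : R).
Hypothesis p1 : 1 < p.
Hypothesis nu1 : 1 <= nu.
Hypothesis qE : q = p / (p - 1).
Hypothesis S0 : (16 * p)^-1 < S.
Let Y := p * nu `^ p^-1.
Let speed := riccati_speed p nu q.

(** The convex function [X^-1] lies above its tangent at [A]. All comparisons of Riccati times with
    the one of slope 0 rest on this. *)
Lemma inv_tangent (X A : R) : 0 < X -> 0 < A -> (2 * A - X) / A ^+ 2 <= X^-1.
Proof.
move=> X0 A0; rewrite -[leRHS]div1r ler_pdivlMr// mulrAC ler_pdivrMr ?exprn_gt0// mul1r -subr_ge0.
by rewrite (_ : _ - _ = (A - X) ^+ 2) ?sqr_ge0//; ring.
Qed.

Lemma riccati_speed_gt0 a kap s : - Y < a -> 0 <= kap <= 1 -> 0 <= s -> 0 < speed a kap s.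
Proof.
move=> aY kap01 s0; apply: lt_le_trans (riccati_speed_ge p1 nu1 qE aY kap01 s0).
exact: riccati_speed_min_gt0.
Qed.

Lemma S_gt0 : 0 < S.
Proof. by apply: lt_trans S0; rewrite invr_gt0 mulr_gt0// (lt_trans ltr01). Qed.

Lemma q_gt1 : 1 < q.
Proof. by rewrite qE ltr_pdivlMr ?mul1r ?subr_gt0// gtrBl. Qed.

Lemma integrable_within_continuous (D : R -> R) :
  {in `[0, S]%classic, continuous D} -> mu.-integrable `[0, S] (EFin \o D).
Proof.
move=> cD; apply: continuous_compact_integrable; first exact: segment_compact.
exact: continuous_in_subspaceT.
Qed.

Lemma integrable_inv_speed a kap : - Y < a -> 0 <= kap <= 1 ->
  mu.-integrable `[0, S] (EFin \o (fun s => (speed a kap s)^-1)).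
Proof.
move=> aY kap01; apply: integrable_within_continuous => s; rewrite inE/= in_itv/= => /andP[s0 _].
apply: continuousV; first by rewrite gt_eqF// riccati_speed_gt0.
by apply: continuous_riccati_speed; exact: lt_trans q_gt1.
Qed.

Lemma le_Rintegral_itv (D E : R -> R) :
  mu.-integrable `[0, S] (EFin \o D) -> mu.-integrable `[0, S] (EFin \o E) ->
  (forall s, 0 <= s <= S -> D s <= E s) ->
  \int[mu]_(s in `[0, S]) D s <= \int[mu]_(s in `[0, S]) E s.
Proof.
move=> iD iE DE; exact: le_Rintegral.
Qed.

Lemma Rintegral_cst_itv (c : R) : \int[mu]_(s in `[0, S]) c = c * S.
Proof.
have E : lebesgue_measure (`[0, S]%classic : set R) = S%:E.
  by rewrite lebesgue_measure_itv/= lte_fin S_gt0 -EFinB subr0.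
by rewrite Rintegral_cst//; congr (_ * _); rewrite [X in fine X]E.
Qed.

(** Two inverse speeds differ by [(a' - a) s] over the product of the speeds, with [s <= S] and
    speeds at least [m]. This is the Lipschitz bound that [slope_crossing] needs. *)
Lemma riccati_time_lip (a a' m : R) : - Y < a -> - Y < a' ->
  m = Num.min (7 / 8) ((Y + Num.min a a') / (16 * p)) ->
  riccati_time p nu q a 0 S <= riccati_time p nu q a' 0 S + `|a - a'| * (S * S / m ^+ 2).
Proof.
move=> aY aY' mE.
have m0 : 0 < m by rewrite mE; apply: riccati_speed_min_gt0; rewrite ?lt_min ?aY.
have k01 : 0 <= (0 : R) <= 1 by rewrite lexx ler01.
have ge a'' s : Num.min a a' <= a'' -> 0 <= s -> m <= speed a'' 0 s.
  move=> ha s0; have aY'' : - Y < a'' by apply: lt_le_trans ha; rewrite lt_min aY.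
  apply: le_trans (riccati_speed_ge p1 nu1 qE aY'' k01 s0).
  rewrite mE le_min ge_min lexx/= ge_min; apply/orP; right.
  by rewrite ler_pM2r ?lerD2l// invr_gt0 mulr_gt0// (lt_trans ltr01).
pose c := `|a - a'| * (S / m ^+ 2).
have icst : mu.-integrable `[0, S] (EFin \o (fun=> c)) by exact: integrable_cst_itv.
have -> : `|a - a'| * (S * S / m ^+ 2) = \int[mu]_(s in `[0, S]) c.
  by rewrite Rintegral_cst_itv /c; ring.
rewrite /riccati_time -RintegralD//; last exact: integrable_inv_speed.
apply: le_Rintegral_itv; first exact: integrable_inv_speed.
  have := @integrableD _ _ R mu _ (measurable_itv _) _ _ (integrable_inv_speed aY' k01) icst.
  by apply.
move=> s /andP[s0 sS].
set X := riccati_speed p nu q a 0 s; set Z := riccati_speed p nu q a' 0 s.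
have mX : m <= X by apply: ge; rewrite // ge_min lexx.
have mZ : m <= Z by apply: ge; rewrite // ge_min lexx orbT.
have XZ : Z - X = (a' - a) * s by rewrite /X /Z /riccati_speed; ring.
have X0 := lt_le_trans m0 mX; have Z0 := lt_le_trans m0 mZ.
rewrite -lerBlDl (_ : X^-1 - Z^-1 = (Z - X) / (X * Z)); last by field; rewrite !gt_eqF.
rewrite XZ /c; apply: le_trans (ler_norm _) _.
rewrite normrM normrM distrC -mulrA ler_wpM2l// (ger0_norm s0).
rewrite gtr0_norm ?invr_gt0 ?mulr_gt0//; apply: ler_pM => //.
  by rewrite invr_ge0 mulr_ge0 ?ltW.
rewrite lef_pV2 ?posrE ?mulr_gt0 ?exprn_gt0// expr2.
by apply: ler_pM => //; exact: ltW.
Qed.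

Lemma riccati_time_anti a a' : - Y < a -> a <= a' ->
  riccati_time p nu q a' 0 S <= riccati_time p nu q a 0 S.
Proof.
move=> aY aa'; have aY' := lt_le_trans aY aa'.
have k01 : 0 <= (0 : R) <= 1 by rewrite lexx ler01.
apply: le_Rintegral_itv; [exact: integrable_inv_speed|exact: integrable_inv_speed|].
move=> s /andP[s0 _]; rewrite lef_pV2 ?posrE ?riccati_speed_gt0//.
by rewrite /riccati_speed lerD2r lerD2l ler_wpM2r.
Qed.

Lemma riccati_time_gt0 a : - Y < a -> 0 < riccati_time p nu q a 0 S.
Proof.
move=> aY.
have k01 : 0 <= (0 : R) <= 1 by rewrite lexx ler01.
have S0' := S_gt0; have q1 := q_gt1.
pose d := nu + (p - 1) * S `^ q + `|a| * S; pose c := d^-1.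
have Sq : 0 <= (p - 1) * S `^ q by rewrite mulr_ge0 ?powR_ge0// subr_ge0 ltW.
have aS : 0 <= `|a| * S by rewrite mulr_ge0// ltW.
have nu0 : 0 < nu by apply: lt_le_trans nu1.
have d0 : 0 < d by rewrite /d -addrA ltr_pwDl ?addr_ge0.
have c0 : 0 < c by rewrite invr_gt0.
apply: (@lt_le_trans _ _ (\int[mu]_(s in `[0, S]) c)).
  by rewrite Rintegral_cst_itv mulr_gt0.
apply: le_Rintegral_itv; [exact: integrable_cst_itv|exact: integrable_inv_speed|].
move=> s /andP[s0 sS]; rewrite /c lef_pV2 ?posrE ?riccati_speed_gt0// /d.
rewrite /riccati_speed mul0r subr0 lerD//.
  rewrite lerD2l ler_wpM2l ?subr_ge0 ?(ltW p1)//.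
  rewrite ger0_norm// ge0_ler_powR ?nnegrE ?(ltW S0')// (le_trans ler01)// ltW//.
by apply: le_trans (ler_norm _) _; rewrite normrM (ger0_norm s0) ler_wpM2l.
Qed.

(** The cutoff [s - 16 p s^2] has integral [(16 p)^-2 / 6] over its positive range, and
    [4 * 6 * 16^2 = 6144]. *)
Lemma riccati_gain kap (F : R -> R) : 0 <= kap ->
  mu.-integrable `[0, S] (EFin \o F) ->
  (forall s, 0 <= s <= S -> 2 * (speed 0 0 s)^-1 +
     kap / (4 * nu ^+ 2) * Num.max 0 (s - 16 * p * s ^+ 2) <= F s) ->
  2 * riccati_time p nu q 0 0 S + kap / (6144 * p ^+ 2 * nu ^+ 2) <=
  \int[mu]_(s in `[0, S]) F s.
Proof.
move=> kap0 iF HF.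
have k01 : 0 <= (0 : R) <= 1 by rewrite lexx ler01.
have Y0 : - Y < 0.
  by rewrite oppr_lt0 mulr_gt0 ?powR_gt0// ?(lt_trans ltr01 p1)// (lt_le_trans ltr01 nu1).
pose w s := Num.max 0 (s - 16 * p * s ^+ 2).
have cw0 : continuous (fun s : R => s - 16 * p * s ^+ 2).
  move=> s; apply: cvgB; first exact: cvg_id.
  by apply: cvgMr; exact: exprn_continuous.
have cw : continuous w.
  move=> s; apply: (@continuous_comp _ _ _ (fun s : R => s - 16 * p * s ^+ 2) (fun y => Num.max 0 y)); first exact: cw0.
  exact: (continuous_max (@cst_continuous _ _ 0 _) (@cvg_id _ _)).
have iw : mu.-integrable `[0, S] (EFin \o w) by apply: integrable_within_continuous => s _; exact: cw.
have i2 : mu.-integrable `[0, S] (EFin \o (fun s => 2 * (speed 0 0 s)^-1)).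
  have := @integrableZl _ _ R mu _ (measurable_itv _) 2 _ (integrable_inv_speed Y0 k01).
  by apply.
pose k := kap / (4 * nu ^+ 2).
have k0 : 0 <= k by rewrite /k divr_ge0// mulr_ge0// sqr_ge0.
have ik : mu.-integrable `[0, S] (EFin \o (fun s => k * w s)).
  by have := @integrableZl _ _ R mu _ (measurable_itv _) k _ iw; apply.
apply: (@le_trans _ _ (\int[mu]_(s in `[0, S]) (2 * (speed 0 0 s)^-1 + k * w s))); last first.
  apply: le_Rintegral_itv => //.
  by have := @integrableD _ _ R mu _ (measurable_itv _) _ _ i2 ik; apply.
rewrite RintegralD// !RintegralZl//; last exact: integrable_inv_speed.
rewrite lerD2l.
pose s2 := (16 * p)^-1.
have s20 : 0 < s2 by rewrite invr_gt0 mulr_gt0// (lt_trans ltr01).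
have p0 : p != 0 by rewrite gt_eqF// (lt_trans ltr01).
have n0 : nu != 0 by rewrite gt_eqF// (lt_le_trans ltr01).
suff H : s2 ^+ 2 / 6 <= \int[mu]_(s in `[0, S]) w s.
  apply: le_trans (ler_wpM2l k0 H); rewrite /k /s2 le_eqVlt; apply/orP; left; apply/eqP.
  by field; rewrite p0 n0.
pose W (s : R) := s ^+ 2 / 2 - 16 * p * s ^+ 3 / 3.
have dW (s : R) : is_derive s 1 W (s - 16 * p * s ^+ 2).
  have d2 := is_deriveX 2 (is_derive_id s (1:R)).
  have d3 := is_deriveX 3 (is_derive_id s (1:R)).
  have := is_deriveB (is_deriveZ 2^-1 d2) (is_deriveZ (16 * p / 3) d3).
  rewrite (_ : _ - _ = W); last first.
    by apply/funext => y; rewrite /W -[LHS]/(2^-1 * y ^+ 2 - (16 * p / 3) * y ^+ 3); field.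
  by move=> H; apply: (is_derive_eq H); rewrite /GRing.scale/= !mulr_natl; field.
have [G [dG GE]] := primitive_exists cw.
have -> : \int[mu]_(s in `[0, S]) w s = G S - G 0 by rewrite /Rintegral GE ?ltW ?S_gt0.
have GW (a b : R) : a <= b -> W b - W a <= G b - G a.
  move=> ab; apply: (le_derive_increment ab (is_derive_within_continuous dW) (is_derive_within_continuous dG)
    (fun x _ => dW x) (fun x _ => dG x)).
  by move=> x _; rewrite /w le_max lexx orbT.
have dc (x : R) : is_derive x 1 (fun=> 0 : R) 0 by exact: is_derive_cst.
have Gmono : G s2 <= G S.
  have := @le_derive_increment _ _ _ _ _ s2 S (ltW S0) (is_derive_within_continuous dc) (is_derive_within_continuous dG)
    (fun x _ => dc x) (fun x _ => dG x).
  rewrite subrr subr_ge0; apply => x _.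
  by rewrite /w le_max lexx.
have := GW 0 s2 (ltW s20).
have -> : W s2 - W 0 = s2 ^+ 2 / 6 by rewrite /W /s2; field.
by move=> h; apply: le_trans h _; rewrite lerD2r.
Qed.
End riccati_time.

Section riccati_time_gain.
Context {R : realType}.
Let mu := @lebesgue_measure R.
Variables (p nu q S : R).
Hypothesis p1 : 1 < p.
Hypothesis nu1 : 1 <= nu.
Hypothesis qE : q = p / (p - 1).
Hypothesis S0 : (16 * p)^-1 < S.
Let Y := p * nu `^ p^-1.
Let w (s : R) : R := Num.max 0 (s - 16 * p * s ^+ 2).
Let A s := riccati_speed p nu q 0 0 s.

Lemma cutoff_le (s : R) : 0 <= s -> 0 <= w s <= s.
Proof.
move=> s0; rewrite /w le_max lexx/= ge_max s0/= gerBl.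
by rewrite !mulr_ge0 ?sqr_ge0// (le_trans ler01)// ltW.
Qed.

Lemma riccati_speed0_gt0 (s : R) : 0 < A s.
Proof.
rewrite /A /riccati_speed !mul0r addr0 subr0 ltr_pwDl ?(lt_le_trans ltr01)//.
by rewrite mulr_ge0 ?powR_ge0// subr_ge0 ltW.
Qed.

(** Where the cutoff is nonzero, [16 p s <= 1], so that [A s <= nu + p s <= 2 nu]. *)
Lemma cutoff_gain (kap s : R) : 0 <= kap -> 0 <= s ->
  kap / (4 * nu ^+ 2) * w s <= kap * w s / A s ^+ 2.
Proof.
move=> kap0 s0; have nu0 : 0 < nu by apply: lt_le_trans nu1.
have [->|wn] := eqVneq (w s) 0; first by rewrite !mulr0 mul0r.
have p0 : 0 < p by apply: lt_trans p1.
have ps : 16 * p * s <= 1.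
  rewrite leNgt; apply/negP => h; move/eqP: wn; apply; rewrite /w max_l// expr2 mulrA.
  by rewrite subr_le0 ler_peMl// ltW.
have s1 : s <= 1.
  by apply: le_trans ps; rewrite ler_peMl// mulr_ege1//; [rewrite ler1n|exact: ltW].
have q1 := q_gt1 p1 qE.
have sq : s `^ q <= s.
  rewrite -(powR_norm_mul s0) ?(lt_trans ltr01)// ler_piMr// ger0_norm//.
  have q10 : 0 <= q - 1 by rewrite subr_ge0 ltW.
  by have := @ge0_ler_powR R (q - 1) q10 s 1; rewrite powR1 !nnegrE; apply.
have A2 : A s <= 2 * nu.
  rewrite /A /riccati_speed !mul0r addr0 subr0 ger0_norm//.
  have : (p - 1) * s `^ q <= p * s.
    apply: ler_pM; rewrite ?subr_ge0 ?powR_ge0// ?(ltW p1)//.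
    by rewrite gerBl.
  move=> h; rewrite mulr_natl mulr2n lerD2l (le_trans h)// (le_trans _ (le_trans ps nu1))//.
  by rewrite -mulrA ler_peMl ?ler1n// mulr_ge0// ltW.
have A0 := riccati_speed0_gt0 s.
rewrite mulrAC; apply: ler_wpM2l.
  by rewrite mulr_ge0//; case/andP: (cutoff_le s0).
rewrite lef_pV2 ?posrE ?exprn_gt0 ?mulr_gt0 ?exprn_gt0//.
rewrite (_ : 4 * nu ^+ 2 = (2 * nu) ^+ 2); last by ring.
by rewrite ler_sqr ?nnegrE ?(ltW A0)// (le_trans (ltW A0)).
Qed.

(** In the sum of the two tangent inequalities at [A s] the terms in [a] cancel; what remains is
    [2 / A] plus the contribution of the cutoff. *)
Lemma riccati_time_pair (a kap : R) : - Y < a -> a < Y -> 0 <= kap <= 1 ->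
  2 * riccati_time p nu q 0 0 S + kap / (6144 * p ^+ 2 * nu ^+ 2) <=
  riccati_time p nu q a kap S + riccati_time p nu q (- a) 0 S.
Proof.
move=> aY aY' kap01.
have aY'' : - Y < - a by rewrite ltrN2.
have k01 : 0 <= (0 : R) <= 1 by rewrite lexx ler01.
have i1 := integrable_inv_speed S p1 nu1 qE aY kap01.
have i2 := integrable_inv_speed S p1 nu1 qE aY'' k01.
rewrite /riccati_time -RintegralD//.
apply: (riccati_gain p1 nu1 qE S0); first by case/andP: kap01.
  by have := @integrableD _ _ R mu _ (measurable_itv _) _ _ i1 i2; apply.
move=> s /andP[s0 _].
have A0 := riccati_speed0_gt0 s.
have h1 := inv_tangent (riccati_speed_gt0 p1 nu1 qE aY kap01 s0) A0.
have h2 := inv_tangent (riccati_speed_gt0 p1 nu1 qE aY'' k01 s0) A0.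
have kap0 : 0 <= kap by case/andP: kap01.
have h3 := cutoff_gain kap0 s0.
apply: le_trans (lerD h1 h2); apply: le_trans (lerD (lexx _) h3) _.
rewrite le_eqVlt; apply/orP; left; apply/eqP.
rewrite -/(A s) (_ : riccati_speed p nu q a kap s = A s + a * s - kap * w s); last first.
  by rewrite /A /w /riccati_speed; ring.
rewrite (_ : riccati_speed p nu q (- a) 0 s = A s - a * s); last first.
  by rewrite /A /riccati_speed; ring.
by field; rewrite gt_eqF.
Qed.

(** The extreme case of the crossing argument: it yields that a left piece of slope [kap] can have
    length [1/2]. Only one tangent inequality is used, with first-order gain [kap s / A^2]. *)
Lemma riccati_time_half (kap : R) : 0 <= kap <= 1 -> kap < Y ->
  2 * riccati_time p nu q 0 0 S + kap / (6144 * p ^+ 2 * nu ^+ 2) <=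
  2 * riccati_time p nu q (- kap) 0 S.
Proof.
move=> kap01 kY.
have kY' : - Y < - kap by rewrite ltrN2.
have k01 : 0 <= (0 : R) <= 1 by rewrite lexx ler01.
have i1 := integrable_inv_speed S p1 nu1 qE kY' k01.
rewrite [in leRHS]/riccati_time -RintegralZl//.
apply: (riccati_gain p1 nu1 qE S0); first by case/andP: kap01.
  by have := @integrableZl _ _ R mu _ (measurable_itv _) 2 _ i1; apply.
move=> s /andP[s0 _].
have A0 := riccati_speed0_gt0 s.
have h1 := inv_tangent (riccati_speed_gt0 p1 nu1 qE kY' k01 s0) A0.
have kap0 : 0 <= kap by case/andP: kap01.
have h3 := cutoff_gain kap0 s0.
have h4 : kap * w s / A s ^+ 2 <= 2 * (kap * s / A s ^+ 2).
  have : kap * w s <= kap * s by rewrite ler_wpM2l//; case/andP: (cutoff_le s0).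
  have : 0 <= kap * s by rewrite mulr_ge0.
  move=> c0 c1; rewrite mulrA ler_wpM2r ?invr_ge0 ?sqr_ge0// (le_trans c1)//.
  by rewrite mulr_natl mulr2n lerDl.
have two : 0 <= 2 :> R by rewrite ler0n.
apply: le_trans (ler_wpM2l two h1); apply: le_trans (lerD (lexx _) (le_trans h3 h4)) _.
rewrite le_eqVlt; apply/orP; left; apply/eqP.
rewrite -/(A s) (_ : riccati_speed p nu q (- kap) 0 s = A s - kap * s); last first.
  by rewrite /A /riccati_speed; ring.
by field; rewrite gt_eqF.
Qed.
End riccati_time_gain.

(** * Logarithmically concave weights *)

Definition slopes_nonincreasing (R : realType) (L : R -> R) :=
  forall x y z w, 0 < x -> x < y -> y <= z -> z < w -> w < 1 ->
  (L w - L z) * (y - x) <= (L y - L x) * (w - z).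

(* [X a] is the length of the piece next to 0 that a slope [a] can sustain; the
   alternative is that the slopes of [L] cross the value [a] exactly at [X a]. *)
Lemma slope_crossing (R : realType) (L X : R -> R) (kap K : R) :
  slopes_nonincreasing L -> 0 < K ->
  (forall a, a <= kap -> 0 < X a <= 1 / 2) ->
  (forall a a', a <= a' -> a' <= kap -> X a <= X a' <= X a + K * (a' - a)) ->
  let P a := forall x y, 0 < x -> x < y -> y < X a -> a * (y - x) <= L y - L x in
  P kap \/ exists a, [/\ a < kap, P a &
     forall x y, X a < x -> x < y -> y < 1 -> L y - L x <= a * (y - x)].
Proof.
move=> Lc K0 X0 XK P.
pose E : set R := [set a | a <= kap /\ P a].
(* The slope of [L] on [[1/2, 3/4]] bounds from below all slopes to the left of [1/2], so [E] is
   nonempty. *)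
pose s1 := (L (3 / 4) - L (1 / 2)) * 4.
have E1 : E (Num.min s1 kap).
  have mk : Num.min s1 kap <= kap by rewrite ge_min lexx orbT.
  split => // x y x0 xy yX.
  have yh : y <= 1 / 2 by have /andP[] := X0 _ mk; lra.
  have h1 : Num.min s1 kap * (y - x) <= s1 * (y - x).
    by rewrite ler_wpM2r ?ge_min ?lexx//; lra.
  have h2 := Lc x y (1 / 2) (3 / 4) x0 xy yh (ltac:(lra)) (ltac:(lra)).
  by move: h1; rewrite /s1; lra.
have hsE : has_sup E by split; [exists (Num.min s1 kap)|exists kap => a []].
set a0 := sup E.
have a0k : a0 <= kap by apply: ge_sup; [exact: hsE.1|move=> a []].
have P0 : P a0.
  move=> x y x0 xy yX; rewrite leNgt; apply/negP => h.
  pose c := (L y - L x) / (y - x).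
  have yx : 0 < y - x by lra.
  have cE : L y - L x = c * (y - x) by rewrite /c divfK// gt_eqF.
  have ca : c < a0 by rewrite ltr_pdivrMr//.
  (* An element [a] of [E] within [e] of [a0] still exceeds the slope [c], and [y < X a] by the
     Lipschitz bound; then [P a] fails at [x] and [y]. *)
  pose e := Num.min (a0 - c) ((X a0 - y) / K).
  have e0 : 0 < e by rewrite lt_min subr_gt0 ca divr_gt0//; lra.
  have [a [ak Pa] aa] := sup_adherent e0 hsE.
  have aa0 : a <= a0 by apply: ub_le_sup => //; exact: hsE.2.
  have /andP[_ hX] := XK a a0 aa0 a0k.
  have h1 : a0 - a < (X a0 - y) / K.
    have : e <= (X a0 - y) / K by rewrite /e ge_min lexx orbT.
    by rewrite -/a0 in aa; lra.
  have h2 : c < a.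
    have : e <= a0 - c by rewrite /e ge_min lexx.
    by rewrite -/a0 in aa; lra.
  rewrite ltr_pdivlMr// in h1.
  have := Pa x y x0 xy (ltac:(lra)); rewrite cE ler_pM2r//; lra.
have [->|a0n] := eqVneq kap a0; first by left.
right; exists a0; have a0k' : a0 < kap by rewrite lt_neqAle eq_sym a0n.
split => // x y xX xy y1; rewrite leNgt; apply/negP => h.
pose c := (L y - L x) / (y - x).
have yx : 0 < y - x by lra.
have cE : L y - L x = c * (y - x) by rewrite /c divfK// gt_eqF.
have ca : a0 < c by rewrite ltr_pdivlMr//.
(* Raising [a0] by [e / 2] keeps it below [c] and [kap], and keeps [X a] below [x]. Slopes to the
   left of [x] are at least [c], so the raised value would still belong to [E]. *)
pose e := Num.min (Num.min (c - a0) (kap - a0)) ((x - X a0) / K).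
have e0 : 0 < e by rewrite !lt_min !subr_gt0 ca a0k' divr_gt0//; lra.
have eK : e * K <= x - X a0 by rewrite -ler_pdivlMr// /e ge_min lexx orbT.
have ec : e <= c - a0 by rewrite /e !ge_min lexx.
have ek : e <= kap - a0 by rewrite /e !ge_min lexx orbT.
pose a := a0 + e / 2.
have ak : a <= kap by rewrite /a; lra.
have nP : ~ P a.
  move=> Pa; have : a <= a0 by apply: ub_le_sup => //; exact: hsE.2.
  by rewrite /a; lra.
have /andP[_ hX] := XK a0 a (ltac:(rewrite /a; lra)) ak.
have Xax : X a < x by rewrite /a in hX *; nra.
apply: nP => x' y' x'0 x'y' y'X; rewrite leNgt; apply/negP => h'.
have := Lc x' y' x y x'0 x'y' (ltac:(lra)) xy y1.
rewrite cE; have yx' : 0 < y' - x' by lra.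
move=> h3; have : c * (y' - x') <= L y' - L x'.
  by rewrite -(ler_pM2r yx); lra.
have : a * (y' - x') <= c * (y' - x') by rewrite ler_pM2r// /a; lra.
lra.
Qed.

Definition concave3 (R : realType) (g : R -> R) := forall x y t : R, 0 < x < 1 -> 0 < y < 1 ->
  0 <= t <= 1 -> t * g x + (1 - t) * g y <= g (t * x + (1 - t) * y).

Section concavity.
Context {R : realType}.
Implicit Types g h L : R -> R.

Lemma conv_gt (a x y t : R) : a < x -> a < y -> 0 <= t <= 1 -> a < t * x + (1 - t) * y.
Proof.
move=> ax ay /andP[t0 t1]; have [->|tn] := eqVneq t 0; first by lra.
have tp : 0 < t by rewrite lt0r tn.
have h1 : 0 < t * (x - a) by rewrite mulr_gt0 ?subr_gt0.
have h2 : 0 <= (1 - t) * (y - a) by rewrite mulr_ge0 ?subr_ge0// ltW.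
by lra.
Qed.

Lemma conv_lt (b x y t : R) : x < b -> y < b -> 0 <= t <= 1 -> t * x + (1 - t) * y < b.
Proof.
move=> xb yb t01; have := @conv_gt (- b) (- x) (- y) t.
by rewrite !ltrN2 => /(_ xb yb t01); lra.
Qed.

Lemma concave_on_concave3 g : concave_on unit_itv g -> concave3 g.
Proof.
move=> cg x y t x01 y01 /andP[t0 t1].
have := cg (Itv01 t0 t1) x y.
rewrite !inE /unit_itv/= !in_itv/= => /(_ x01 y01).
by rewrite !convRE/= /unstable.onem -lerN2 opprK opprD -!mulrN !opprK.
Qed.

Lemma concave3_comp_ln h : (forall x, 0 < x < 1 -> 0 < h x) -> concave3 h ->
  concave3 (fun x => ln (h x)).
Proof.
move=> h0 ch x y t x01 y01 t01; have /andP[t0 t1] := t01.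
have := concave_ln (Itv01 t0 t1) (h0 x x01) (h0 y y01).
rewrite !convRE/= /unstable.onem => /le_trans; apply.
have xy01 : 0 < t * x + (1 - t) * y < 1.
  case/andP: x01 => x0 x1; case/andP: y01 => y0 y1.
  by rewrite conv_gt ?conv_lt.
have hx := h0 x x01; have hy := h0 y y01; have hxy := h0 _ xy01.
have hc : 0 < t * h x + (1 - t) * h y by exact: conv_gt.
by rewrite ler_ln ?posrE//; exact: ch.
Qed.

(** The logarithm of the [1/m] power is [ln h / m], so the exponent merely rescales a concave
    function. *)
Lemma concave3_power (m : nat) h : (0 < m)%N -> (forall x, 0 < x < 1 -> 0 < h x) ->
  power_concave_on m%:R^-1 unit_itv h -> concave3 (fun x => ln (h x)).
Proof.
move=> m0 h0 /concave_on_concave3 ch.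
have := concave3_comp_ln (fun x x01 => powR_gt0 m%:R^-1 (h0 x x01)) ch.
have mR : 0 < m%:R^-1 :> R by rewrite invr_gt0 ltr0n.
move=> H x y t x01 y01 t01; have := H x y t x01 y01 t01; rewrite !ln_powR => hh.
rewrite -(ler_pM2l mR); apply: le_trans hh.
by rewrite le_eqVlt; apply/orP; left; apply/eqP; ring.
Qed.

Lemma concave3_add g h : concave3 g -> concave3 h -> concave3 (fun x => g x + h x).
Proof.
move=> cg ch x y t x01 y01 t01.
have := cg x y t x01 y01 t01; have := ch x y t x01 y01 t01; lra.
Qed.

Lemma concave3_slopes g : concave3 g -> slopes_nonincreasing g.
Proof.
move=> cg.
have three x y z : 0 < x -> x < y -> y < z -> z < 1 ->
    (g z - g y) * (y - x) <= (g y - g x) * (z - y).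
  move=> x0 xy yz z1; have zx : 0 < z - x by lra.
  pose t := (z - y) / (z - x).
  have tE : t * (z - x) = z - y by rewrite /t divfK// gt_eqF.
  have t01 : 0 <= t <= 1.
    by rewrite /t divr_ge0 ?ler_pdivrMr ?mul1r//=; lra.
  have := cg x z t (ltac:(lra)) (ltac:(lra)) t01.
  have -> : t * x + (1 - t) * z = y by lra.
  rewrite -(ler_pM2r zx) => h.
  have h2 : (t * g x + (1 - t) * g z) * (z - x) = (z - y) * g x + (y - x) * g z.
    rewrite (_ : _ * _ = t * (z - x) * g x + ((z - x) - t * (z - x)) * g z); last by ring.
    by rewrite tE; ring.
  by rewrite h2 in h; lra.
move=> x y z w x0 xy yz zw w1.
move: yz zw; rewrite [y <= z]le_eqVlt => /predU1P[<-|yz] zw; first exact: three.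
have h1 := three x y z x0 xy yz (ltac:(lra)).
have h2 := three y z w (ltac:(lra)) yz zw w1.
have zy : 0 < z - y by lra.
rewrite -(ler_pM2r zy).
have yx : 0 <= y - x by lra.
have wz : 0 <= w - z by lra.
have h3 := ler_wpM2r yx h2; have h4 := ler_wpM2r wz h1.
by lra.
Qed.

(** Slopes on [[x/2, (x+1)/2]] lie between those of one fixed chord on each side, so [g] is
    Lipschitz there. *)
Lemma slopes_nonincreasing_continuous g x : slopes_nonincreasing g -> 0 < x < 1 ->
  {for x, continuous g}.
Proof.
move=> sg x01.
pose a1 := x / 4; pose a2 := x / 2; pose b1 := (x + 1) / 2; pose b2 := (x + 3) / 4.
pose sl := (g a2 - g a1) / (a2 - a1); pose sr := (g b2 - g b1) / (b2 - b1).
pose M := `|sl| + `|sr| + 1.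
have M0 : 0 < M by rewrite /M ltr_wpDl ?addr_ge0.
have aE : g a2 - g a1 = sl * (a2 - a1) by rewrite /sl divfK// gt_eqF// /a1 /a2; lra.
have bE : g b2 - g b1 = sr * (b2 - b1) by rewrite /sr divfK// gt_eqF// /b1 /b2; lra.
have slN := ler_norm sl; have srN := ler_norm (- sr); rewrite normrN in srN.
have sl0 := normr_ge0 sl; have sr0 := normr_ge0 sr.
have key y z : a2 <= y -> y < z -> z <= b1 -> `|g z - g y| <= M * (z - y).
  move=> ay yz zb.
  have h1 := sg a1 a2 y z (ltac:(rewrite /a1; lra)) (ltac:(rewrite /a1 /a2; lra)) ay yz (ltac:(rewrite /b1 in zb; lra)).
  have h2 := sg y z b1 b2 (ltac:(rewrite /a2 in ay; lra)) yz zb (ltac:(rewrite /b1 /b2; lra)) (ltac:(rewrite /b2; lra)).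
  have zy : 0 < z - y by lra.
  have a21 : 0 < a2 - a1 by rewrite /a1 /a2; lra.
  have b21 : 0 < b2 - b1 by rewrite /b1 /b2; lra.
  have u1 : g z - g y <= sl * (z - y) by rewrite -(ler_pM2r a21); rewrite aE in h1; lra.
  have u2 : sr * (z - y) <= g z - g y by rewrite -(ler_pM2r b21); rewrite bE in h2; lra.
  by rewrite ler_norml /M; nra.
have near_b : \forall y \near x, a2 < y < b1.
  near=> y; apply/andP; split; near: y; [apply: lt_nbhsr|apply: lt_nbhsl]; rewrite /a2 /b1; lra.
apply/cvgrPdist_lt => e e0; near=> y.
have /andP[ya yb] : a2 < y < b1 by near: y.
have ye : `|x - y| < e / M by near: y; exists (e / M) => //=; rewrite divr_gt0.
rewrite ltr_pdivlMr// mulrC in ye.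
have [xy|yx|->] := ltgtP x y; last by rewrite subrr normr0.
- have xyE : `|x - y| = y - x by rewrite distrC gtr0_norm ?subr_gt0.
  rewrite xyE in ye; rewrite distrC; apply: le_lt_trans ye.
  by apply: key; [rewrite /a2; lra|by []|exact: ltW].
- have xyE : `|x - y| = x - y by rewrite gtr0_norm ?subr_gt0.
  rewrite xyE in ye; apply: le_lt_trans ye.
  by apply: key; [exact: ltW|by []|rewrite /b1; lra].
Unshelve. all: by end_near. Qed.
End concavity.

Section tangent.
Context {R : realType}.

(* At an interior minimum [z] of [h + C (x - c)^2] the concave function [h] is
   squeezed between a parabola and its supporting line. *)
Lemma exists_tangent_pt (h : R -> R) (l r : R) : slopes_nonincreasing h ->
  (forall x, 0 < x < 1 -> 0 < h x) -> 0 < l -> l < r -> r < 1 ->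
  exists z d, [/\ l < z < r, is_derive z 1 h d &
    forall y, 0 < y < 1 -> h y <= h z + d * (y - z)].
Proof.
move=> sh h0 l0 lr r1.
pose c := (l + r) / 2; pose w := (r - l) / 2.
have w0 : 0 < w by rewrite /w; lra.
have hc : 0 < h c by apply: h0; rewrite /c; lra.
(* With this [C], [G] exceeds [h c = G c] at both ends of [[l, r]], so its minimum is interior. *)
pose C := h c / w ^+ 2.
have C0 : 0 < C by rewrite divr_gt0// exprn_gt0.
have Cw : C * w ^+ 2 = h c by rewrite /C divfK// gt_eqF// exprn_gt0.
pose G x := h x + C * (x - c) ^+ 2.
have cG : {within `[l, r], continuous G}.
  apply: continuous_in_subspaceT => x; rewrite inE/= in_itv/= => xlr.
  apply: cvgD; first by apply: slopes_nonincreasing_continuous => //; lra.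
  apply: cvgMr; apply: (@continuous_comp _ _ _ (fun x : R => x - c) (fun x => x ^+ 2)).
    by apply: cvgB; [exact: cvg_id|exact: cvg_cst].
  exact: exprn_continuous.
have [z zlr Gz] := EVT_min (ltW lr) cG.
move: zlr; rewrite in_itv/= => zlr.
have Gc : G z <= h c.
  by have := Gz c; rewrite in_itv/= /G subrr expr0n/= mulr0 addr0; apply; rewrite /c; lra.
have zl : l < z.
  rewrite lt_neqAle; apply/andP; split; last by case/andP: zlr.
  apply/eqP => E; have : 0 < h z by apply: h0; lra.
  have zc : (z - c) ^+ 2 = w ^+ 2 by rewrite -E /c /w; field.
  by move: Gc; rewrite /G zc Cw; lra.
have zr : z < r.
  rewrite lt_neqAle; apply/andP; split; last by case/andP: zlr.
  apply/eqP => E; have : 0 < h z by apply: h0; lra.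
  have zc : (z - c) ^+ 2 = w ^+ 2 by rewrite E /c /w; field.
  by move: Gc; rewrite /G zc Cw; lra.
pose s := - 2 * C * (z - c).
have lower x : l <= x <= r -> h z + s * (x - z) - C * (x - z) ^+ 2 <= h x.
  move=> xlr; have := Gz x; rewrite in_itv/= => /(_ xlr).
  by rewrite /G /s !expr2; lra.
(* By [lower], a chord of length [t] on the other side of [z] has a slope that passes [s] by at most
   [C t]; monotonicity of slopes carries this over to [y], and [t] is taken small enough for an
   error at most [e]. *)
have upper y : 0 < y < 1 -> h y <= h z + s * (y - z).
  move=> y01; have [zy|yz|->] := ltgtP z y; last by rewrite subrr mulr0 addr0.
  - rewrite -lerBlDl; have yz0 : 0 < y - z by lra.
    apply/ler_addgt0Pr => e e0.
    pose t := Num.min (z - l) (e / (C * (y - z))).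
    have t0 : 0 < t by rewrite lt_min subr_gt0 ?zl ?zr/= divr_gt0// mulr_gt0.
    have tz : t <= z - l by rewrite /t ge_min lexx.
    have te : t * (C * (y - z)) <= e.
      by rewrite -(ler_pdivlMr _ _ (mulr_gt0 C0 yz0)) /t ge_min lexx orbT.
    have h1 := sh (z - t) z z y (ltac:(lra)) (ltac:(lra)) (lexx _) zy (ltac:(lra)).
    have h2 := lower (z - t) (ltac:(lra)).
    rewrite -(ler_pM2r t0).
    have h3 : (h z - h (z - t)) * (y - z) <= (s * t + C * t ^+ 2) * (y - z).
      by rewrite ler_pM2r// ; rewrite !expr2 in h2 *; lra.
    have h4 : t * (C * (y - z)) * t <= e * t by rewrite ler_pM2r.
    by rewrite expr2 in h3; lra.
  - rewrite -lerBlDl; have yz0 : 0 < z - y by lra.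
    apply/ler_addgt0Pr => e e0.
    pose t := Num.min (r - z) (e / (C * (z - y))).
    have t0 : 0 < t by rewrite lt_min subr_gt0 ?zl ?zr/= divr_gt0// mulr_gt0.
    have tz : t <= r - z by rewrite /t ge_min lexx.
    have te : t * (C * (z - y)) <= e.
      by rewrite -(ler_pdivlMr _ _ (mulr_gt0 C0 yz0)) /t ge_min lexx orbT.
    have h1 := sh y z z (z + t) (ltac:(lra)) yz (lexx _) (ltac:(lra)) (ltac:(lra)).
    have h2 := lower (z + t) (ltac:(lra)).
    rewrite -(ler_pM2r t0).
    have h3 : (s * t - C * t ^+ 2) * (z - y) <= (h (z + t) - h z) * (z - y).
      by rewrite ler_pM2r// ; rewrite !expr2 in h2 *; lra.
    have h4 : t * (C * (z - y)) * t <= e * t by rewrite ler_pM2r.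
    by rewrite expr2 in h3; lra.
exists z, s; split; [by rewrite zl zr| |exact: upper].
have da (e : R) : is_derive z 1 (fun y : R => (y - z) * e) e by exact: is_derive_affine.
have dc := is_derive_cst (h z) z (1 : R).
apply: (@is_derive_squeeze R (fun x => h z + ((x - z) * s - (x - z) * C * (x - z))) h
   (fun x => h z + (x - z) * s)).
- near=> x; have xlr : l < x < r.
    by apply/andP; split; near: x; [exact: lt_nbhsr|exact: lt_nbhsl].
  have h1 := lower x (ltac:(lra)); have h2 := upper x (ltac:(lra)).
  by rewrite expr2 in h1; apply/andP; split; lra.
- by rewrite subrr !mul0r subrr addr0.
- by rewrite subrr mul0r addr0.
- have d1 : is_derive z 1 (fun x : R => x - z) 1.
    by have := da 1; rewrite (_ : (fun y : R => (y - z) * 1) = (fun y => y - z))//; apply/funext => y; rewrite mulr1.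
  have := is_deriveD dc (is_deriveB (da s) (is_deriveM (da C) d1)).
  move=> H; apply: (is_derive_eq H).
  by rewrite /GRing.scale/= subrr !mul0r !addr0 subr0 add0r.
- have := is_deriveD dc (da s) => H; apply: (is_derive_eq H); exact: add0r.
Unshelve. all: by end_near. Qed.

(** Let [r = d / h z]. Below the tangent, [ln h] has slope at least [r] on chords ending at [z], so
    [phi] has slope at most [a - r] on such a chord and hence beyond [z]. Beyond [x] the slope of
    [ln h] is at most [r / (1 + r (x - z))], and this is at most [r - r^2 / 8] because
    [x - z >= 1/4] and [r <= 2]. *)
Lemma concave_steepening (h phi L : R -> R) (z d a x0 : R) :
  slopes_nonincreasing h -> slopes_nonincreasing phi ->
  (forall x, 0 < x < 1 -> 0 < h x) ->
  (forall x, 0 < x < 1 -> L x = ln (h x) + phi x) ->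
  1 / 2 < z < 5 / 8 ->
  (forall y, 0 < y < 1 -> h y <= h z + d * (y - z)) ->
  0 < x0 < 1 / 2 ->
  (forall x y, x0 < x -> x < y -> y < 1 -> L y - L x <= a * (y - x)) ->
  forall x y, 7 / 8 <= x -> x < y -> y < 1 ->
  L y - L x <= (a - (d / h z) ^+ 2 / 8) * (y - x).
Proof.
move=> sh sphi h0 LE z58 tan x001 La x y x78 xy y1.
have hz : 0 < h z by apply: h0; lra.
have hx : 0 < h x by apply: h0; lra.
have hy : 0 < h y by apply: h0; lra.
pose r := d / h z; have dE : d = r * h z by rewrite /r divfK// gt_eqF.
pose X := x - z; have X14 : 1 / 4 <= X by rewrite /X; lra.
have tx := tan x (ltac:(lra)).
have rX : 0 < 1 + r * X.
  have : 0 < h z * (1 + r * X) by apply: lt_le_trans hx _; rewrite dE in tx; rewrite /X; lra.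
  by rewrite pmulr_rgt0.
(* Otherwise the tangent would vanish at [z - r^-1], a point of [(0, 1)] as [z > 1/2], where [h] is
   positive. *)
have r2 : r <= 2.
  rewrite leNgt; apply/negP => r2.
  have y0 : 0 < z - r^-1.
    rewrite subr_gt0 -[ltRHS]invrK ltf_pV2 ?posrE ?invr_gt0//; try lra.
    apply: le_lt_trans r2; rewrite -[leRHS]invrK lef_pV2 ?posrE ?invr_gt0//; lra.
  have rn : r != 0 by rewrite gt_eqF//; lra.
  have := tan (z - r^-1); have ri : 0 < r^-1 by rewrite invr_gt0; lra.
  move=> /(_ (ltac:(lra))).
  rewrite (_ : h z + d * (z - r^-1 - z) = 0); last by rewrite dE; field.
  by rewrite leNgt h0//; lra.
have lnphi : phi y - phi x <= (a - r) * (y - x).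
  pose w := (x0 + z) / 2.
  have zw : 0 < z - w by rewrite /w; lra.
  have h1 := sphi w z x y (ltac:(rewrite /w; lra)) (ltac:(rewrite /w; lra)) (ltac:(lra)) xy y1.
  have h2 := La w z (ltac:(rewrite /w; lra)) (ltac:(rewrite /w; lra)) (ltac:(lra)).
  rewrite !LE in h2; try (rewrite /w; lra).
  have hw : 0 < h w by apply: h0; rewrite /w; lra.
  have h3 : ln (h w) - ln (h z) <= r * (w - z).
    rewrite -ln_div ?posrE//; apply: le_trans (_ : ln (1 + r * (w - z)) <= _).
      have tw := tan w (ltac:(rewrite /w; lra)).
      have hh : h w / h z <= 1 + r * (w - z).
        by rewrite ler_pdivrMr//; rewrite dE in tw; lra.
      rewrite ler_ln ?posrE// ?divr_gt0//.
      by apply: lt_le_trans hh; rewrite divr_gt0.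
    apply: le_ln1Dx; have tw := tan w (ltac:(rewrite /w; lra)).
    have : 0 < h z * (1 + r * (w - z)).
      by apply: lt_le_trans hw _; rewrite dE in tw; lra.
    by rewrite pmulr_rgt0//; lra.
  rewrite -(ler_pM2r zw); have yx : 0 <= y - x by lra.
  have h4 : phi z - phi w <= (a - r) * (z - w) by lra.
  have h5 := ler_wpM2r yx h4.
  by lra.
have lnh : ln (h y) - ln (h x) <= (y - x) * r / (1 + r * X).
  have yx : 0 < y - x by lra.
  have XE : 0 < X by lra.
  rewrite -ln_div ?posrE//.
  have E : h y / h x = 1 + (h y - h x) / h x by field; rewrite gt_eqF.
  have h1 : (h y - h x) / h x <= (y - x) * r / (1 + r * X).
    rewrite ler_pdivrMr// mulrAC ler_pdivlMr//.
    have s1 := sh z x x y (ltac:(lra)) (ltac:(rewrite /X in XE; lra)) (lexx _) xy y1.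
    rewrite -/X in s1.
    have tX : h x - h z <= r * h z * X by rewrite dE in tx; rewrite /X; lra.
    rewrite -(ler_pM2r XE).
    have s2 := ler_wpM2r (ltW rX) s1.
    have s3 := ler_wpM2r (ltW yx) tX.
    by lra.
  rewrite E; apply: le_trans h1; apply: le_ln1Dx.
  by rewrite -subr_gt0 opprK addrC -E divr_gt0.
rewrite !LE; try lra.
have fin : (y - x) * r / (1 + r * X) <= (r - r ^+ 2 / 8) * (y - x).
  rewrite -mulrA [leRHS]mulrC.
  rewrite ler_pM2l; last by lra.
  rewrite ler_pdivrMr//.
  have : 0 <= r ^+ 2 * (8 * X - 1 - r * X).
    by rewrite mulr_ge0 ?sqr_ge0//; nra.
  by rewrite expr2; lra.
by rewrite -/r; lra.
Qed.
End tangent.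

Section crossing_fields.
Context {R : realType}.

Lemma le_mul_expR (c fx fy : R) : 0 < fx -> 0 < fy -> ln fy - ln fx <= c -> fy <= fx * expR c.
Proof.
move=> fx0 fy0 h; rewrite -ler_ln ?posrE ?mulr_gt0 ?expR_gt0//.
by rewrite lnM ?posrE ?expR_gt0// expRK; lra.
Qed.

Lemma measurable_log_concave (f : R -> R) : (forall x, 0 < x < 1 -> 0 < f x) ->
  slopes_nonincreasing (fun x => ln (f x)) -> measurable_fun unit_itv f.
Proof.
move=> f0 sL.
have mL : measurable_fun unit_itv (fun x => ln (f x)).
  apply: open_continuous_measurable_fun; first exact: interval_open.
  move=> x; rewrite inE /unit_itv/= in_itv/= => x01.
  exact: (slopes_nonincreasing_continuous sL).
apply: (eq_measurable_fun (fun x => expR (ln (f x)))).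
  by move=> x; rewrite inE /unit_itv/= in_itv/= => /f0 fx; rewrite lnK// posrE.
apply: (@measurableT_comp _ _ _ _ _ _ (@expR R)) => //.
Qed.

Lemma reflected_slope_le (f : R -> R) (a x0 : R) : x0 < 1 ->
  (forall x, 0 < x < 1 -> 0 < f x) ->
  (forall x y, 0 < x -> x < y -> y < x0 -> a * (y - x) <= ln (f y) - ln (f x)) ->
  slope_le (fun x => f (1 - x)) (- a) (1 - x0) 1.
Proof.
move=> x01 f0 Pa x y xx xy y1; apply: le_mul_expR; [apply: f0; lra|apply: f0; lra|].
have h1 : 0 < 1 - y by lra.
have h2 : 1 - y < 1 - x by lra.
have h3 : 1 - x < x0 by lra.
have := Pa (1 - y) (1 - x) h1 h2 h3; rewrite (_ : 1 - x - (1 - y) = y - x); last by ring.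
by lra.
Qed.

(** The left piece, seen after reflection, has slope at most [- a] and so can last for the time
    [tm a]. Capping it at [1/2] makes [steep] applicable to any crossing point before [1/2]; if the
    cap is reached, only the left field, at [1/2], is claimed. *)
Lemma crossing_fields (p nu q kap S : R) (f : R -> R) :
  1 < p -> 1 <= nu -> q = p / (p - 1) -> (16 * p)^-1 < S ->
  0 <= kap <= 1 ->
  1 <= 2 * riccati_time p nu q 0 0 S + kap / (6144 * p ^+ 2 * nu ^+ 2) ->
  (forall x, 0 < x < 1 -> 0 < f x) ->
  slopes_nonincreasing (fun x => ln (f x)) ->
  (forall a x0, 0 < x0 < 1 / 2 ->
    (forall x y, x0 < x -> x < y -> y < 1 -> ln (f y) - ln (f x) <= a * (y - x)) ->
    forall x y, 7 / 8 <= x -> x < y -> y < 1 ->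
      ln (f y) - ln (f x) <= (a - kap) * (y - x)) ->
  (exists x0, [/\ 0 < x0 < 1, neumann_field p nu f x0 &
     neumann_field p nu (fun x => f (1 - x)) (1 - x0)]) \/
  neumann_field p nu (fun x => f (1 - x)) (1 - 1 / 2).
Proof.
move=> p1 nu1 qE S0 kap01 base f0 sL steep.
have pair_ge a Ya aY :=
  le_trans base (@riccati_time_pair R p nu q S p1 nu1 qE S0 a kap Ya aY kap01).
have half_ge kY := le_trans base (@riccati_time_half R p nu q S p1 nu1 qE S0 kap kap01 kY).
clear base.
have p0 : 0 < p by lra.
have nu0 : 0 < nu by lra.
have mf := measurable_log_concave f0 sL.
have mI : measurable (@unit_itv R) by exact: measurable_itv.
have Sp : 0 < S by exact: S_gt0 p1 S0.
pose Y := p * nu `^ p^-1.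
have Y1 : 1 < Y.
  have : 1 <= nu `^ p^-1.
    by have := @ge0_ler_powR R p^-1 (ltac:(by rewrite invr_ge0 ltW)) 1 nu;
      rewrite powR1 !nnegrE; apply => //; lra.
  by rewrite /Y; nra.
have k01 : 0 <= (0 : R) <= 1 by lra.
pose tm a := riccati_time p nu q (- a) 0 S.
pose X a := Num.min (tm a) (1 / 2).
have tm0 a : a <= kap -> 0 < tm a.
  by move=> ak; apply: riccati_time_gt0 => //; rewrite -/Y; lra.
have X0 a : a <= kap -> 0 < X a <= 1 / 2.
  by move=> ak; rewrite /X lt_min tm0// ge_min lexx orbT andbT; lra.
(* Thus [X kap = 1/2]: if the slopes do not cross any value below [kap], the left field exists at
   [1/2]. *)
have tk : 1 / 2 <= tm kap.
  have := half_ge (ltac:(rewrite -/Y; lra)).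
  by rewrite /tm; lra.
have pair a : - Y < a -> a < Y -> 1 <= riccati_time p nu q a kap S + tm a.
  exact: pair_ge.
clear pair_ge half_ge.
pose m0 := Num.min (7 / 8) ((Y + - kap) / (16 * p)).
have m00 : 0 < m0 by apply: riccati_speed_min_gt0 => //; rewrite -/Y; lra.
pose K := S * S / m0 ^+ 2.
have K0 : 0 < K by rewrite divr_gt0 ?mulr_gt0 ?exprn_gt0.
have XK a a' : a <= a' -> a' <= kap -> X a <= X a' <= X a + K * (a' - a).
  move=> aa ak.
  have t1 : tm a <= tm a'.
    by apply: riccati_time_anti => //; [rewrite -/Y; lra|rewrite lerN2].
  have t2 : tm a' <= tm a + K * (a' - a).
    have := @riccati_time_lip R p nu q S p1 nu1 qE S0 (- a') (- a) _ (ltac:(rewrite -/Y; lra)) (ltac:(rewrite -/Y; lra)) erefl.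
    rewrite (_ : Num.min (- a') (- a) = - a'); last by rewrite min_l// lerN2.
    rewrite -/Y -/(tm a) -/(tm a') => /le_trans; apply; rewrite lerD2l.
    rewrite (_ : - a' - - a = - (a' - a)); last by ring.
    rewrite normrN ger0_norm ?subr_ge0// mulrC ler_wpM2r ?subr_ge0//.
    rewrite /K ler_pM2l ?mulr_gt0//.
    set m := Num.min _ _.
    have m0m : m0 <= m.
      rewrite /m0 /m le_min ge_min lexx/= ge_min; apply/orP; right.
      by rewrite ler_pM2r ?invr_gt0 ?mulr_gt0//; lra.
    rewrite lef_pV2 ?posrE ?exprn_gt0//; last exact: lt_le_trans m0m.
    by rewrite ler_sqr ?nnegrE//; [exact: ltW|exact: le_trans (ltW m00) m0m].
  have Ka : 0 <= K * (a' - a) by rewrite mulr_ge0 ?subr_ge0// ltW.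
  rewrite /X; apply/andP; split.
    by rewrite le_min !ge_min t1 lexx/= orbT.
  by case: (leP (tm a) (1 / 2)) => h; rewrite ge_min; apply/orP; [left|right]; lra.
have fieldL a x0 : a <= kap -> 0 < x0 -> x0 < 1 -> x0 <= tm a ->
    (forall x y, 0 < x -> x < y -> y < x0 -> a * (y - x) <= ln (f y) - ln (f x)) ->
    neumann_field p nu (fun x => f (1 - x)) (1 - x0).
  move=> ak x00 x01 x0t Pa.
  have sl := reflected_slope_le x01 f0 Pa.
  apply: (@neumann_field_ode R p nu q (- a) 0 S (1 - x0) ((1 - x0 + 1) / 2)) => //.
  - by rewrite -/Y; lra.
  - by lra.
  - by lra.
  - by left.
  - have := measurable_onem mI mf; apply: measurable_funS.
      rewrite (_ : _ @^-1` _ = `]0, 1[%classic)//.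
      by apply/seteqP; split => x /=; rewrite /unit_itv/= !in_itv/=; lra.
    by move=> x /=; rewrite /unit_itv/= !in_itv/=; lra.
  - by move=> x xx; apply: f0; lra.
  - by move=> x y xx xy y1; rewrite subr0; apply: sl => //; lra.
  - by rewrite opprB addrC subrK.
have [Pk|[a [ak Pa Ra]]] := slope_crossing sL K0 X0 XK.
  right.
  have Xk : X kap = 1 / 2 by rewrite /X min_r.
  apply: (fieldL kap) => //; try lra.
  by move=> x y x0' xy yh; apply: Pk => //; rewrite Xk.
have /andP[Xa0 Xah] := X0 a (ltW ak).
have Xt : X a <= tm a by rewrite /X ge_min lexx.
have left_ok : neumann_field p nu (fun x => f (1 - x)) (1 - X a).
  by apply: (fieldL a) => //; lra.
have [XE|Xn] := eqVneq (X a) (1 / 2); first by right; rewrite -XE.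
have Xh : X a < 1 / 2 by rewrite lt_neqAle Xn.
have XE : X a = tm a.
  by move: Xn; rewrite /X; case: (leP (tm a) (1 / 2)) => // _; rewrite eqxx.
left; exists (X a); split; [lra| |exact: left_ok].
have mfX : measurable_fun (`]X a, 1[ : set R) f.
  by apply: measurable_funS mf => // x /=; rewrite /unit_itv/= !in_itv/=; lra.
have fX x : X a < x < 1 -> 0 < f x by move=> xx; apply: f0; lra.
have slX : slope_le f a (X a) 1.
  by move=> x y xx xy y1; apply: le_mul_expR; [apply: f0; lra|apply: f0; lra|exact: Ra].
(* For slopes up to [- Y] the Riccati time would be infinite, and the stationary solution covers any
   length. *)
have [aY|Ya] := leP a (- Y).
  by apply: (@neumann_field_const R p nu q a) => //; lra.
have st := steep a (X a) (ltac:(lra)) Ra.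
apply: (@neumann_field_ode R p nu q a kap S (X a) (7 / 8)) => //.
- by lra.
- by lra.
- by right.
- move=> x y xx xy y1; apply: le_mul_expR; [apply: f0; lra|apply: f0; lra|exact: st].
by have := pair a Ya (ltac:(lra)); rewrite XE; lra.
Qed.
End crossing_fields.

Section two_fields.
Context {R : realType}.

(** If [d > 0], the tangent vanishes at [z - h z / d], which cannot lie in [(0, 1)] because [h] is
    positive there. *)
Lemma tangent_log_slope (h : R -> R) (z d : R) : (forall x, 0 < x < 1 -> 0 < h x) ->
  0 < z < 1 -> (forall y, 0 < y < 1 -> h y <= h z + d * (y - z)) ->
  d / h z <= z^-1.
Proof.
move=> h0 z01 tan; have hz := h0 z z01.
have [z0 z1] : 0 < z /\ z < 1 by lra.
rewrite ler_pdivrMr// mulrC ler_pdivlMr//.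
rewrite leNgt; apply/negP => lt.
have d0 : 0 < d by rewrite -(pmulr_lgt0 _ z0); exact: lt_trans lt.
pose y := z - h z / d.
have yd : d * (z - y) = h z by rewrite /y; field; rewrite gt_eqF.
have hd : 0 < h z / d by rewrite divr_gt0.
have y0 : 0 < y.
  by rewrite -(pmulr_rgt0 _ d0); lra.
have y01 : 0 < y < 1 by rewrite y0/= /y; lra.
by have := tan y y01; have := h0 y y01; lra.
Qed.

(** The previous bound for [h] and for its reflection gives [|d / h z| <= 8/3]. The value 8 ensures
    that [kap = D / 8] is at most 1. *)
Lemma tangent_log_slope_sqr (h : R -> R) (z d : R) : (forall x, 0 < x < 1 -> 0 < h x) ->
  1 / 2 < z < 5 / 8 -> (forall y, 0 < y < 1 -> h y <= h z + d * (y - z)) ->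
  (d / h z) ^+ 2 <= 8.
Proof.
move=> h0 /andP[z1 z2] tan.
have z01 : 0 < z < 1 by apply/andP; split; lra.
have b1 := tangent_log_slope h0 z01 tan.
have hz x : 0 < x < 1 -> 0 < h (1 - x) by move=> x01; apply: h0; lra.
have z01' : 0 < 1 - z < 1 by lra.
have tanr y : 0 < y < 1 -> h (1 - y) <= h (1 - (1 - z)) + (- d) * (y - (1 - z)).
  move=> y01; have := tan (1 - y) (ltac:(lra)).
  by rewrite (_ : 1 - (1 - z) = z); [lra|ring].
have := tangent_log_slope hz z01' tanr.
rewrite (_ : 1 - (1 - z) = z); last by ring.
rewrite mulNr => b2.
have zV : z^-1 <= 2 by rewrite invf_ple ?posrE; lra.
have zV' : (1 - z)^-1 <= 8 / 3 by rewrite invf_ple ?posrE ?invf_div; lra.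
have : `|d / h z| <= 8 / 3 by rewrite ler_norml; apply/andP; split; lra.
move=> dh; rewrite -real_normK ?num_real//; apply: (@le_trans _ _ ((8 / 3) ^+ 2)); last lra.
by rewrite lerXn2r ?nnegrE.
Qed.

Lemma slopes_nonincreasing_onem (L : R -> R) : slopes_nonincreasing L ->
  slopes_nonincreasing (fun x => L (1 - x)).
Proof.
move=> sL x y z w x0 xy yz zw w1.
have h1 : 0 < 1 - w by lra.
have h2 : 1 - w < 1 - z by lra.
have h3 : 1 - z <= 1 - y by lra.
have h4 : 1 - y < 1 - x by lra.
have h5 : 1 - x < 1 by lra.
have := sL _ _ _ _ h1 h2 h3 h4 h5.
rewrite (_ : 1 - z - (1 - w) = w - z); last by ring.
rewrite (_ : 1 - x - (1 - y) = y - x); last by ring.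
by lra.
Qed.

(** [crossing_fields] is applied to [f], with the tangent at [z], and to its reflection, with the
    tangent at [z']. If neither has a crossing before [1/2], the two one-sided fields both live at
    [1/2] and fit together. *)
Lemma concave_product_two_fields (p nu q S D : R) (f h phi : R -> R) (z d z' d' : R) :
  1 < p -> 1 <= nu -> q = p / (p - 1) -> (16 * p)^-1 < S -> 0 <= D ->
  1 <= 2 * riccati_time p nu q 0 0 S + D / 8 / (6144 * p ^+ 2 * nu ^+ 2) ->
  (forall x, 0 < x < 1 -> 0 < h x) -> slopes_nonincreasing h ->
  (forall x, 0 < x < 1 -> 0 < f x) -> slopes_nonincreasing phi ->
  (forall x, 0 < x < 1 -> ln (f x) = ln (h x) + phi x) ->
  slopes_nonincreasing (fun x => ln (f x)) ->
  1 / 2 < z < 5 / 8 -> (forall y, 0 < y < 1 -> h y <= h z + d * (y - z)) ->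
  3 / 8 < z' < 1 / 2 -> (forall y, 0 < y < 1 -> h y <= h z' + d' * (y - z')) ->
  D <= (d / h z) ^+ 2 -> D <= (d' / h z') ^+ 2 ->
  exists x0, [/\ 0 < x0 < 1, neumann_field p nu f x0 &
     neumann_field p nu (fun x => f (1 - x)) (1 - x0)].
Proof.
move=> p1 nu1 qE Sp D0 base h0 sh f0 sphi fE sL z58 tan z38 tan' Dz Dz'.
have D8 : D / 8 <= 1.
  by clear -h0 z58 tan Dz; have := tangent_log_slope_sqr h0 z58 tan; lra.
have D80 : 0 <= D / 8 <= 1 by rewrite D8 andbT divr_ge0.
pose f' x := f (1 - x); pose h' x := h (1 - x); pose phi' x := phi (1 - x).
have rr (g : R -> R) : (fun x => g (1 - (1 - x))) = g.
  by apply/funext => x; congr g; ring.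
have H1 := @crossing_fields R p nu q (D / 8) S f p1 nu1 qE Sp D80 base f0 sL.
have H2 := @crossing_fields R p nu q (D / 8) S f' p1 nu1 qE Sp D80 base.
clear base Sp qE D8 D80.
have {}H1 : (exists x0, [/\ 0 < x0 < 1, neumann_field p nu f x0 &
     neumann_field p nu f' (1 - x0)]) \/ neumann_field p nu f' (1 - 1 / 2).
  apply: H1 => a x0 x00 La x y x78 xy y1.
  apply: le_trans (concave_steepening sh sphi h0 fE z58 tan x00 La x78 xy y1) _.
  by apply: ler_wpM2r; lra.
have {}H2 : (exists x0, [/\ 0 < x0 < 1, neumann_field p nu f' x0 &
     neumann_field p nu f (1 - x0)]) \/ neumann_field p nu f (1 - 1 / 2).
  rewrite -(rr f); apply: H2.
  - by move=> x x01; apply: f0; lra.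
  - exact: (slopes_nonincreasing_onem sL).
  move=> a x0 x00 La x y x78 xy y1.
  have h0' x' : 0 < x' < 1 -> 0 < h' x' by move=> x01; apply: h0; lra.
  have fE' x' : 0 < x' < 1 -> ln (f' x') = ln (h' x') + phi' x'.
    by move=> x01; apply: fE; lra.
  have z58' : 1 / 2 < 1 - z' < 5 / 8 by lra.
  have zz : 1 - (1 - z') = z' by ring.
  have tanr u : 0 < u < 1 -> h' u <= h' (1 - z') + (- d') * (u - (1 - z')).
    move=> u01; have := tan' (1 - u) (ltac:(lra)).
    by rewrite /h' zz; lra.
  apply: le_trans (concave_steepening (slopes_nonincreasing_onem sh)
    (slopes_nonincreasing_onem sphi) h0' fE' z58' tanr x00 La x78 xy y1) _.
  apply: ler_wpM2r; first lra.
  by rewrite zz mulNr sqrrN; lra.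
case: H1 => // H1; case: H2 => H2.
  case: H2 => x0 [x01 F1 F2]; exists (1 - x0); split; [lra|exact: F2|].
  by rewrite (_ : 1 - (1 - x0) = x0); [|ring].
exists (1 / 2); split; [lra| |exact: H1].
by rewrite (_ : 1 / 2 = 1 - 1 / 2); [|lra].
Qed.
End two_fields.

(** * Cosecant and the total Riccati time *)

Definition cot (R : realType) (x : R) : R := cos x / sin x.

Section cotangent.
Context {R : realType}.

Lemma mul_cos_le_sin (x : R) : 0 <= x <= pi / 2 -> x * cos x <= sin x.
Proof.
move=> /andP[x0 xp].
have dm (t : R) : is_derive t 1 (fun u : R => u * cos u) (cos t - t * sin t).
  have d : is_derive t 1 (id \* cos) (t *: (- sin t) + cos t *: 1).
    by exact: is_deriveM.
  by apply: is_derive_eq d _; rewrite /GRing.scale/=; ring.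
have := @le_derive_increment R (fun u => u * cos u) (fun t => cos t - t * sin t) sin cos
  0 x x0.
rewrite sin0 mul0r !subr0; apply.
- by apply: continuous_subspaceT => t; exact: is_derive_continuous (dm t).
- by apply: continuous_subspaceT => t; exact: is_derive_continuous (is_derive_sin t).
move=> t /andP[t0 tx]; rewrite gerBl mulr_ge0 ?ltW//.
by apply: sin_gt0_pihalf; rewrite t0 (lt_le_trans tx).
Qed.

(** Derivatives are compared: [1 / sin^2 = 1 + cot^2 <= 1 + 1 / t^2]. *)
Lemma cot_increment_le (a b : R) : 0 < a -> a <= b -> b <= pi / 2 ->
  cot a - cot b <= a^-1 - b^-1 + (b - a).
Proof.
move=> a0 ab bp.
have sp t : a <= t <= b -> [/\ 0 < t, t <= pi / 2 & 0 < sin t].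
  move=> /andP[at_ tb]; have t0 := lt_le_trans a0 at_; have tp := le_trans tb bp.
  split=> //; apply: sin_gt0_pi; rewrite t0 (le_lt_trans tp)//.
  by have := pi_gt0 R; lra.
have dF (t : R) : a <= t <= b -> is_derive t 1 (fun u : R => u^-1 - u) (- t ^- 2 - 1).
  move=> /sp[t0 _ _].
  have d : is_derive t 1 ((fun u : R => (id u)^-1) - id) (- (id t) ^- 2 *: 1 - 1).
    by apply: is_deriveB; apply: is_deriveV; rewrite gt_eqF.
  by apply: is_derive_eq d _; rewrite /GRing.scale/=; ring.
have dG (t : R) : a <= t <= b -> is_derive t 1 (@cot R) (- (sin t) ^- 2).
  move=> /sp[_ _ s0].
  have d : is_derive t 1 (cos \* (fun u => (sin u)^-1))
     (cos t *: (- (sin t) ^- 2 *: cos t) + (sin t)^-1 *: - sin t).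
    by apply: is_deriveM; apply: is_deriveV; rewrite gt_eqF.
  apply: is_derive_eq d _; rewrite /GRing.scale/=.
  have := cos2Dsin2 t => E.
  apply: (@etrans _ _ (- (cos t ^+ 2 + sin t ^+ 2) / sin t ^+ 2)); last first.
    by rewrite E mulN1r.
  by field; rewrite gt_eqF.
have := @le_derive_increment R (fun u => u^-1 - u) (fun t => - t ^- 2 - 1) (@cot R)
  (fun t => - (sin t) ^- 2) a b ab.
move=> H; have {}H : b^-1 - b - (a^-1 - a) <= cot b - cot a.
  apply: H.
  - apply: derivable_within_continuous => t; rewrite in_itv/= => tab.
    by have [] := dF t tab.
  - apply: derivable_within_continuous => t; rewrite in_itv/= => tab.
    by have [] := dG t tab.
  - by move=> t /andP[t1 t2]; apply: dF; rewrite !ltW.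
  - by move=> t /andP[t1 t2]; apply: dG; rewrite !ltW.
  move=> t /andP[t1 t2]; have [|t0 tp s0] := sp t; first by rewrite !ltW.
  rewrite -opprD lerN2.
  have := @mul_cos_le_sin t; rewrite ltW// tp => /(_ isT) h.
  have c0 : 0 <= cos t.
    by apply: cos_ge0_pihalf; rewrite tp andbT; have := pi_gt0 R; lra.
  have -> : sin t ^- 2 = (cos t / sin t) ^+ 2 + 1.
    have := cos2Dsin2 t => E.
    have -> : sin t ^- 2 = (cos t ^+ 2 + sin t ^+ 2) / sin t ^+ 2.
      by rewrite E mul1r.
    by field; rewrite gt_eqF.
  rewrite lerD2r -exprVn ler_sqr ?nnegrE; [|by rewrite divr_ge0// ltW|by rewrite invr_ge0 ltW].
  by rewrite ler_pdivrMr// mulrC ler_pdivlMr// mulrC.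
by lra.
Qed.

Lemma cot_half (y : R) : 0 < y < pi / 2 ->
  cot y = (cot (y / 2) - cot (pi / 2 - y / 2)) / 2.
Proof.
move=> y01; have p0 := pi_gt0 R.
have s0 : 0 < sin (y / 2) by apply: sin_gt0_pihalf; lra.
have c0 : 0 < cos (y / 2) by apply: cos_gt0_pihalf; lra.
rewrite /cot.
have -> : sin (pi / 2 - y / 2) = cos (y / 2).
  by rewrite sinB sin_pihalf cos_pihalf; ring.
have -> : cos (pi / 2 - y / 2) = sin (y / 2).
  by rewrite cosB sin_pihalf cos_pihalf; ring.
have yE : y = y / 2 + y / 2 by lra.
rewrite [in sin y]yE [in cos y]yE sinD cosD.
rewrite [cos (y / 2) * sin (y / 2)]mulrC -mulr2n.
by field; rewrite !gt_eqF.
Qed.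

Lemma alternating_sum_le (F G : nat -> R) (c : R) (n : nat) :
  (forall j, (j < n)%N -> F j.*2 - F j.*2.+1 <= G j.*2 - G j.*2.+1 + c) ->
  \sum_(0 <= k < n.*2) (-1) ^+ k * F k <= \sum_(0 <= k < n.*2) (-1) ^+ k * G k + n%:R * c.
Proof.
elim: n => [|n IH] H; first by rewrite !big_geq// mul0r addr0.
rewrite doubleS !big_nat_recr//= exprS -signr_odd odd_double expr0 mulN1r !mul1r.
have := IH (fun j jn => H j (ltnW jn)); have := H n (ltnSn n).
by rewrite -natr1; lra.
Qed.
End cotangent.

Section cosecant.
Context {R : realType}.

(** For [N] a power of 2 this is exactly [2 N / sin x]. Replacing [cot y] by [1 / y] turns it into
    [2 N] times a partial sum of the partial fraction series of the cosecant. *)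
Let csc_sum (x : R) (N : nat) := \sum_(0 <= k < N) (-1) ^+ k *
  (cot ((x + k%:R * pi) / (2 * N%:R)) + cot (((k%:R + 1) * pi - x) / (2 * N%:R))).

(* Each step applies [cot y = (cot (y / 2) - cot (pi / 2 - y / 2)) / 2] to all terms. *)
Let csc_sum_double (x : R) (N : nat) : 0 < x < pi -> (0 < N)%N ->
  csc_sum x (N + N) = 2 * csc_sum x N.
Proof.
move=> /andP[x0 xp] N0; have p0 := pi_gt0 R.
rewrite /csc_sum (@big_cat_nat _ _ _ N)//=; last by rewrite leq_addr.
have shift (F : nat -> R) : \sum_(N <= k < N + N) F k = \sum_(0 <= k < N) F (k + N)%N.
  by rewrite -{1}[N]add0n big_addn addnK.
rewrite shift [X in _ + X]big_nat_rev/= -big_split/= mulr_sumr.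
apply: eq_big_nat => k /andP[_ kN]; rewrite add0n.
have NR : 0 < N%:R :> R by rewrite ltr0n.
have kR : k%:R + 1 <= N%:R :> R by rewrite natr1 ler_nat.
(* The upper half of the sum is reversed, so index [k] meets [2 N - 1 - k]: the signs are opposite
   and the arguments complementary in [pi / 2], as [cot_half] requires. *)
have -> : (-1) ^+ (N - k.+1 + N) = - (-1) ^+ k :> R.
  rewrite -signr_odd -[in RHS]signr_odd oddD oddB//=.
  by case: (odd N); case: (odd k); rewrite /= ?expr0 ?expr1 ?opprK.
rewrite (natrD _ N N) (natrD _ (N - k.+1) N) natrB// -(natr1 k).
have k0 : 0 <= k%:R :> R by [].
have kp : 0 <= k%:R * pi :> R by rewrite mulr_ge0// ltW.
have kNp : (k%:R + 1) * pi <= N%:R * pi :> R by rewrite ler_pM2r.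
have bnd (u : R) : 0 < u -> u < N%:R * pi -> 0 < u / (2 * N%:R) < pi / 2.
  move=> u0 uN; rewrite divr_gt0 ?mulr_gt0//= ltr_pdivrMr ?mulr_gt0//.
  by rewrite mulrA divfK ?pnatr_eq0// mulrC.
have hA : 0 < x + k%:R * pi by lra.
have hA' : x + k%:R * pi < N%:R * pi by lra.
have hB : 0 < (k%:R + 1) * pi - x by lra.
have hB' : (k%:R + 1) * pi - x < N%:R * pi by lra.
rewrite (cot_half (bnd _ hA hA')) (cot_half (bnd _ hB hB')).
set a := cot _; set b := cot _; set c := cot _; set d := cot _.
set a' := cot _; set d' := cot _; set b' := cot _; set c' := cot _.
have -> : a = a' by rewrite /a /a'; congr cot; field; rewrite !gt_eqF ?addr_gt0.
have -> : b = b' by rewrite /b /b'; congr cot; field; rewrite !gt_eqF ?addr_gt0.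
have -> : c = c' by rewrite /c /c'; congr cot; field; rewrite !gt_eqF ?addr_gt0.
have -> : d = d' by rewrite /d /d'; congr cot; field; rewrite !gt_eqF ?addr_gt0.
by field.
Qed.

Let csc_sumE (x : R) (n : nat) : 0 < x < pi ->
  2 * (2 ^ n)%:R * (sin x)^-1 = csc_sum x (2 ^ n).
Proof.
move=> x01; have p0 := pi_gt0 R.
elim: n => [|n IH]; last first.
  by rewrite expnS mul2n -addnn csc_sum_double ?expn_gt0// natrD -IH; ring.
have s0 : 0 < sin (x / 2) by apply: sin_gt0_pihalf; lra.
have c0 : 0 < cos (x / 2) by apply: cos_gt0_pihalf; lra.
rewrite /csc_sum expn0 big_nat1 expr0 mul1r mul0r addr0 add0r mul1r !mulr1 /cot.
have -> : (pi - x) / 2 = pi / 2 - x / 2 by rewrite mulrBl.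
have -> : sin (pi / 2 - x / 2) = cos (x / 2).
  by rewrite sinB sin_pihalf cos_pihalf; ring.
have -> : cos (pi / 2 - x / 2) = sin (x / 2).
  by rewrite cosB sin_pihalf cos_pihalf; ring.
have xE : x = x / 2 + x / 2 by lra.
rewrite [in sin x]xE sinD [cos (x / 2) * sin (x / 2)]mulrC -mulr2n.
have E := cos2Dsin2 (x / 2).
apply: (@etrans _ _ ((cos (x / 2) ^+ 2 + sin (x / 2) ^+ 2) / (sin (x / 2) * cos (x / 2)))).
  by rewrite E; field; rewrite !gt_eqF.
by field; rewrite !gt_eqF.
Qed.

(** With [M = 2 ^ n], consecutive terms are paired and each of the two cotangent differences costs
    [pi / (4 M)] by [cot_increment_le]. The [M] pairs cost [pi / 2] in all, and division by [4 M]
    gives the error. *)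
Lemma csc_le_alternating (x : R) (n : nat) : 0 < x < pi ->
  (sin x)^-1 <= \sum_(0 <= k < (2 ^ n).*2) (-1) ^+ k *
    ((x + k%:R * pi)^-1 + ((k%:R + 1) * pi - x)^-1) + pi / (8 * (2 ^ n)%:R).
Proof.
move=> x01; have p0 := pi_gt0 R; have /andP[x0 xp] := x01.
pose M := (2 ^ n)%N; have M0 : 0 < M%:R :> R by rewrite ltr0n expn_gt0.
have := csc_sumE n.+1 x01; rewrite expnS mul2n -/M /csc_sum -muln2 natrM => E.
pose F k : R := cot ((x + k%:R * pi) / (2 * (M%:R * 2))) +
   cot (((k%:R + 1) * pi - x) / (2 * (M%:R * 2))).
pose G k : R := 4 * M%:R * ((x + k%:R * pi)^-1 + ((k%:R + 1) * pi - x)^-1).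
have D0 : 0 < 2 * (M%:R * 2) :> R by rewrite !mulr_gt0.
have := @alternating_sum_le R F G (2 * (pi / (4 * M%:R))) M.
move=> H; have {}H := H _; have {}H : 2 * (M%:R * 2) * (sin x)^-1 <=
   \sum_(0 <= k < M.*2) (-1) ^+ k * G k + M%:R * (2 * (pi / (4 * M%:R))).
  rewrite E -muln2; rewrite -muln2 in H; apply: H => j jM.
  have j2R : (j.*2)%:R + 2 <= M%:R * 2 :> R.
    by move: jM; rewrite -(ler_nat R) -(natr1 j) -muln2 natrM; lra.
  have kp : 0 <= (j.*2)%:R * pi :> R by rewrite mulr_ge0// ltW.
  have jp : ((j.*2)%:R + 2) * pi <= M%:R * 2 * pi :> R by rewrite ler_pM2r.
  have bnd (u : R) : u < M%:R * 2 * pi -> u / (2 * (M%:R * 2)) <= pi / 2.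
    move=> uN; rewrite ler_pdivrMr//; lra.
  have inc (u v : R) : 0 < u -> v = u + pi -> v < M%:R * 2 * pi ->
    cot (u / (2 * (M%:R * 2))) - cot (v / (2 * (M%:R * 2))) <=
    4 * M%:R * (u^-1 - v^-1) + pi / (4 * M%:R).
    move=> u0 uv vM; have v0 : 0 < v by lra.
    apply: le_trans (cot_increment_le _ _ (bnd _ vM)) _.
    - by rewrite divr_gt0.
    - by rewrite ler_pM2r ?invr_gt0//; lra.
    rewrite le_eqVlt; apply/orP; left; apply/eqP.
    by rewrite !invf_div {2}uv; field; rewrite !gt_eqF.
  rewrite /F /G -(natr1 j.*2).
  have i1 := inc (x + (j.*2)%:R * pi) (x + ((j.*2)%:R + 1) * pi) (ltac:(lra)) (ltac:(ring)) (ltac:(lra)).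
  have i2 := inc (((j.*2)%:R + 1) * pi - x) (((j.*2)%:R + 1 + 1) * pi - x) (ltac:(lra)) (ltac:(ring)) (ltac:(lra)).
  lra.
have -> : 8 * M%:R = 2 * (2 * (M%:R * 2)) :> R by ring.
rewrite -(ler_pM2l D0); apply: le_trans H _.
rewrite mulrDr mulr_sumr le_eqVlt; apply/orP; left; apply/eqP; congr (_ + _).
  by rewrite -muln2; apply: eq_bigr => k _; rewrite /G; ring.
by field; rewrite gt_eqF.
Qed.
End cosecant.

Section csc_integral.
Context {R : realType}.

Lemma alternating_geometric (y : R) (n : nat) : 0 <= y ->
  \sum_(0 <= k < n.*2) (-1) ^+ k * y ^+ k <= (1 + y)^-1.
Proof.
move=> y0; have y1 : 0 < 1 + y by lra.
suff E : (\sum_(0 <= k < n.*2) (-1) ^+ k * y ^+ k) * (1 + y) = 1 - y ^+ n.*2.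
  by rewrite -[leRHS]mul1r ler_pdivlMr// E gerBl exprn_ge0.
elim: n => [|n IH]; first by rewrite big_geq// mul0r expr0 subrr.
rewrite doubleS !big_nat_recr//= !mulrDl IH !exprS -signr_odd odd_double expr0.
by ring.
Qed.

Lemma is_derive_bigsum (F F' : nat -> R -> R) (n : nat) (t : R) :
  (forall k, is_derive t 1 (F k) (F' k t)) ->
  is_derive t 1 (fun u => \sum_(0 <= k < n) F k u) (\sum_(0 <= k < n) F' k t).
Proof.
move=> dF; elim: n => [|n IH].
  have -> : (fun u : R => \sum_(0 <= k < 0) F k u) = cst 0.
    by apply/funext => u; rewrite big_geq.
  by rewrite big_geq//; exact: is_derive_cst.
have -> : (fun u : R => \sum_(0 <= k < n.+1) F k u) = (fun u => \sum_(0 <= k < n) F k u) + F n.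
  by apply/funext => u; rewrite big_nat_recr.
by rewrite big_nat_recr//=; exact: is_deriveD.
Qed.

Lemma is_derive_powR_div (e t : R) : e != 0 -> 0 < t ->
  is_derive t 1 (fun u => u `^ e / e) (t `^ (e - 1)).
Proof.
move=> e0 t0.
have d := @is_derive1_powR R e t t0.
have := is_deriveZ e^-1 d; rewrite /GRing.scale/= mulrA mulVf// mul1r.
rewrite (_ : (fun u => u `^ e / e) = e^-1 \*: (@powR R)^~ e)//.
by apply/funext => u; rewrite /= mulrC.
Qed.

(* The integrand is expanded in powers of [t `^ q] on [[0, 1]] and of its inverse
   on [[1, S]]. *)
Lemma increment_ge_alternating (q S : R) (G : R -> R) (n : nat) : 1 < q -> 1 <= S ->
  continuous G -> (forall t : R, 0 < t -> is_derive t 1 G (1 + t `^ q)^-1) ->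
  \sum_(0 <= k < n.*2) (-1) ^+ k * ((k%:R * q + 1)^-1 + ((k%:R + 1) * q - 1)^-1) <=
  G S - G 0 + n.*2%:R * (S `^ (1 - q) / (q - 1)).
Proof.
move=> q1 S1 cG dG.
have e0 k : 0 < k%:R * q + 1 by rewrite ltr_wpDl// mulr_ge0//; lra.
have kq (k : nat) : 0 <= k%:R * q by rewrite mulr_ge0//; lra.
have e1 (k : nat) : 0 < (k%:R + 1) * q - 1 by rewrite mulrDl mul1r; have := kq k; lra.
have part0 : \sum_(0 <= k < n.*2) (-1) ^+ k * (k%:R * q + 1)^-1 <= G 1 - G 0.
  (* The absolute value makes the antiderivatives continuous on the whole line, in particular at
     0. *)
  pose F (k : nat) (t : R) := (-1) ^+ k * (`|t| `^ (k%:R * q + 1) / (k%:R * q + 1)).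
  pose F' (k : nat) (t : R) := (-1) ^+ k * (t `^ q) ^+ k.
  have dF (k : nat) (t : R) : 0 < t -> is_derive t 1 (F k) (F' k t).
    move=> t0; have d := @is_derive_powR_div (k%:R * q + 1) t (lt0r_neq0 (e0 k)) t0.
    have {d}d := is_deriveZ ((-1) ^+ k) d.
    have -> : F' k t = (-1) ^+ k *: t `^ (k%:R * q + 1 - 1).
      by rewrite addrK /F' mulrC mulrC [k%:R * q]mulrC powRrM powR_mulrn ?powR_ge0.
    apply: near_eq_is_derive d; near=> u.
    rewrite /F /GRing.scale/= ger0_norm//; apply/ltW; near: u.
    exact: lt_nbhsr.
  have -> : \sum_(0 <= k < n.*2) (-1) ^+ k * (k%:R * q + 1)^-1 =
     (\sum_(0 <= k < n.*2) F k 1) - (\sum_(0 <= k < n.*2) F k 0).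
    rewrite (_ : \sum_(0 <= k < n.*2) F k 0 = 0) ?subr0; last first.
      rewrite big1// => k _; rewrite /F normr0 powR0 ?mul0r ?mulr0//.
      exact: lt0r_neq0.
    by apply: eq_bigr => k _; rewrite /F normr1 powR1 mul1r.
  apply: (@le_derive_increment R (fun t => \sum_(0 <= k < n.*2) F k t)
    (fun t => \sum_(0 <= k < n.*2) F' k t) G (fun t => (1 + t `^ q)^-1) 0 1) => //.
  - apply: continuous_subspaceT => t.
    elim: n.*2 => [|j IH].
      rewrite (_ : (fun _ => _) = cst 0); first exact: cst_continuous.
      by apply/funext => u; rewrite big_geq.
    rewrite (_ : (fun u => \sum_(0 <= k < j.+1) F k u) =
       (fun u => \sum_(0 <= k < j) F k u) \+ F j); last first.
      by apply/funext => u; rewrite big_nat_recr.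
    apply: continuousD => //.
    apply: continuousM; first exact: cst_continuous.
    apply: continuousM; last exact: cst_continuous.
    exact: continuous_norm_powR.
  - exact: continuous_subspaceT.
  - by move=> t /andP[t0 _]; apply: is_derive_bigsum => k; exact: dF.
  - by move=> t /andP[t0 _]; exact: dG.
  - by move=> t /andP[t0 _]; apply: alternating_geometric; exact: powR_ge0.
have part1 : \sum_(0 <= k < n.*2) (-1) ^+ k * ((k%:R + 1) * q - 1)^-1 <=
    G S - G 1 + n.*2%:R * (S `^ (1 - q) / (q - 1)).
  pose e (k : nat) := 1 - (k%:R + 1) * q.
  have en (k : nat) : e k != 0 by rewrite lt_eqF// /e; have := e1 k; lra.
  pose F (k : nat) (t : R) := (-1) ^+ k * (t `^ e k / e k).
  pose F' (k : nat) (t : R) := (-1) ^+ k * t `^ (- ((k%:R + 1) * q)).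
  have dF (k : nat) (t : R) : 0 < t -> is_derive t 1 (F k) (F' k t).
    move=> t0; have d := @is_derive_powR_div (e k) t (en k) t0.
    have {d}d := is_deriveZ ((-1) ^+ k) d.
    have -> // : F' k t = (-1) ^+ k *: t `^ (e k - 1).
    by rewrite /F' /e; congr (_ * _ `^ _); ring.
  have dFs (t : R) : 0 < t -> is_derive t 1 (fun t => \sum_(0 <= k < n.*2) F k t)
      (\sum_(0 <= k < n.*2) F' k t).
    by move=> t0; apply: is_derive_bigsum => k; exact: dF.
  have H : (\sum_(0 <= k < n.*2) F k S) - (\sum_(0 <= k < n.*2) F k 1) <= G S - G 1.
    apply: (@le_derive_increment R (fun t => \sum_(0 <= k < n.*2) F k t)
      (fun t => \sum_(0 <= k < n.*2) F' k t) G (fun t => (1 + t `^ q)^-1) 1 S) => //.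
    - apply: derivable_within_continuous => t; rewrite in_itv/= => /andP[t1 _].
      by have [] := dFs t (lt_le_trans ltr01 t1).
    - exact: continuous_subspaceT.
    - by move=> t /andP[t0 _]; apply: dFs; exact: lt_trans t0.
    - by move=> t /andP[t0 _]; apply: dG; exact: lt_trans t0.
    move=> t /andP[t1 _]; have t0 : 0 < t by exact: lt_trans t1.
    have y0 : 0 < t `^ q by exact: powR_gt0.
    have := @alternating_geometric (t `^ q)^-1 n; rewrite invr_ge0 ltW// => /(_ isT).
    move=> A; have {}A := ler_wpM2r (ltW (powR_gt0 (- q) t0)) A.
    apply: le_trans (le_trans _ A) _; rewrite le_eqVlt; apply/orP; left; apply/eqP.
      rewrite mulr_suml; apply: eq_bigr => k _; rewrite /F' -mulrA; congr (_ * _).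
      rewrite exprVn -powR_mulrn ?powR_ge0// -powRrM -powRN -powRD; last first.
        by rewrite (gt_eqF t0) implybT.
      by congr (_ `^ _); ring.
    by rewrite powRN; field; rewrite !gt_eqF//; lra.
  have F1 : - (\sum_(0 <= k < n.*2) F k 1) =
     \sum_(0 <= k < n.*2) (-1) ^+ k * ((k%:R + 1) * q - 1)^-1.
    rewrite -sumrN; apply: eq_bigr => k _; rewrite /F powR1 mul1r /e -opprB invrN.
    by rewrite mulrN opprK.
  (* Each of the [2 n] boundary terms at [S] is at most the one of index 0 in absolute value. *)
  have FS : - (\sum_(0 <= k < n.*2) F k S) <= n.*2%:R * (S `^ (1 - q) / (q - 1)).
    rewrite -sumrN -[n.*2 in leRHS]subn0 mulr_natl -sumr_const_nat.
    apply: ler_sum => k _; rewrite /F.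
    apply: le_trans (ler_norm _) _; rewrite normrN !normrM normrX normrN1 expr1n mul1r.
    rewrite ger0_norm ?powR_ge0// normfV.
    have nE : `|e k| = (k%:R + 1) * q - 1.
      by rewrite /e ltr0_norm ?opprB//; have := e1 k; lra.
    rewrite nE; have := kq k; have := e1 k; rewrite mulrDl mul1r => e1k kqk.
    apply: ler_pM; [exact: powR_ge0|by rewrite invr_ge0 ltW| |].
      by rewrite /e; apply: ler_powR => //; rewrite mulrDl mul1r; lra.
    by rewrite lef_pV2 ?posrE//; lra.
  by lra.
under eq_bigr do rewrite mulrDr.
by rewrite big_split/=; lra.
Unshelve. all: by end_near.
Qed.
End csc_integral.

Section riccati_time_csc.
Context {R : realType}.

(** The lower half of the classical value [(pi / q) / sin (pi / q)] for the integral of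
    [1 / (1 + t^q)] over the half-line: the same alternating sum approximates both sides. *)
Lemma increment_ge_csc (q eps : R) : 1 < q -> 0 < eps -> exists S0 : R, 1 <= S0 /\
  forall (G : R -> R) (S : R), S0 <= S -> continuous G ->
  (forall t : R, 0 < t -> is_derive t 1 G (1 + t `^ q)^-1) ->
  pi / q / sin (pi / q) - eps <= G S - G 0.
Proof.
move=> q1 eps0; have p0 := pi_gt0 R; have q0 : 0 < q by lra.
pose x : R := pi / q.
have x0 : 0 < x by rewrite divr_gt0.
have xp : x < pi by rewrite ltr_pdivrMr// ltr_pMr.
have xq : x * q = pi by rewrite divfK// gt_eqF.
(* As [2 ^ n > n], this makes the cosecant error at most [eps / 2]. *)
pose n := Num.bound (x * pi / (4 * eps)).
have nn : x * pi / (8 * (2 ^ n)%:R) <= eps / 2.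
  have h1 : x * pi / (4 * eps) < n%:R.
    by apply: archi_boundP; rewrite divr_ge0// mulr_ge0// ltW.
  have h2 : n%:R <= (2 ^ n)%:R :> R by rewrite ler_nat ltnW// ltn_expl.
  have h3 : 0 < (2 ^ n)%:R :> R by rewrite ltr0n expn_gt0.
  rewrite ler_pdivrMr ?mulr_gt0//.
  move: h1; rewrite ltr_pdivrMr ?mulr_gt0// => h1.
  have h4 : n%:R * eps <= (2 ^ n)%:R * eps by rewrite ler_pM2r.
  by lra.
pose N : R := ((2 ^ n).*2)%:R.
have N0 : 0 < N by rewrite ltr0n double_gt0 expn_gt0.
(* Once [S^(q-1) >= c], the boundary terms at [S] sum to at most [eps / 2]. *)
pose c := 2 * N / ((q - 1) * eps).
have qe0 : 0 < (q - 1) * eps by rewrite mulr_gt0// subr_gt0.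
have c0 : 0 < c by rewrite divr_gt0// mulr_gt0.
exists (Num.max 1 (c `^ (q - 1)^-1)); split; first by rewrite le_max lexx.
move=> G S; rewrite ge_max => /andP[S1 cS] cG dG.
have Sc : c <= S `^ (q - 1).
  have := ge0_ler_powR (r := q - 1) (ltac:(lra)) _ _ cS.
  rewrite !nnegrE powR_ge0 -powRrM mulVf ?powRr1ltW//; last by rewrite gt_eqF//; lra.
  by rewrite powRr1 ?(ltW c0)//; apply => //; lra.
have err : N * (S `^ (1 - q) / (q - 1)) <= eps / 2.
  rewrite -opprB powRN mulrA ler_pdivrMr ?subr_gt0// ler_pdivrMr; last first.
    exact: lt_le_trans Sc.
  have h0 : 0 < (q - 1) * (eps / 2) by rewrite mulr_gt0 ?subr_gt0// divr_gt0.
  have := ler_wpM2l (ltW h0) Sc.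
  have -> : (q - 1) * (eps / 2) * c = N by rewrite /c; field; rewrite !gt_eqF ?subr_gt0.
  by lra.
have := increment_ge_alternating (2 ^ n) q1 S1 cG dG; rewrite -/N => H.
have x01 : 0 < x < pi by rewrite x0.
have := ler_wpM2l (ltW x0) (csc_le_alternating n x01); rewrite mulrDr mulr_sumr.
have -> : \sum_(0 <= i < (2 ^ n).*2) x * ((-1) ^+ i * ((x + i%:R * pi)^-1 + ((i%:R + 1) * pi - x)^-1))
   = \sum_(0 <= k < (2 ^ n).*2) (-1) ^+ k * ((k%:R * q + 1)^-1 + ((k%:R + 1) * q - 1)^-1).
  apply: eq_bigr => k _; rewrite -xq mulrCA; congr (_ * _).
  have -> : x + k%:R * (x * q) = x * (k%:R * q + 1) by ring.
  have -> : (k%:R + 1) * (x * q) - x = x * ((k%:R + 1) * q - 1) by ring.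
  by rewrite (invfM x) (invfM x) mulrDr !mulVKf ?gt_eqF.
by rewrite -/x; lra.
Qed.

(** The substitution [s = c t] with [(p - 1) c^q = nu] reduces the speed to [nu (1 + t^q)]; since
    [pi / q = pi - pi / p], the sine is that of [pi_p]. *)
Lemma riccati_time_csc (p nu q eps : R) : 1 < p -> 1 <= nu -> q = p / (p - 1) -> 0 < eps ->
  exists S, (16 * p)^-1 < S /\
  pi_p p / nu `^ p^-1 - eps <= 2 * riccati_time p nu q 0 0 S.
Proof.
move=> p1 nu1 qE eps0; have q1 : 1 < q by apply: q_gt1 qE.
have p0 : 0 < p by lra.
have pm0 : 0 < p - 1 by lra.
have nu0 : 0 < nu by lra.
have q0 : 0 < q by lra.
pose c := (nu / (p - 1)) `^ q^-1.
have c0 : 0 < c by rewrite powR_gt0// divr_gt0.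
have cq : c `^ q = nu / (p - 1).
  by rewrite -powRrM mulVf ?gt_eqF// powRr1// ltW// divr_gt0.
pose g s := (riccati_speed p nu q 0 0 s)^-1.
have g0 s : 0 < riccati_speed p nu q 0 0 s by exact: riccati_speed0_gt0.
have cg : continuous g.
  by move=> s; apply: cvgV; [rewrite gt_eqF|exact: continuous_riccati_speed].
have [H [dH iH]] := primitive_exists cg.
pose e := eps * nu / (2 * c).
have e0 : 0 < e by rewrite divr_gt0 ?mulr_gt0.
have [S0 [S01 HS]] := increment_ge_csc q1 e0.
have cnu : c / nu = (p - 1) `^ p^-1 / (p - 1) / nu `^ p^-1.
  have qV : q^-1 = 1 - p^-1 by rewrite qE invf_div mulrBl divff ?gt_eqF// mul1r.
  rewrite /c qV powRM ?invr_ge0 ?(ltW nu0) ?(ltW pm0)//.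
  rewrite !gt0_powRD ?invr_gt0// !powRN !powRr1 ?invr_ge0 ?(ltW nu0) ?(ltW pm0)//.
  have -> : (p - 1)^-1 `^ p^-1 = ((p - 1) `^ p^-1)^-1.
    by rewrite -powR_inv1 ?(ltW pm0)// -powRrM mulN1r powRN.
  by field; rewrite !gt_eqF ?powR_gt0.
pose S' := Num.max S0 ((8 * p * c)^-1).
have S'c : (16 * p)^-1 < c * S'.
  have h : (8 * p)^-1 <= c * S'.
    rewrite -ler_pdivrMl// /S' le_max -invfM; apply/orP; right.
    by rewrite [c * _]mulrC.
  by apply: lt_le_trans h; rewrite ltf_pV2 ?posrE ?mulr_gt0// ltr_pM2r// ltr_nat.
exists (c * S'); split=> //.
have tE : riccati_time p nu q 0 0 (c * S') = H (c * S') - H 0.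
  rewrite /riccati_time /Rintegral iH//.
  by rewrite mulr_ge0 ?(ltW c0)// le_max (le_trans ler01 S01).
rewrite tE.
have := HS (fun t => nu / c * H (c * t)) S'; rewrite mulr0 => HH.
have {}HH : pi / q / sin (pi / q) - e <= nu / c * H (c * S') - nu / c * H 0.
  have dG (t : R) : is_derive t 1 (fun u => nu / c * H (c * u)) (nu * g (c * t)).
    have dl : is_derive t 1 (fun u : R => c * u) c.
      by have := is_deriveZ c (is_derive_id t 1); rewrite /GRing.scale/= mulr1.
    have := is_deriveZ (nu / c) (is_derive1_comp (dH (c * t)) dl).
    rewrite /GRing.scale/= => d; apply: is_derive_eq d _.
    by rewrite mulrCA divfK ?gt_eqF// mulrC.
  apply: HH.
  - by rewrite /S' le_max lexx.
  - by move=> t; exact: is_derive_continuous (dG t).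
  move=> t t0; apply: is_derive_eq (dG t) _.
  rewrite /g /riccati_speed !mul0r subr0 addr0 ger0_norm ?mulr_ge0 ?ltW// powRM ?ltW// cq.
  rewrite (_ : nu + _ = nu * (1 + t `^ q)); last by field; rewrite gt_eqF.
  by rewrite invfM mulVKf// gt_eqF.
have sE : sin (pi / q) = sin (pi / p).
  have -> : pi / q = pi - pi / p by rewrite qE; field; rewrite !gt_eqF.
  by rewrite sinB sinpi cospi; ring.
have s0 : 0 < sin (pi / p).
  have p0' := pi_gt0 R.
  by apply: sin_gt0_pi; rewrite divr_gt0//= ltr_pdivrMr// ltr_pMr.
have cn0 : 0 < 2 * (c / nu) by rewrite mulr_gt0// divr_gt0.
have := ler_wpM2l (ltW cn0) HH; rewrite mulrBr.
have -> : 2 * (c / nu) * e = eps by rewrite /e; field; rewrite !gt_eqF.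
have -> : 2 * (c / nu) * (pi / q / sin (pi / q)) = pi_p p / nu `^ p^-1.
  rewrite cnu sE /pi_p qE; field; rewrite !gt_eqF// powR_gt0//.
have -> : 2 * (c / nu) * (nu / c * H (c * S') - nu / c * H 0) = 2 * (H (c * S') - H 0).
  by field; rewrite !gt_eqF.
by [].
Qed.
End riccati_time_csc.

(** * The lower bound for a product of concave type *)

Section concave_product.
Context {R : realType}.

Lemma sin_le (x : R) : 0 <= x -> sin x <= x.
Proof.
move=> x0.
have := @le_derive_increment R sin cos id (fun=> 1) 0 x x0.
rewrite sin0 !subr0; apply.
- by apply: continuous_subspaceT; exact: continuous_sin.
- by apply: continuous_subspaceT => t; exact: cvg_id.
by move=> t _; exact: cos_le1.
Qed.

(** For [p >= 2] this follows from [p sin (pi / p) <= pi]; for [p < 2] from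
    [sin (pi / p) = sin (pi - pi / p)] and [p - 1 <= (p - 1)^(1/p)]. *)
Lemma pi_p_ge2 (p : R) : 1 < p -> 2 <= pi_p p.
Proof.
move=> p1; have p0 : 0 < p by lra.
have pi0 := pi_gt0 R.
have s0 : 0 < sin (pi / p).
  by apply: sin_gt0_pi; rewrite divr_gt0//= ltr_pdivrMr// ltr_pMr.
suff H : p * sin (pi / p) <= pi * (p - 1) `^ p^-1.
  rewrite /pi_p -mulrA -[leLHS]mulr1 ler_pM2l// mulrA ler_pdivlMr ?mul1r//.
  by rewrite mulr_gt0.
have [p2|p2] := leP 2 p.
  have h1 : 1 <= (p - 1) `^ p^-1.
    rewrite -[leLHS](powRr0 (p - 1)); apply: ler_powR; first lra.
    by rewrite invr_ge0 ltW.
  have h2 : p * sin (pi / p) <= p * (pi / p).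
    by rewrite ler_pM2l// sin_le// divr_ge0// ltW.
  rewrite [p * (_ / p)]mulrC divfK ?gt_eqF// in h2.
  by apply: le_trans h2 _; rewrite ler_pMr.
have h1 : p - 1 <= (p - 1) `^ p^-1.
  by apply: ger1_powR; [lra|rewrite invf_le1//; lra].
have pE : pi - pi / p = pi * (p - 1) / p by field; rewrite gt_eqF.
have h2 : sin (pi / p) <= pi * (p - 1) / p.
  rewrite -pE; have -> : sin (pi / p) = sin (pi - pi / p).
    by rewrite sinB sinpi cospi; ring.
  by apply: sin_le; rewrite pE divr_ge0 ?mulr_ge0//; lra.
have := ler_wpM2l (ltW p0) h2; rewrite [p * (_ / p)]mulrC divfK ?gt_eqF// => h3.
by apply: le_trans h3 _; rewrite ler_pM2l.
Qed.

Lemma pi_p_powR_ge2 (p : R) : 1 < p -> 2 <= pi_p p `^ p.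
Proof.
move=> p1; have h := pi_p_ge2 p1.
have h1 : 1 <= pi_p p by lra.
by apply: le_trans h _; apply: le1r_powR => //; exact: ltW.
Qed.

(** Here the gain in time becomes a gain in [nu]. When [nu] passes [pi_p ^ p], the slope-0 time
    falls short of 1 by at most [(nu - pi_p^p) / nu < k D / nu], and the condition on [k] keeps this
    below the gain [D / 8 / (c nu^2)]. The strict surplus [y + G - 1] serves as the [eps] of
    [riccati_time_csc]. *)
Lemma riccati_time_base (p nu q k D : R) : 1 < p -> 1 <= nu -> q = p / (p - 1) ->
  0 <= D <= 8 -> 0 <= k -> k * (16 * (6144 * p ^+ 2) * (pi_p p `^ p + 1)) <= 1 ->
  nu < pi_p p `^ p + k * D ->
  exists S, (16 * p)^-1 < S /\
    1 <= 2 * riccati_time p nu q 0 0 S + D / 8 / (6144 * p ^+ 2 * nu ^+ 2).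
Proof.
move=> p1 nu1 qE /andP[D0 D8] k0 kle nulam.
have : 1 <= 6144 * p ^+ 2.
  by apply: mulr_ege1; [rewrite ler1n|rewrite exprn_ege1// ltW].
move: (6144 * p ^+ 2) kle => c kle c1.
have pp := pi_p_ge2 p1; have n2 := pi_p_powR_ge2 p1.
have p0 : 0 < p by lra.
have nu0 : 0 < nu by lra.
have yE : pi_p p / nu `^ p^-1 = (pi_p p `^ p / nu) `^ p^-1.
  rewrite powRM ?powR_ge0 ?invr_ge0 ?ltW// -powRrM mulfV ?gt_eqF// powRr1; last lra.
  by rewrite -[nu^-1]powR_inv1 ?(ltW nu0)// -powRrM mulN1r powRN.
set y := pi_p p / nu `^ p^-1 in yE.
pose G := D / 8 / (c * nu ^+ 2).
have c0 : 0 < c by lra.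
have den0 : 0 < c * nu ^+ 2 by rewrite mulr_gt0 ?exprn_gt0.
have G0 : 0 <= G by rewrite divr_ge0 ?(ltW den0)// divr_ge0.
suff yG : 1 < y + G.
  have e0 : 0 < y + G - 1 by lra.
  have [S [Sp HS]] := riccati_time_csc p1 nu1 qE e0.
  by exists S; split=> //; rewrite -/y in HS; rewrite -/G; lra.
have [nl|nl] := ltP nu (pi_p p `^ p).
  have h : 1 < pi_p p `^ p / nu by rewrite ltr_pdivlMr// mul1r.
  suff : 1 < y by lra.
  rewrite yE (_ : 1 = 1 `^ p^-1); last by rewrite powR1.
  apply: gt0_ltr_powR => //.
  - by rewrite invr_gt0.
  - by rewrite nnegrE; lra.
  - by rewrite nnegrE ltW// (lt_trans ltr01).
have h : 0 < pi_p p `^ p / nu <= 1.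
  by rewrite divr_gt0 ?ler_pdivrMr ?mul1r//; lra.
have h1 : pi_p p `^ p / nu <= y.
  by rewrite yE; apply: ger1_powR => //; rewrite invf_le1// ltW.
have h2 : pi_p p `^ p / nu = 1 - (nu - pi_p p `^ p) / nu.
  by field; rewrite gt_eqF.
suff h3 : (nu - pi_p p `^ p) / nu < G by lra.
have kD : 0 < k * D by lra.
have D0' : 0 < D.
  by rewrite lt0r D0 andbT; apply: contraTN kD => /eqP ->; rewrite mulr0 ltxx.
have kd1 : k * D <= 1.
  have q1 : k * D <= k * 8 by exact: ler_wpM2l.
  have q2 : k * 8 <= k * (16 * c * (pi_p p `^ p + 1)).
    apply: ler_wpM2l => //; rewrite -[leLHS]mulr1; apply: ler_pM => //; last lra.
    by rewrite -[leLHS]mulr1; apply: ler_pM => //; lra.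
  exact: le_trans (le_trans q1 q2) kle.
have nun : nu <= pi_p p `^ p + 1 by lra.
rewrite ltr_pdivrMr//.
apply: (@lt_le_trans _ _ (k * D)); first lra.
have -> : G * nu = D / (8 * c * nu).
  by rewrite /G; field; rewrite !gt_eqF.
rewrite ler_pdivlMr ?mulr_gt0// mulrC mulrA -[leRHS]mul1r; apply: ler_wpM2r => //.
have q3 : k * (8 * c * nu) <= k * (16 * c * (pi_p p `^ p + 1)).
  apply: ler_wpM2l => //; apply: ler_pM => //; last lra.
  - by rewrite mulr_ge0//; lra.
  - by rewrite ltW.
rewrite mulrC; exact: le_trans q3 kle.
Qed.

(** There is one tangency point on each side of [1/2]; the one with the smaller squared logarithmic
    slope is returned as the witness. *)
Lemma mu_p_concave_product (p k : R) (m : nat) (f h phi : R -> R) :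
  1 < p -> (0 < m)%N ->
  (forall x, unit_itv x -> f x = h x * phi x) ->
  (forall x, unit_itv x -> 0 < h x) -> concave_on unit_itv h ->
  (forall x, unit_itv x -> 0 < phi x) -> power_concave_on m%:R^-1 unit_itv phi ->
  0 <= k -> k * (16 * (6144 * p ^+ 2) * (pi_p p `^ p + 1)) <= 1 ->
  exists z d : R, [/\ 3 / 8 < z < 5 / 8, is_derive z 1 h d &
    ((pi_p p `^ p + k * (d / h z) ^+ 2)%:E <= mu_p p unit_itv f)%E].
Proof.
move=> p1 m0; rewrite /unit_itv/= => fE0 h0' ch phi0' cphi k0 kle.
have time_base nu D nu1 D08 nulam :=
  @riccati_time_base p nu (p / (p - 1)) k D p1 nu1 erefl D08 k0 kle nulam.
clear kle.
have uE x : (0 < x < 1) = (x \in `]0%R, 1%R[) by rewrite in_itv.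
have fE x : 0 < x < 1 -> f x = h x * phi x by rewrite uE; exact: fE0.
have h0 x : 0 < x < 1 -> 0 < h x by rewrite uE; exact: h0'.
have phi0 x : 0 < x < 1 -> 0 < phi x by rewrite uE; exact: phi0'.
have f0 x : 0 < x < 1 -> 0 < f x by move=> x01; rewrite fE// mulr_gt0 ?h0 ?phi0.
have c3h := concave_on_concave3 ch.
have sh := concave3_slopes c3h.
have c3p := concave3_power m0 phi0 cphi.
have lf x : 0 < x < 1 -> ln (f x) = ln (h x) + ln (phi x).
  by move=> x01; rewrite fE// lnM ?posrE ?h0 ?phi0.
have c3f : concave3 (fun x => ln (f x)).
  have c := concave3_add (concave3_comp_ln h0 c3h) c3p.
  move=> x y t x01 y01 t01; rewrite !lf//; first exact: c.
  have /andP[x0 x1] := x01; have /andP[y0 y1] := y01.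
  by rewrite conv_gt ?conv_lt.
have sL := concave3_slopes c3f.
have [z [d [z58 dz tan]]] := exists_tangent_pt sh h0 (ltac:(lra) : 0 < 1 / 2)
  (ltac:(lra) : 1 / 2 < 5 / 8) (ltac:(lra) : 5 / 8 < 1).
have [z' [d' [z38 dz' tan']]] := exists_tangent_pt sh h0 (ltac:(lra) : 0 < 3 / 8)
  (ltac:(lra) : 3 / 8 < 1 / 2) (ltac:(lra) : 1 / 2 < 1).
pose D := Num.min ((d / h z) ^+ 2) ((d' / h z') ^+ 2).
have D0 : 0 <= D by rewrite le_min !sqr_ge0.
have D8 : D <= 8 by rewrite ge_min (tangent_log_slope_sqr h0 z58 tan).
have lower : ((pi_p p `^ p + k * D)%:E <= mu_p p unit_itv f)%E.
  apply: mu_p_lower_bound => //.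
  - by have := pi_p_powR_ge2 p1; have := mulr_ge0 k0 D0; lra.
  - exact: (measurable_log_concave f0 sL).
  move=> nu /andP[nu1 nulam].
  have D08 : 0 <= D <= 8 by rewrite D0.
  have [S [Sp base]] := time_base nu D nu1 D08 nulam.
  apply: (concave_product_two_fields p1 nu1 erefl Sp D0 base h0 sh f0
    (concave3_slopes c3p) lf sL z58 tan z38 tan').
  - by rewrite ge_min lexx.
  - by rewrite ge_min lexx orbT.
have [Dz|Dz] := leP ((d / h z) ^+ 2) ((d' / h z') ^+ 2).
  exists z, d; split=> //; first lra.
  by move: lower; rewrite /D min_l.
exists z', d'; split=> //; first lra.
by move: lower; rewrite /D min_r// ltW.
Qed.
End concave_product.

(** * The constants *)

Section constants.
Context {R : realType}.
Let mu := @lebesgue_measure R.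

(* [lebesgue_tuple] integrates sections of sets not known to be measurable. *)
Lemma ge0_le_integralT (f g : R -> \bar R) : (forall x, 0 <= f x)%E ->
  (forall x, f x <= g x)%E -> (\int[mu]_x f x <= \int[mu]_x g x)%E.
Proof.
move=> f0 fg; rewrite !ge0_integralTE//; last by move=> x; exact: le_trans (fg x).
by apply: le_ereal_sup => _ [s sf <-]; exists s => // x; exact: le_trans (fg x).
Qed.

(** Induction by slicing: slices of a subset of the cube lie in the smaller cube, and those outside
    [[-1, 1]] are empty, which is why the value at the empty set is carried along. *)
Lemma lebesgue_tuple_cube (n : nat) : @lebesgue_tuple R n set0 = 0%E /\
  forall A : set (n.-tuple R), (forall x, A x -> forall i, `|tnth x i| <= 1) ->
  (0 <= lebesgue_tuple A <= (2 ^+ n)%:E)%E.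
Proof.
elim: n => [|n [IH0 IH]] /=.
  split; first by rewrite diracE in_set0.
  by move=> A _; rewrite diracE expr0; case: (_ \in _); rewrite /= ?lee_fin ?lexx ?ler01.
have E (A : set (n.+1.-tuple R)) : @lebesgue_tuple R n.+1 A =
    (\int[mu]_x lebesgue_tuple [set y : n.-tuple R | A [tuple of x :: y]])%E.
  rewrite /= /pushforward /product_measure1; apply: eq_integral => x _ /=.
  congr lebesgue_tuple; apply/seteqP; split => y /=.
    by rewrite /xsection/= inE.
  by rewrite /xsection/= inE.
split.
  rewrite [LHS]E; apply: integral0_eq => x _.
  by rewrite -IH0; congr lebesgue_tuple; apply/seteqP; split.
move=> A A1.
pose g (x : R) := lebesgue_tuple [set y : n.-tuple R | A [tuple of x :: y]].
have gE x : (0 <= g x <= (2 ^+ n * \1_(`[-1, 1]%classic : set R) x)%:E)%E.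
  rewrite /g indicE; have [x1|x1] := boolP (x \in _).
    rewrite mulr1; apply: IH => y Ay i; have := A1 _ Ay (lift ord0 i).
    by rewrite tnthS.
  rewrite mulr0 (_ : [set y | _] = set0) ?IH0 ?lexx//.
  apply/seteqP; split=> // y Ay; move/negP: x1; apply; rewrite inE/= in_itv/=.
  by have := A1 _ Ay ord0; rewrite tnth0 ler_norml.
have := E A; rewrite /= => ->; rewrite integral_ge0/=; last by move=> x _; case/andP: (gE x).
apply: (@le_trans _ _ (\int[mu]_x (2 ^+ n * \1_(`[-1, 1]%classic : set R) x)%:E)%E).
  by apply: ge0_le_integralT => x; case/andP: (gE x).
under eq_integral do rewrite EFinM.
rewrite ge0_integralZl//; last first.
  by apply/measurable_EFinP; exact: measurable_indic.
have m2 : mu `[-1, 1] = 2%:E.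
  rewrite /mu lebesgue_measure_itv/= lte_fin ifT; last lra.
  by rewrite -EFinB opprK.
rewrite integral_indic// setIT [X in (_ * X)%E]m2.
by rewrite -EFinM lee_fin exprSr.
Qed.

Lemma omega_bounds (n : nat) : 0 <= @omega R n <= 2 ^+ n.
Proof.
have [_ /(_ (@unit_ball R n))] := lebesgue_tuple_cube n.
have ub (x : n.-tuple R) : unit_ball x -> forall i, `|tnth x i| <= 1.
  rewrite /unit_ball/= => x1 i.
  have : tnth x i ^+ 2 <= 1.
    apply: le_trans (ltW x1); rewrite (bigD1 i)//= lerDl.
    by apply: sumr_ge0 => j _; exact: sqr_ge0.
  by rewrite -real_normK ?num_real// expr_le1.
move=> /(_ ub); rewrite /omega; case: (lebesgue_tuple _) => [r| |] //=.
by rewrite leye_eq andbF.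
Qed.

(** If [omega k] is 0, its inverse is 0 by convention and the whole constant vanishes; otherwise the
    three groups of factors are at least 4, 4 and 1. *)
Lemma K_infty_bound (k : nat) : (1 < k)%N -> @K_infty R k = 0 \/ 16 <= @K_infty R k.
Proof.
move=> k1; have /andP[w0 w2] := omega_bounds k.
have [wE|wn] := eqVneq (@omega R k) 0.
  by left; rewrite /K_infty wE invr0 mulr0 !mul0r.
right; have w1 : 0 < @omega R k by rewrite lt0r wn.
have kR : 2 <= k%:R :> R by rewrite ler_nat.
have h1 : 4 <= 2 ^+ (2 * k)%N * (@omega R k)^-1.
  rewrite ler_pdivlMr//; apply: (@le_trans _ _ (2 ^+ 2 * 2 ^+ k)).
    by rewrite -natrX; apply: ler_pM.
  rewrite mul2n -addnn exprD; apply: ler_wpM2r; first by rewrite exprn_ge0.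
  by apply: ler_weXn2l => //; rewrite ler1n.
have h2 : 4 <= (1 + 4 * k%:R ^+ k.+1) ^+ k :> R.
  have h : 4 <= 1 + 4 * k%:R ^+ k.+1 :> R.
    have : 1 <= k%:R ^+ k.+1 :> R by apply: exprn_ege1; lra.
    by lra.
  apply: le_trans h _; rewrite -[leLHS]expr1; apply: ler_weXn2l; last exact: ltnW.
  by rewrite lerDl mulr_ge0// exprn_ge0.
have h3 : 1 <= (k%:R / (k%:R - 1)) ^+ (k * (k - 1))%N :> R.
  by apply: exprn_ege1; rewrite ler_pdivlMr ?mul1r; lra.
rewrite /K_infty (_ : 16 = 4 * 4 * 1); last by ring.
apply: ler_pM; [by []|by []| |exact: h3].
by apply: ler_pM; [by []|by []|exact: h1|exact: h2].
Qed.

(** The integral [J] is at most 1, so its negative power is at least 1; should [J] be 0, that power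
    is 0 by convention, which falls under the first alternative. *)
Lemma gamma_bound (p : R) (m : nat) : 1 < p -> (0 < m)%N -> gamma p m = 0 \/
  16 * (pi_p p `^ p + 1) `^ (m.+1%:R / p) <= gamma p m.
Proof.
move=> p1 m0; have p0 : 0 < p by lra.
rewrite /gamma; set J := Rintegral _ _ _.
have cJ : continuous (fun x : R => Num.min x (1 - x) ^+ m.+1).
  move=> x.
  apply: (@continuous_comp _ _ _ (fun y : R => Num.min y (1 - y)) (fun y => y ^+ m.+1));
    last exact: exprn_continuous.
  apply: continuous_min; first exact: cvg_id.
  by apply: cvgB; [exact: cvg_cst|exact: cvg_id].
have iJ : mu.-integrable `[0, 1] (EFin \o (fun x : R => Num.min x (1 - x) ^+ m.+1)).
  apply: continuous_compact_integrable; first exact: segment_compact.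
  exact: continuous_subspaceT.
have J0 : 0 <= J.
  apply: Rintegral_ge0 => x /=; rewrite in_itv/= => /andP[x0 x1].
  by rewrite exprn_ge0// le_min x0 subr_ge0.
have J1 : J <= 1.
  have -> : 1 = \int[mu]_(x in `[0, 1]) (cst 1 x) :> R.
    by rewrite Rintegral_cst//= lebesgue_measure_itv/= lte_fin ltr01 -EFinB/= subr0 mul1r.
  apply: le_Rintegral_itv => //.
    apply: continuous_compact_integrable; first exact: segment_compact.
    by apply: continuous_subspaceT => x; exact: cvg_cst.
  move=> x /andP[x0 x1]; apply: exprn_ile1; first by rewrite le_min x0 subr_ge0.
  by rewrite ge_min x1.
have [->|K0] := @K_infty_bound m.+1 (ltac:(by [])).
  by left; rewrite !mul0r.
have [JE|Jn] := eqVneq J 0.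
  by left; rewrite JE powR0 ?mulr0// oppr_eq0 invr_eq0 gt_eqF.
right.
have Jp : 1 <= J `^ (- p^-1).
  have Jpos : 0 < J by rewrite lt0r Jn.
  rewrite powRN invf_ge1 ?powR_gt0//.
  rewrite (_ : 1 = 1 `^ p^-1); last by rewrite powR1.
  by apply: ge0_ler_powR; rewrite ?nnegrE ?invr_ge0// ltW.
rewrite -[leLHS]mulr1; apply: ler_pM; [|by []| |exact: Jp].
  by rewrite mulr_ge0 ?powR_ge0.
by rewrite ler_wpM2r ?powR_ge0.
Qed.
End constants.

Section K1_bound.
Context {R : realType}.

Lemma M_bounds (p a s t : R) : 1 < p -> 0 <= a <= 2 -> 0 <= s <= 1 -> 0 <= M p a s t <= 1.
Proof.
move=> p1 /andP[a0 a2] /andP[s0 s1]; rewrite /M.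
have b00 : 0 <= b0 p a s t by rewrite le_min powR_ge0 andbT divr_ge0.
have b01 : b0 p a s t <= 1.
  by apply: (@le_trans _ _ (a / 2)); [rewrite ge_min lexx|lra].
move: (b0 p a s t) b00 b01 => b b00 b01.
have powR1_le (x r : R) : 0 <= x -> x <= 1 -> 0 <= r -> x `^ r <= 1.
  move=> x0 x1 r0; rewrite (_ : 1 = 1 `^ r); last by rewrite powR1.
  by apply: ge0_ler_powR; rewrite ?nnegrE.
have q01 : 0 <= ((p - 1) / p) `^ (p - 1) <= 1.
  rewrite powR_ge0 powR1_le//; try lra.
    by rewrite divr_ge0//; lra.
  by rewrite ler_pdivrMr; lra.
have /andP[q0 q1] := q01.
case: ifP => _; apply/andP; split.
- rewrite mulr_ge0// le_min mulr_ge0 ?invr_ge0 ?exprn_ge0//= mulr_ge0 ?powR_ge0//.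
  by rewrite divr_ge0.
- rewrite mulr_ile1//.
    rewrite le_min mulr_ge0 ?invr_ge0 ?exprn_ge0//= mulr_ge0 ?powR_ge0//.
    by rewrite divr_ge0.
  rewrite ge_min; apply/orP; left.
  have : b ^+ 2 <= 1 by rewrite exprn_ile1.
  by lra.
- by rewrite !mulr_ge0 ?powR_ge0.
have bp : b `^ (p - 1) <= 1 by rewrite powR1_le//; lra.
have sp : s `^ p <= 1 by rewrite powR1_le//; lra.
rewrite mulr_ile1 ?mulr_ge0 ?powR_ge0// mulr_ile1 ?mulr_ge0 ?powR_ge0//.
by rewrite mulr_ile1 ?powR_ge0// invf_le1 ?ler1n.
Qed.

Lemma powR_ge1 (x r : R) : 1 <= x -> 0 <= r -> 1 <= x `^ r.
Proof. by move=> x1 r0; rewrite -(powRr0 x); apply: ler_powR. Qed.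

Lemma powR16_ge (p : R) : 1 < p -> 16 <= 16 `^ p :> R /\ p <= 16 `^ p.
Proof.
move=> p1; split; first by apply: le1r_powR; [rewrite ler1n|exact: ltW].
have l16 : 1 <= ln 16 :> R.
  rewrite -[leLHS]expRK ler_ln ?posrE ?expR_gt0//.
  (* Squaring gives [expR (- 1) >= 1/4], that is, [e <= 4 <= 16]. *)
  have h : 1 / 2 <= expR (- (1 / 2)) :> R by apply: le_trans (expR_ge1Dx _); lra.
  have : (1 / 2) ^+ 2 <= expR (- (1 / 2)) ^+ 2 :> R.
    by rewrite lerXn2r ?nnegrE ?expR_ge0//; lra.
  rewrite -expRM_natl (_ : 2 * - (1 / 2) = - 1); last by field.
  rewrite expRN => h2; rewrite -[leRHS]invrK -[leLHS]invrK lef_pV2 ?posrE ?invr_gt0 ?expR_gt0//.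
  by apply: le_trans h2; lra.
rewrite /powR gt_eqF//; apply: le_trans (_ : expR p <= _).
  by apply: le_trans (expR_ge1Dx p); lra.
by rewrite ler_expR ler_pMr//; lra.
Qed.

(* The exponential factor of [K1] alone is small enough. *)
Lemma K1_K3_bounds (p : R) (m : nat) : 1 < p -> (0 < m)%N ->
  16 * (pi_p p `^ p + 1) `^ (m.+1%:R / p) <= gamma p m ->
  [/\ 0 <= K1 p m, K1 p m * (16 * (6144 * p ^+ 2) * (pi_p p `^ p + 1)) <= 1 &
      K3 p m <= 3 / 8].
Proof.
move=> p1 m0; rewrite /K1 /K3; have n2 := pi_p_powR_ge2 p1.
have c0 : 0 < 6144 :> R by rewrite ltr0n.
(* In the lower bound [32 (16^p n^2)^3] for the exponent [x], the cube of [16^p] pays for [16 p^2],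
   and [n^6] for [3^5 n] since [n >= 3]; the rest is this inequality. *)
have c1 : 6144 <= 32 * 3 ^+ 5 :> R by lra.
move: (gamma p m) (pi_p p `^ p) (6144 : R) n2 c0 c1 => g nu0 c nu2 c0 c1 gb.
have p0 : 0 < p by lra.
have n3 : 3 <= nu0 + 1 by lra.
move: (nu0 + 1) n3 gb => n n3 gb.
have n0 : 0 < n by lra.
have n1 : 1 <= n by lra.
have [y16 yp] := powR16_ge p1.
have gp : 16 `^ p * n ^+ 2 <= g `^ p.
  apply: (@le_trans _ _ ((16 * n `^ (m.+1%:R / p)) `^ p)); last first.
    have G0 : 0 <= 16 * n `^ (m.+1%:R / p) by rewrite mulr_ge0 ?powR_ge0.
    by apply: ge0_ler_powR; rewrite ?nnegrE ?(ltW p0)//; exact: le_trans gb.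
  rewrite powRM ?powR_ge0// -powRrM divfK ?gt_eqF// powR_mulrn ?(ltW n0)//.
  by rewrite ler_pM2l ?powR_gt0//; apply: ler_weXn2l.
have g1 : 1 <= g.
  apply: le_trans gb; apply: mulr_ege1; first by rewrite ler1n.
  by apply: powR_ge1 => //; rewrite divr_ge0// ltW.
have g0 : 0 < g by lra.
have gp1 : 1 <= g `^ p by apply: powR_ge1 => //; exact: ltW.
set x := m.+1%:R * 2 ^+ (m + 3)%N * g `^ (p * (m + 2)%:R).
(* From [m >= 1]: the factors are at least 2 and [2^4], and [g^p >= 1] occurs with exponent at least
   3. *)
have xlb : 32 * (16 `^ p * n ^+ 2) ^+ 3 <= x.
  rewrite /x; apply: ler_pM => //.
  - by rewrite exprn_ge0// mulr_ge0 ?powR_ge0// exprn_ge0// ltW.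
  - rewrite (_ : 32 = 2 * 2 ^+ 4); last by ring.
    apply: ler_pM => //; first by rewrite ler_nat.
    by apply: ler_weXn2l; [rewrite ler1n|rewrite -(add1n 3) leq_add2r].
  rewrite powRrM powR_mulrn ?powR_ge0//.
  apply: (@le_trans _ _ ((g `^ p) ^+ 3)).
    by rewrite lerXn2r ?nnegrE ?mulr_ge0 ?powR_ge0 ?exprn_ge0// ltW.
  by apply: ler_weXn2l => //; rewrite -(add1n 2) leq_add2r.
have C0 : 0 < 16 * (c * p ^+ 2) * n by rewrite !mulr_gt0 ?exprn_gt0.
have Cx : 16 * (c * p ^+ 2) * n <= x.
  apply: le_trans xlb.
  have h1 : 16 * p ^+ 2 <= (16 `^ p) ^+ 3.
    by rewrite [leRHS]exprS ler_pM ?sqr_ge0// lerXn2r ?nnegrE ?powR_ge0// ltW.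
  have h2 : 3 ^+ 5 * n <= (n ^+ 2) ^+ 3.
    rewrite -exprM (_ : (2 * 3)%N = 5.+1)// [leRHS]exprSr; apply: ler_pM; [by rewrite exprn_ge0|exact: ltW| |exact: lexx].
    by rewrite lerXn2r ?nnegrE// ltW.
  have pn0 : 0 <= p ^+ 2 * n by rewrite mulr_ge0 ?exprn_ge0 ?ltW.
  have h3 : 16 * (c * p ^+ 2) * n <= 32 * ((16 * p ^+ 2) * (3 ^+ 5 * n)).
    have -> : 16 * (c * p ^+ 2) * n = (16 * c) * (p ^+ 2 * n) by ring.
    have -> : 32 * ((16 * p ^+ 2) * (3 ^+ 5 * n)) = (16 * (32 * 3 ^+ 5)) * (p ^+ 2 * n) by ring.
    by apply: ler_wpM2r => //; apply: ler_wpM2l => //; lra.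
  apply: le_trans h3 _; apply: ler_wpM2l => //; rewrite exprMn; apply: ler_pM => //.
  - by rewrite mulr_ge0// exprn_ge0// ltW.
  - by rewrite mulr_ge0// ltW.
have ex : expR (- x) * (16 * (c * p ^+ 2) * n) <= 1.
  have x0 : 0 < x by exact: lt_le_trans Cx.
  rewrite expRN mulrC ler_pdivrMr ?expR_gt0// mul1r.
  by apply: le_trans Cx _; apply: le_trans (expR_ge1Dx x); rewrite lerDr.
have A1 : 0 <= (2 `^ (p - 1)^-1)^-1 <= (1 : R).
  rewrite invr_ge0 powR_ge0 invf_le1 ?powR_gt0// powR_ge1 ?ler1n//.
  by rewrite invr_ge0; lra.
have E1 : 1 <= g `^ ((2 * p ^+ 2 - p) / (p - 1)).
  apply: powR_ge1 => //; rewrite divr_ge0//; last lra.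
  have : p * 1 <= p * p by rewrite ler_pM2l// ltW.
  by rewrite expr2; lra.
have M1 : 0 <= M p (4 * g `^ p)^-1 ((4 * g) `^ (p - 1)^-1)^-1 ((4 * g `^ p) ^+ m.+1 * n) <= 1.
  apply: M_bounds => //.
    rewrite invr_ge0 mulr_ge0 ?powR_ge0//=.
    by apply: (@le_trans _ _ 1); [rewrite invf_le1; lra|rewrite ler1n].
  rewrite invr_ge0 powR_ge0/= invf_le1 ?powR_gt0 ?mulr_gt0//.
  by apply: powR_ge1; [lra|rewrite invr_ge0; lra].
move: (M _ _ _ _) M1 => M0 /andP[M00 M01].
case/andP: A1 => A0 A1.
have e0 := expR_ge0 (- x).
have eE0 : 0 <= expR (- x) / g `^ ((2 * p ^+ 2 - p) / (p - 1)).
  by rewrite divr_ge0// powR_ge0.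
split.
- by apply: mulr_ge0; [exact: mulr_ge0|].
- apply: le_trans ex; apply: ler_wpM2r; first exact: ltW.
  apply: (@le_trans _ _ (expR (- x) / g `^ ((2 * p ^+ 2 - p) / (p - 1)))).
    rewrite -mulrA mulrCA -[leRHS]mulr1; apply: ler_wpM2l => //.
    by rewrite mulr_ile1.
  rewrite -[leRHS]mulr1; apply: ler_wpM2l => //.
  by rewrite invf_le1// (lt_le_trans ltr01).
(* As [g ^ p >= 1], [K3] is at most [1/4]. *)
rewrite -[leRHS]invrK lef_pV2 ?posrE ?invr_gt0 ?mulr_gt0 ?powR_gt0//.
lra.
Qed.
End K1_bound.

Unset Implicit Arguments.
Set Strict Implicit.

Theorem proposition15 (R : realType) (p : R) (m : nat) (f h phi : R -> R) :
  1 < p -> (0 < m)%N ->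
  ess_norm unit_itv f = 1%E ->
  (forall x, unit_itv x -> f x = h x * phi x) ->
  (forall x, unit_itv x -> 0 < h x) ->
  concave_on unit_itv h ->
  (forall x, unit_itv x -> 0 < phi x) ->
  power_concave_on m%:R^-1 unit_itv phi ->
  (mu_p p unit_itv f <= (pi_p p `^ p + 1)%:E)%E ->
  ((pi_p p `^ p)%:E +
     (K1 p m)%:E *
     ereal_inf [set ((h^`()%classic x / h x) ^+ 2)%:E |
                 x in [set x : R | (K3 p m <= x <= 1 - K3 p m)%R /\
                                   derivable h x 1%R]]
   <= mu_p p unit_itv f)%E.
Proof.
move=> p1 m0 _ fE h0 ch phi0 cphi _.
have lower k : 0 <= k -> k * (16 * (6144 * p ^+ 2) * (pi_p p `^ p + 1)) <= 1 -> _ :=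
  fun k0 kle => mu_p_concave_product p1 m0 fE h0 ch phi0 cphi k0 kle.
(* If [gamma] is 0, then [K1] is 0 through division by a zero power, and the claim is the bound by
   [pi_p ^ p] alone, the case [k = 0]. *)
have [g0|/(K1_K3_bounds p1 m0)[k0 kle K38]] := gamma_bound p1 m0.
  have e0 : (2 * p ^+ 2 - p) / (p - 1) != 0.
    rewrite gt_eqF// divr_gt0 ?subr_gt0// expr2.
    have : 1 * p < p * p by rewrite ltr_pM2r ?(lt_trans ltr01).
    by lra.
  have -> : K1 p m = 0 by rewrite /K1 g0 [0 `^ (_ / _)]powR0// invr0 mulr0 mulr0 mul0r.
  have [|z [d [_ _]]] := lower 0 (lexx 0); first by rewrite mul0r ler01.
  by rewrite mul0r addr0 mul0e adde0.
have [z [d [z38 dz]]] := lower _ k0 kle; apply: le_trans.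
rewrite [leRHS]EFinD; apply: leeD2l; rewrite [leRHS]EFinM.
apply: lee_wpmul2l; first by rewrite lee_fin.
(* The infimum is at most its value at [z], which is admissible because [K3 <= 3/8 < z < 5/8]. *)
apply: ereal_inf_lbound; exists z.
  by split; [clear -z38 K38; lra|case: dz].
by rewrite derive1E (@derive_val _ _ _ _ _ _ _ dz).
Qed.
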